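(* Let $N\ge 2$, $s\in(0,1)$, and let $\mathcal K_s$, $P_s$, $C_{N,s}$, $\tau_E$, $\sigma_s$ and $E_t$ be as described in the context. Let $E\subset\mathbb{R}^N$ be an open set such that $\partial E$ is of class $C^{1,\beta}$ for some $\beta>2s$ if $s\in(0,\tfrac12)$, and $\partial E$ is of class $C^3$ if $s\in[\tfrac12,1)$. For $y\in\partial E$ let $\nu(y)$ be the unit exterior normal of $E$ at $y$, and for $t>0$ small let $v(t,y)\in\mathbb{R}$ be any number such that $$y+v(t,y)\,t\,\nu(y)\in \partial E_t\cap B\big(y,\sigma_s(t)^{\frac1{2s}}\big).$$ Then, as $t\to0$, locally uniformly in $y\in\partial E$, $$ v(t,y)=\begin{cases} a_{N,s}\,H_s(y)+o_t(1) & \text{if } s\in(0,\tfrac12),\\[4pt] b_N(t)\,H(y)+O\!\left(\dfrac{1}{\log(\sigma_{1/2}(t))}\right) & \text{if } s=\tfrac12,\\[8pt] c_{N,s}\,H(y)+O\!\left(t^{\frac{2s-1}{2}}\right) & \text{if } s\in(\tfrac12,1), \end{cases} $$ where $o_t(1)\to0$ as $t\to0$, $H_s$ and $H$ are the fractional and normalized classical mean curvatures of $\partial E$ (defined in the context), and $$ a_{N,s}=\frac{C_{N,s}}{2\int_{\mathbb{R}^{N-1}}P_s(y',0)\,dy'},\qquad b_N(t)=\frac{\int_{B^{N-1}_{\sigma_{1/2}(t)^{-1}}}|y'|^2P_{1/2}(y',0)\,dy'}{2\,|\log(\sigma_{1/2}(t))|\int_{\mathbb{R}^{N-1}}P_{1/2}(y',0)\,dy'},\qquad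 c_{N,s}=\frac{\int_{\mathbb{R}^{N-1}}|y'|^2P_s(y',0)\,dy'}{2\int_{\mathbb{R}^{N-1}}P_s(y',0)\,dy'}, $$ with $B^{N-1}_\rho$ the ball of radius $\rho$ centred at $0$ in $\mathbb{R}^{N-1}$.
   Context: Kernel: $\mathcal K_s(x,t)=t^{-\frac{N}{2s}}P_s(t^{-\frac1{2s}}x)$ for $x\in\mathbb{R}^N$, $t>0$, where $P_s\in C^1(\mathbb{R}^N)$ is radially symmetric (so $P_s=\mathcal K_s(\cdot,1)$), and there are constants $\mathcal C_{N,s}>0$, $C_{N,s}>0$ with $$\frac{\mathcal C_{N,s}^{-1}}{1+|y|^{N+2s}}\le P_s(y)\le\frac{\mathcal C_{N,s}}{1+|y|^{N+2s}},\qquad |\nabla P_s(y)|\le\frac{\mathcal C_{N,s}}{1+|y|^{N+2s+1}}\quad(y\in\mathbb{R}^N),$$ and $\lim_{t\to0}t^{-1}\mathcal K_s(y,t)=\frac{C_{N,s}}{|y|^{N+2s}}$ locally uniformly in $\mathbb{R}^N\setminus\{0\}$. (Examples: the fractional heat kernel, i.e. the kernel with Fourier transform $e^{-t|\xi|^{2s}}$; or $\overline K_s(x,t^{1/2s})$ with $\overline K_s(x,t)=t^{-N}p_{N,s}(1+|x/t|^2)^{-\frac{N+2s}{2}}$.) For an open set $E$, $\tau_E=\mathbb 1_E-\mathbb 1_{\mathbb{R}^N\setminus\overline E}$, $u(x,t)=\int_{\mathbb{R}^N}\mathcal K_s(x-y,t)\tau_E(y)\,dy$, and $E_t=\{x\in\mathbb{R}^N: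 u(x,\sigma_s(t))>0\}$, where $\sigma_s(t)=t^{\frac{2s}{1+2s}}$ for $s\in(0,\frac12)$, $\sigma_s(t)=t^s$ for $s\in(\frac12,1)$, and $\sigma_{1/2}(t)$ is the unique positive solution of $t=\sigma_{1/2}(t)^2|\log(\sigma_{1/2}(t))|$. Fractional mean curvature ($s\in(0,\frac12)$): $H_s(x)=\lim_{\varepsilon\to0}\int_{\mathbb{R}^N\setminus B_\varepsilon(x)}\frac{\tau_E(y)}{|x-y|^{N+2s}}\,dy$ for $x\in\partial E$. Normalized mean curvature: for $x\in\partial E$, after a rigid motion taking $x$ to $0$ and the exterior normal $\nu(x)$ to $e_N$, near $0$ the set $E$ is $\{y_N<\gamma(y')\}$ with $\gamma(0)=0$, $\nabla\gamma(0)=0$, and $H(x)=\frac{\Delta\gamma(0)}{N-1}$ (the average of the principal curvatures, with the convention that $H=-1/R$ on the boundary of a ball of radius $R$). $O(f(t))$ denotes a quantity bounded by $C|f(t)|$ for a constant $C$.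
   Formalization: For small t the equation t = σ²|log σ| has three positive solutions, so ''the unique positive solution'' is undefined; σ_{1/2}(t) is taken to be the solution in (0, e^{-1/2}], the one tending to 0 as t→0. *)

(* Defs.v *)
From HB Require Import structures.
From mathcomp Require Import all_boot all_order all_algebra.
From mathcomp Require Import all_classical all_reals all_analysis.
Set Implicit Arguments. Unset Strict Implicit. Unset Printing Implicit Defensive.
Import Order.TTheory GRing.Theory Num.Theory.
Import numFieldNormedType.Exports.
Local Open Scope classical_set_scope.
Local Open Scope ring_scope.

Section Defs.
Variable R : realType.

(* Euclidean norm on R^m (the library norm on matrices is the sup norm). *)
Definition enorm (m : nat) (x : 'rV[R]_m) : R :=
  Num.sqrt (\sum_(i < m) x 0 i ^+ 2).

Definition evec (m : nat) (i : 'I_m) : 'rV[R]_m := delta_mx 0 i.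

Definition partial (m : nat) (i : 'I_m) (f : 'rV[R]_m -> R) : 'rV[R]_m -> R :=
  fun x => 'D_(evec i) f x.

Definition gradnorm (m : nat) (f : 'rV[R]_m -> R) (x : 'rV[R]_m) : R :=
  Num.sqrt (\sum_(i < m) (partial i f x) ^+ 2).

Definition laplacian (m : nat) (f : 'rV[R]_m -> R) (x : 'rV[R]_m) : R :=
  \sum_(i < m) partial i (partial i f) x.

Fixpoint Ck (m : nat) (k : nat) (f : 'rV[R]_m -> R) : Prop :=
  match k with
  | 0 => continuous f
  | k'.+1 => continuous f /\
      forall i : 'I_m, (forall x, derivable f x (evec i)) /\ Ck k' (partial i f)
  end.

Definition consr (m : nat) (x : R) (y : 'rV[R]_m) : 'rV[R]_m.+1 :=
  \row_(j < m.+1) (if unlift ord0 j is Some k then y 0 k else x).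

Definition extl (m : nat) (y' : 'rV[R]_m) (h : R) : 'rV[R]_m.+1 :=
  \row_(j < m.+1) (if unlift ord_max j is Some k then y' 0 k else h).

Definition front (m : nat) (w : 'rV[R]_m.+1) : 'rV[R]_m :=
  \row_(i < m) w 0 (widen_ord (leqnSn m) i).

(* Lebesgue integral over R^m of a real function, computed as an iterated
   one-dimensional Lebesgue integral (equal to the R^m Lebesgue integral for
   integrable f, by Fubini). *)
Fixpoint intRN (m : nat) : ('rV[R]_m -> R) -> R :=
  match m return ('rV[R]_m -> R) -> R with
  | 0 => fun f => f 0
  | m'.+1 => fun f =>
      fine (\int[@lebesgue_measure R]_x
              ((intRN (fun y : 'rV[R]_m' => f (consr x y)))%:E))%E
  end.

Definition bdry (m : nat) (A : set 'rV[R]_m) : set 'rV[R]_m :=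
  closure A `\` interior A.

Definition tauE (m : nat) (E : set 'rV[R]_m) (y : 'rV[R]_m) : R :=
  \1_E y - \1_(~` closure E) y.

Definition Kern (m : nat) (s : R) (P : 'rV[R]_m -> R) (x : 'rV[R]_m) (t : R) : R :=
  t `^ (- (m%:R / (2 * s))) * P (t `^ (- (2 * s)^-1) *: x).

Definition uE (m : nat) (s : R) (P : 'rV[R]_m -> R) (E : set 'rV[R]_m)
  (x : 'rV[R]_m) (t : R) : R :=
  intRN (fun y => Kern s P (x - y) t * tauE E y).

(* sigma_{1/2}(t): the solution sigma in (0, e^{-1/2}] of sigma^2 |log sigma| = t
   (the map sigma |-> sigma^2 |log sigma| increases on (0, e^{-1/2}]), written as
   a supremum; it is the solution for 0 < t <= 1/(2e). *)
Definition sigma_half (t : R) : R :=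
  sup [set sg : R | 0 < sg <= expR (- 2^-1) /\ sg ^+ 2 * `|ln sg| <= t].

Definition sigma_s (s t : R) : R :=
  if s < 2^-1 then t `^ (2 * s / (1 + 2 * s))
  else if s == 2^-1 then sigma_half t
  else t `^ s.

Definition Et (m : nat) (s : R) (P : 'rV[R]_m -> R) (E : set 'rV[R]_m) (t : R)
  : set 'rV[R]_m :=
  [set x | 0 < uE s P E x (sigma_s s t)].

Definition Hs (m : nat) (s : R) (E : set 'rV[R]_m) (x : 'rV[R]_m) : R :=
  lim ((fun eps : R => intRN (fun y =>
          if enorm (y - x) < eps then 0
          else tauE E y / enorm (x - y) `^ (m%:R + 2 * s))) @ 0^'+).

Definition kernel_hyp (m : nat) (s : R) (P : 'rV[R]_m -> R) (CC CNs : R) : Prop :=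
  [/\ 0 < CC /\ 0 < CNs,
      Ck 1 P,
      (forall x y, enorm x = enorm y -> P x = P y),
      (forall y, CC^-1 / (1 + enorm y `^ (m%:R + 2 * s)) <= P y /\
                 P y <= CC / (1 + enorm y `^ (m%:R + 2 * s))) /\
      (forall y, gradnorm P y <= CC / (1 + enorm y `^ (m%:R + 2 * s + 1)))
    &
      (forall K : set 'rV[R]_m, compact K -> K `<=` ~` [set 0] ->
        forall eps, 0 < eps -> exists2 d, 0 < d & forall t y, 0 < t < d -> K y ->
          `| t^-1 * Kern s P y t - CNs / enorm y `^ (m%:R + 2 * s)| <= eps)].

(* A boundary chart of E at x in R^(n+1): a rigid motion z |-> (z - x) M
   (M orthogonal) taking x to 0, a radius r > 0 and gamma : R^n -> R with
   gamma(0) = 0, grad gamma(0) = 0 such that, in the ball B(x,r), E is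
   {w_N < gamma(w')} in the new coordinates w. *)
Definition bchart (n : nat) (E : set 'rV[R]_n.+1) (x : 'rV[R]_n.+1)
  (M : 'M[R]_n.+1) (r : R) (gamma : 'rV[R]_n -> R) : Prop :=
  [/\ M *m M^T = 1%:M, 0 < r, gamma 0 = 0,
      (forall i, derivable gamma 0 (evec i) /\ partial i gamma 0 = 0)
    & forall z, enorm (z - x) < r ->
        (E z <-> ((z - x) *m M) 0 ord_max < gamma (front ((z - x) *m M)))].

(* exterior unit normal at x given by a chart: nu(x) M = e_N *)
Definition chart_normal (n : nat) (M : 'M[R]_n.+1) : 'rV[R]_n.+1 :=
  evec ord_max *m M^T.

Definition C1beta_boundary (n : nat) (E : set 'rV[R]_n.+1) (beta : R)
  (nu : 'rV[R]_n.+1 -> 'rV[R]_n.+1) : Prop :=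
  forall x, bdry E x -> exists M r gamma, bchart E x M r gamma /\ Ck 1 gamma /\
    (exists Cg, forall i y z, enorm y < r -> enorm z < r ->
        `|partial i gamma y - partial i gamma z| <= Cg * enorm (y - z) `^ beta) /\
    nu x = chart_normal M.

Definition C3_boundary (n : nat) (E : set 'rV[R]_n.+1)
  (nu : 'rV[R]_n.+1 -> 'rV[R]_n.+1) (H : 'rV[R]_n.+1 -> R) : Prop :=
  forall x, bdry E x -> exists M r gamma, bchart E x M r gamma /\ Ck 3 gamma /\
    nu x = chart_normal M /\ H x = laplacian gamma 0 / n%:R.

Definition admissible (n : nat) (s : R) (P : 'rV[R]_n.+1 -> R)
  (E : set 'rV[R]_n.+1) (nu : 'rV[R]_n.+1 -> 'rV[R]_n.+1)
  (t : R) (y : 'rV[R]_n.+1) (v : R) : Prop :=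
  bdry (Et s P E t) (y + (v * t) *: nu y) /\
  enorm ((y + (v * t) *: nu y) - y) < sigma_s s t `^ (2 * s)^-1.

Definition aNs (n : nat) (s : R) (P : 'rV[R]_n.+1 -> R) (CNs : R) : R :=
  CNs / (2 * intRN (fun y' => P (extl y' 0))).

Definition bN (n : nat) (P : 'rV[R]_n.+1 -> R) (t : R) : R :=
  intRN (fun y' => (if enorm y' < (sigma_half t)^-1 then 1 else 0) *
                   enorm y' ^+ 2 * P (extl y' 0))
  / (2 * `|ln (sigma_half t)| * intRN (fun y' => P (extl y' 0))).

Definition cNs (n : nat) (P : 'rV[R]_n.+1 -> R) : R :=
  intRN (fun y' => enorm y' ^+ 2 * P (extl y' 0))
  / (2 * intRN (fun y' => P (extl y' 0))).

End Defs.

(* Main.v *)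
Require Import Defs.
From HB Require Import structures.
From mathcomp Require Import all_boot all_order all_algebra.
From mathcomp Require Import all_classical all_reals all_analysis.
From mathcomp Require Import measurable_realfun.
From mathcomp Require Import ring lra.
Import Order.TTheory GRing.Theory Num.Theory.
Import numFieldNormedType.Exports.
Local Open Scope classical_set_scope.
Local Open Scope ring_scope.
Set Implicit Arguments.
Unset Strict Implicit.
Unset Printing Implicit Defensive.

(** Blow up at a boundary point [y] by [lam = sigma_s t `^ (2 s)^-1], with the normal as first axis
    [e]. Then [u = 0] at the point [y + (v t) nu] becomes
    [0 = \int P (d e - w) tau (y + lam w) dw] with [d = v t / lam]. By oddness, replacing
    [tau (y + lam w)] by minus the sign of [w_0 - d] gives the value [0], so the equation
    balances two deviations from the flat interface through [0]: the displacement contributes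
    [2 d \int P (0, w') dw' + O (d ^ 2)], and the rest comes from the set where [E] differs from
    a half-space.

    For [s < 1/2] this set, scaled back and divided by [lam `^ (2 s)], gives the singular
    integral [C_{N,s} H_s], because [K_s / t] tends to [C_{N,s} / |y| ^ (N + 2 s)] and the
    [C^{1,beta}] regularity with [beta > 2 s] makes it integrable near [0]. For [s >= 1/2] the
    set is, up to a cubic error, bounded by the hyperplane and the graph of the quadratic form
    [Q] of the second fundamental form; since [P] is radial, only the trace of [Q] survives, and
    [|d \int P (0, w') dw' - lam (H / 2) \int_{|w'| < 1 / lam} |w'| ^ 2 P (0, w') dw'|] is at
    most [C lam `^ (2 s)]. *)

(** * Lebesgue measure on row vectors *)

(** Freezing [P] on the hyperplane costs an error of order [d ^ 2], so the size of [d] must be known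
    before the equation can be solved for it. This is the role of [apriori]: contact of order [e]
    with the tangent hyperplane gives [|d| <= C lam ^ b] for every [b <= 2 s] with [1 + b < e]. When
    [s < 1/2], the choice [b = 2 s] makes [d ^ 2] negligible against [lam ^ (2 s)]. When [s >= 1/2],
    the contact is only quadratic and [b < 1] is forced; [b = s] brings [d ^ 2] exactly to the
    permitted error [lam ^ (2 s)]. The boundary enters only through [sandwich], whose single
    constant can be chosen for a whole compact set; uniformity in [y] comes from there. The
    integrals of the statement are iterated one-dimensional ones, for which rotations are not a
    visible symmetry. They are therefore identified with integrals for a measure [muV], whose
    invariance under rotations and dilations follows from the uniqueness of Haar measure. *)

Definition rV_display : measure_display.
Proof. exact. Qed.

Section MeasurableRV.
Variables (R : realType) (m : nat).

(** The sigma-algebra is the one generated by the coordinates, so that maps into row vectors are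
    tested coordinate by coordinate. That it contains the open sets is [open_measurable_rV]. *)
Definition rVcoord (i : 'I_m) (x : 'rV[R]_m) : measurableTypeR R := x ord0 i.

Let rV_set0 : g_sigma_preimage rVcoord set0.
Proof. exact: sigma_algebra0. Qed.

Let rV_setC A : g_sigma_preimage rVcoord A -> g_sigma_preimage rVcoord (~` A).
Proof. exact: sigma_algebraC. Qed.

Let rV_bigcup (F : _^nat) : (forall i, g_sigma_preimage rVcoord (F i)) ->
  g_sigma_preimage rVcoord (\bigcup_i (F i)).
Proof. exact: sigma_algebra_bigcup. Qed.

HB.instance Definition _ := @isMeasurable.Build rV_display
  'rV[R]_m (g_sigma_preimage rVcoord) rV_set0 rV_setC rV_bigcup.

End MeasurableRV.

Section SigmaFinitePack.
Context d (T : measurableType d) (R : realType) (nu : {measure set T -> \bar R}).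
Hypothesis sf : sigma_finite setT nu.

Let nu_copy : set T -> \bar R := nu.
HB.instance Definition _ := Measure.on nu_copy.
HB.instance Definition _ := Measure_isSigmaFinite.Build _ _ _ nu_copy sf.

(** A bundled measure together with its value as a set function: the recursion [muV] needs the
    bundle, computations rewrite with the equation. *)
Lemma sigma_finite_sig :
  {nu' : {sigma_finite_measure set T -> \bar R} | nu' = nu :> (set T -> \bar R)}.
Proof. by exists nu_copy. Qed.

End SigmaFinitePack.

Section MeasurableRVTheory.
Variable R : realType.

Lemma measurable_rVcoord m (i : 'I_m) :
  measurable_fun [set: 'rV[R]_m] (fun x => x ord0 i : measurableTypeR R).
Proof.
move=> _ Y mY; rewrite setTI; apply: sub_sigma_algebra => /=.
rewrite -bigcup_seq/=; exists i => /=; first by rewrite mem_index_enum.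
by exists Y => //; rewrite setTI.
Qed.

Lemma measurable_fun_rVP d (T : measurableType d) m (f : T -> 'rV[R]_m) :
  (forall i, measurable_fun [set: T] (fun x => f x ord0 i : measurableTypeR R)) ->
  measurable_fun [set: T] f.
Proof.
move=> mf.
have key : g_sigma_preimage (fun i => rVcoord i \o f) `<=` measurable.
  apply: smallest_sub; first exact: sigma_algebra_measurable.
  case: m f mf => [|n] f mf; first by rewrite big_ord0.
  rewrite -bigcup_mkord_ord; apply: bigcup_sub => i Ii.
  by move=> A [B mB <-]; exact: mf.
rewrite g_sigma_preimage_comp in key.
by move=> _ A mA; apply: key; exists A.
Qed.

Lemma measurable_consr m :
  measurable_fun [set: measurableTypeR R * 'rV[R]_m]
    (fun z => consr z.1 z.2 : 'rV[R]_m.+1).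
Proof.
apply: measurable_fun_rVP => i.
case: (unliftP ord0 i) => [j ->|->].
  apply: (eq_measurable_fun (fun z : measurableTypeR R * 'rV[R]_m => z.2 ord0 j : measurableTypeR R)).
    by move=> z _; rewrite mxE liftK.
  apply: (@measurableT_comp _ _ _ _ _ _ (fun x : 'rV[R]_m => x ord0 j : measurableTypeR R)) => //.
  exact: measurable_rVcoord.
apply: (eq_measurable_fun (fun z : measurableTypeR R * 'rV[R]_m => z.1)).
  by move=> z _; rewrite mxE unlift_none.
exact: measurable_fst.
Qed.

Definition tailr m (x : 'rV[R]_m.+1) : 'rV[R]_m := \row_i x ord0 (lift ord0 i).

Lemma consr_tailr m (x : 'rV[R]_m.+1) : consr (x ord0 ord0) (tailr x) = x.
Proof.
apply/rowP => i; rewrite mxE; case: unliftP => [j ->|->//].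
by rewrite mxE.
Qed.

Lemma consr0 m (h : R) (x : 'rV[R]_m) : consr h x ord0 ord0 = h.
Proof. by rewrite mxE unlift_none. Qed.

Lemma consr_lift m (h : R) (x : 'rV[R]_m) i : consr h x ord0 (lift ord0 i) = x ord0 i.
Proof. by rewrite mxE liftK. Qed.

Lemma tailr_consr m (h : R) (x : 'rV[R]_m) : tailr (consr h x) = x.
Proof. by apply/rowP => i; rewrite mxE consr_lift. Qed.

Lemma measurable_tailr m : measurable_fun [set: 'rV[R]_m.+1] (@tailr m).
Proof.
apply: measurable_fun_rVP => i.
apply: (eq_measurable_fun (fun z : 'rV[R]_m.+1 => z ord0 (lift ord0 i) : measurableTypeR R)).
  by move=> z _; rewrite mxE.
exact: measurable_rVcoord.
Qed.

Lemma pushforward_sig d d' (T : measurableType d) (U : measurableType d')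
    (mu : {measure set T -> \bar R}) (f : T -> U) : measurable_fun setT f ->
  {nu : {measure set U -> \bar R} | nu = pushforward mu f :> (set U -> \bar R)}.
Proof.
move=> mf; unshelve eexists.
  unshelve refine (pushforward mu f : {measure set U -> \bar R}); exact: mf.
by [].
Qed.

Lemma consr_measure m (nu : {sigma_finite_measure set 'rV[R]_m -> \bar R}) :
  {nu' : {sigma_finite_measure set 'rV[R]_m.+1 -> \bar R} |
    nu' = pushforward (@lebesgue_measure R \x nu)%E (fun z => consr z.1 z.2) :> (set _ -> \bar R)}.
Proof.
pose phi := (fun z => consr z.1 z.2 : 'rV[R]_m.+1) : (measurableTypeR R * 'rV[R]_m)%type -> 'rV[R]_m.+1.
have mphi : measurable_fun setT phi := @measurable_consr m.
pose psi := fun x : 'rV[R]_m.+1 => (x ord0 ord0 : measurableTypeR R, tailr x).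
have mpsi : measurable_fun setT psi.
  apply/measurable_fun_pairP; split; first exact: measurable_rVcoord.
  exact: measurable_tailr.
have [nu0 nu0E] := pushforward_sig (@lebesgue_measure R \x nu)%E mphi.
(* [psi] inverts [consr], so products of the two exhaustions pull back to an exhaustion. Both
   increase, hence the common index [maxn i j]. *)
have sf : sigma_finite setT nu0.
  have /sigma_finiteP[F [FT Fnd Foo]] := sigma_finiteT (@lebesgue_measure R).
  have /sigma_finiteP[G [GT Gnd Goo]] := sigma_finiteT nu.
  exists (fun i => psi @^-1` (F i `*` G i)).
    apply/seteqP; split => // x _.
    have : setT (psi x).1 by [].
    rewrite FT => -[i _ Fi]; have : setT (psi x).2 by [].
    rewrite GT => -[j _ Gj]; exists (maxn i j) => //; split.
      by move: Fi; apply/subsetPset/Fnd/leq_maxl.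
    by move: Gj; apply/subsetPset/Gnd/leq_maxr.
  move=> i; have [mF Fi] := Foo i; have [mG Gi] := Goo i; split.
    by rewrite -[X in measurable X]setTI; apply: mpsi => //; exact: measurableX.
  rewrite nu0E /pushforward.
  suff -> : phi @^-1` (psi @^-1` (F i `*` G i)) = F i `*` G i.
    have := product_measure1E (@lebesgue_measure R) nu mF mG; rewrite /= => ->.
    by rewrite lte_mul_pinfty // ge0_fin_numE.
  by apply/seteqP; split => -[x y]; rewrite /= /psi /= ?consr0 ?tailr_consr.
have [nu' nu'E] := sigma_finite_sig sf.
by exists nu'; rewrite nu'E.
Qed.

Lemma dirac0_measure :
  {nu' : {sigma_finite_measure set 'rV[R]_0 -> \bar R} |
    nu' = \d_(0 : 'rV[R]_0) :> (set _ -> \bar R)}.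
Proof. by exists (\d_(0 : 'rV[R]_0)). Qed.

(** Lebesgue measure on R^m, built by prepending one coordinate at a time so that its integral
    unfolds in the same order as [intRN]. *)
Fixpoint muV (m : nat) : {sigma_finite_measure set 'rV[R]_m -> \bar R} :=
  match m with
  | 0 => sval dirac0_measure
  | m'.+1 => sval (consr_measure (muV m'))
  end.

Local Open Scope ereal_scope.

Lemma ge0_integral_muVS m (f : 'rV[R]_m.+1 -> \bar R) :
  measurable_fun setT f -> (forall x, 0 <= f x) ->
  \int[muV m.+1]_x f x =
  \int[@lebesgue_measure R]_x \int[muV m]_y f (consr x y).
Proof.
move=> mf f0.
rewrite /= (svalP (consr_measure (muV m))).
rewrite ge0_integral_pushforward //; last exact: measurable_consr.
rewrite preimage_setT (fubini_tonelli1 (m1 := @lebesgue_measure R) (m2 := muV m)) //=.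
exact: (measurableT_comp mf (@measurable_consr m)).
Qed.

Lemma integrable_muVS m (f : 'rV[R]_m.+1 -> \bar R) :
  (muV m.+1).-integrable setT f ->
  (@lebesgue_measure R \x muV m).-integrable setT (fun z => f (consr z.1 z.2)).
Proof.
move=> /integrableP[mf fi]; apply/integrableP; split.
  exact: (measurableT_comp mf (@measurable_consr m)).
rewrite (fubini_tonelli1 (m1 := @lebesgue_measure R) (m2 := muV m)) //=; last first.
  apply: measurableT_comp => //; exact: (measurableT_comp mf (@measurable_consr m)).
rewrite ge0_integral_muVS // in fi.
exact: measurableT_comp.
Qed.

Lemma integral_muVS m (f : 'rV[R]_m.+1 -> \bar R) :
  (muV m.+1).-integrable setT f ->
  \int[muV m.+1]_x f x =
  \int[@lebesgue_measure R]_x \int[muV m]_y f (consr x y).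
Proof.
move=> fi.
rewrite /= (svalP (consr_measure (muV m))).
rewrite integral_pushforward //=; first last.
- by rewrite preimage_setT; exact: integrable_muVS.
- by have /integrableP[] := fi.
- exact: measurable_consr.
by rewrite preimage_setT -integral12_prod_meas1 //; exact: integrable_muVS.
Qed.

Lemma integral_muV0 (f : 'rV[R]_0 -> \bar R) : measurable_fun setT f ->
  \int[muV 0]_x f x = f 0%R.
Proof.
move=> mf.
rewrite /= (svalP dirac0_measure).
by rewrite integral_dirac // diracT mul1e.
Qed.

Lemma measurable_section m (f : 'rV[R]_m.+1 -> \bar R) (x : R) :
  measurable_fun setT f -> measurable_fun setT (fun y => f (consr x y)).
Proof.
move=> mf; apply: measurableT_comp => //.
apply: (@measurableT_comp _ _ _ _ _ _ (fun z : measurableTypeR R * 'rV[R]_m => consr z.1 z.2) _ (fun y => (x, y))).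
  exact: measurable_consr.
exact: pair1_measurable.
Qed.

(** Integrability of every section, not of almost every one: the [fine] that [intRN] takes at each
    level then never meets an infinite value, and the identification with [muV] is an induction free
    of null sets. *)
Fixpoint hintegrable m : ('rV[R]_m -> R) -> Prop :=
  match m return ('rV[R]_m -> R) -> Prop with
  | 0 => fun f => measurable_fun setT f
  | m'.+1 => fun f => (muV m'.+1).-integrable setT (EFin \o f) /\
      forall x, hintegrable (fun y => f (consr x y))
  end.

Lemma hintegrable_integrable m (f : 'rV[R]_m -> R) : hintegrable f ->
  (muV m).-integrable setT (EFin \o f).
Proof.
case: m f => [|m] f /=; last by case.
move=> mf; apply/integrableP; split; first exact/measurable_EFinP.
rewrite integral_muV0 ?ltry //.
by do 2! apply: measurableT_comp => //.
Qed.

Lemma intRN_Rintegral m (f : 'rV[R]_m -> R) : hintegrable f ->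
  intRN f = Rintegral (muV m) setT f.
Proof.
elim: m f => [|m IH] f /=.
  move=> mf; rewrite /Rintegral integral_muV0 //; exact/measurable_EFinP.
move=> [fi fs]; rewrite /Rintegral integral_muVS //=; congr fine.
apply: eq_integral => x _; rewrite IH //.
by rewrite /Rintegral fineK //; apply: integrable_fin_num => //; exact: hintegrable_integrable.
Qed.

Lemma hintegrable_le m (f g : 'rV[R]_m -> R) : measurable_fun setT f ->
  (forall x, `|f x| <= g x)%R -> hintegrable g -> hintegrable f.
Proof.
elim: m f g => [|m IH] f g mf fg //= [gi gs]; split.
  apply: le_integrable gi => //; first exact/measurable_EFinP.
  by move=> x _ /=; rewrite lee_fin (le_trans (fg x)) // ler_norm.
move=> x; apply: (IH _ (fun y => g (consr x y))) => //.
apply/measurable_EFinP.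
by apply: (@measurable_section _ (EFin \o f)); exact/measurable_EFinP.
Qed.

End MeasurableRVTheory.

(** * Euclidean geometry of row vectors *)

Section Euclid.
Variable R : realType.

Definition dotp m (x y : 'rV[R]_m) : R := \sum_(i < m) x 0 i * y 0 i.

Lemma dotpE m (x y : 'rV[R]_m) : dotp x y = (x *m y^T) 0 0.
Proof. by rewrite mxE; apply: eq_bigr => i _; rewrite mxE. Qed.

Lemma dotpC m (x y : 'rV[R]_m) : dotp x y = dotp y x.
Proof. by apply: eq_bigr => i _; rewrite mulrC. Qed.

Lemma dotpDl m (x y z : 'rV[R]_m) : dotp (x + y) z = dotp x z + dotp y z.
Proof. by rewrite -big_split /=; apply: eq_bigr => i _; rewrite mxE mulrDl. Qed.

Lemma dotpZl m c (x z : 'rV[R]_m) : dotp (c *: x) z = c * dotp x z.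
Proof. by rewrite mulr_sumr; apply: eq_bigr => i _; rewrite mxE mulrA. Qed.

Lemma dotpDr m (x y z : 'rV[R]_m) : dotp x (y + z) = dotp x y + dotp x z.
Proof. by rewrite dotpC dotpDl !(dotpC x). Qed.

Lemma dotpZr m c (x z : 'rV[R]_m) : dotp x (c *: z) = c * dotp x z.
Proof. by rewrite dotpC dotpZl dotpC. Qed.

Lemma dotpNl m (x z : 'rV[R]_m) : dotp (- x) z = - dotp x z.
Proof. by rewrite -scaleN1r dotpZl mulN1r. Qed.

Lemma dotpNr m (x z : 'rV[R]_m) : dotp x (- z) = - dotp x z.
Proof. by rewrite dotpC dotpNl dotpC. Qed.

Lemma dotp_evec m (x : 'rV[R]_m) i : dotp x (evec R i) = x 0 i.
Proof.
rewrite /dotp (bigD1 i) //= big1 ?addr0; first by rewrite mxE !eqxx mulr1.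
by move=> j ji; rewrite mxE eqxx (negbTE ji) mulr0.
Qed.

Lemma dotp_mulmx m (M : 'M[R]_m) (x y : 'rV[R]_m) : M *m M^T = 1%:M ->
  dotp (x *m M) (y *m M) = dotp x y.
Proof. by move=> MM; rewrite !dotpE trmx_mul mulmxA -(mulmxA x) MM mulmx1. Qed.

Lemma dotp_mulmxT m (M : 'M[R]_m) (x y : 'rV[R]_m) :
  dotp (x *m M) y = dotp x (y *m M^T).
Proof. by rewrite !dotpE trmx_mul trmxK mulmxA. Qed.

Lemma enorm_ge0 m (x : 'rV[R]_m) : 0 <= enorm x.
Proof. exact: sqrtr_ge0. Qed.

Lemma sqr_enorm m (x : 'rV[R]_m) : enorm x ^+ 2 = dotp x x.
Proof.
rewrite sqr_sqrtr; first by apply: eq_bigr => i _; rewrite expr2.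
by apply: sumr_ge0 => i _; exact: sqr_ge0.
Qed.

Lemma enormE m (x : 'rV[R]_m) : enorm x = Num.sqrt (dotp x x).
Proof. by rewrite -sqr_enorm sqrtr_sqr ger0_norm // enorm_ge0. Qed.

Lemma enorm0 m : enorm (0 : 'rV[R]_m) = 0.
Proof. by rewrite enormE -(scale0r (0 : 'rV[R]_m)) dotpZl mul0r sqrtr0. Qed.

Lemma enormZ m c (x : 'rV[R]_m) : enorm (c *: x) = `|c| * enorm x.
Proof. by rewrite !enormE dotpZl dotpZr mulrA -expr2 sqrtrM ?sqr_ge0 // sqrtr_sqr. Qed.

Lemma enormN m (x : 'rV[R]_m) : enorm (- x) = enorm x.
Proof. by rewrite -scaleN1r enormZ normrN1 mul1r. Qed.

Lemma enorm_distC m (x y : 'rV[R]_m) : enorm (x - y) = enorm (y - x).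
Proof. by rewrite -opprB enormN. Qed.

Lemma ler_abs_coord_enorm m (x : 'rV[R]_m) i : `|x 0 i| <= enorm x.
Proof.
rewrite -sqrtr_sqr ler_wsqrtr // (bigD1 i) //= lerDl.
by apply: sumr_ge0 => j _; exact: sqr_ge0.
Qed.

Lemma enorm_eq0 m (x : 'rV[R]_m) : enorm x = 0 -> x = 0.
Proof.
move=> x0; apply/rowP => i; rewrite mxE; apply/eqP; rewrite -normr_eq0.
by rewrite -normr_le0 normr_id -x0 ler_abs_coord_enorm.
Qed.

Lemma enorm_gt0 m (x : 'rV[R]_m) : x != 0 -> 0 < enorm x.
Proof.
move=> x0; rewrite lt_def enorm_ge0 andbT; apply: contra x0 => /eqP xE.
by apply/eqP; exact: enorm_eq0.
Qed.

Lemma dotp_le m (x y : 'rV[R]_m) : `|dotp x y| <= enorm x * enorm y.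
Proof.
have [/eqP x0|x0] := boolP (enorm x == 0).
  by rewrite (enorm_eq0 x0) -(scale0r (0 : 'rV[R]_m)) dotpZl mul0r normr0 mulr_ge0 ?enorm_ge0.
have xp : 0 < enorm x by rewrite lt_def x0 enorm_ge0.
rewrite -(@ler_pXn2r _ 2) ?nnegrE ?mulr_ge0 ?enorm_ge0 //.
rewrite exprMn !sqr_enorm real_normK ?num_real //.
have xxp : 0 < dotp x x by rewrite -sqr_enorm exprn_gt0.
(* Cauchy-Schwarz: this squared norm equals [<x,x> (<x,x> <y,y> - <x,y> ^ 2)]. *)
have : 0 <= dotp (dotp x x *: y - dotp x y *: x) (dotp x x *: y - dotp x y *: x).
  by rewrite -sqr_enorm sqr_ge0.
rewrite !(dotpDl, dotpDr, dotpZl, dotpZr, dotpNl, dotpNr) (dotpC y x).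
set a := dotp x x in xxp *; set b := dotp x y; set c := dotp y y.
set e := (X in 0 <= X); have -> : e = a * (a * c - b ^+ 2) by rewrite /e; ring.
by rewrite pmulr_rge0 // subr_ge0.
Qed.

Lemma enorm_triangle m (x y : 'rV[R]_m) : enorm (x + y) <= enorm x + enorm y.
Proof.
rewrite -(@ler_pXn2r _ 2) ?nnegrE ?addr_ge0 ?enorm_ge0 //.
rewrite sqrrD !sqr_enorm dotpDl !dotpDr (dotpC y x).
have := dotp_le x y; have := ler_norm (dotp x y); lra.
Qed.

Lemma enorm_sum m k (F : 'I_k -> 'rV[R]_m) :
  enorm (\sum_i F i) <= \sum_i enorm (F i).
Proof.
elim/big_ind2 : _ => [|u a v b ua vb|//]; first by rewrite enorm0.
by rewrite (le_trans (enorm_triangle _ _)) // lerD.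
Qed.

Lemma enorm_le_sum m (x : 'rV[R]_m) : enorm x <= \sum_i `|x 0 i|.
Proof.
have s0 : 0 <= \sum_i `|x 0 i| by apply: sumr_ge0.
rewrite -(@ler_pXn2r _ 2) ?nnegrE ?enorm_ge0 // sqr_enorm expr2 mulr_suml.
apply: ler_sum => i _; rewrite (le_trans (ler_norm _)) // normrM ler_wpM2l //.
by rewrite (bigD1 i) //= lerDl sumr_ge0.
Qed.

Lemma enorm_le_max m (x : 'rV[R]_m) c : (forall i, `|x 0 i| <= c) -> enorm x <= m%:R * c.
Proof.
move=> xc; rewrite (le_trans (enorm_le_sum x)) //.
rewrite (@le_trans _ _ (\sum_(i < m) c)) //; first exact: ler_sum.
by rewrite sumr_const card_ord mulr_natl.
Qed.

Lemma enorm_mulmx m (M : 'M[R]_m) (x : 'rV[R]_m) : M *m M^T = 1%:M ->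
  enorm (x *m M) = enorm x.
Proof. by move=> MM; rewrite !enormE dotp_mulmx. Qed.

Lemma enorm_evec m i : enorm (evec R i : 'rV[R]_m) = 1.
Proof. by rewrite enormE dotp_evec mxE !eqxx sqrtr1. Qed.

Lemma dotp_consr m h k (x y : 'rV[R]_m) : dotp (consr h x) (consr k y) = h * k + dotp x y.
Proof.
rewrite /dotp big_ord_recl !mxE unlift_none; congr (_ + _).
by apply: eq_bigr => i _; rewrite !mxE liftK.
Qed.

Lemma sqr_enorm_consr m h (x : 'rV[R]_m) : enorm (consr h x) ^+ 2 = h ^+ 2 + enorm x ^+ 2.
Proof. by rewrite !sqr_enorm dotp_consr expr2. Qed.

Lemma enorm_consr_ge m h (x : 'rV[R]_m) : enorm x <= enorm (consr h x).
Proof.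
rewrite -(@ler_pXn2r _ 2) ?nnegrE ?enorm_ge0 // sqr_enorm_consr.
by rewrite lerDr sqr_ge0.
Qed.

Lemma enorm_consr_geh m h (x : 'rV[R]_m) : `|h| <= enorm (consr h x).
Proof. by have := ler_abs_coord_enorm (consr h x) ord0; rewrite mxE unlift_none. Qed.

Lemma consrD m h k (x y : 'rV[R]_m) : consr h x + consr k y = consr (h + k) (x + y).
Proof. by apply/rowP => i; rewrite !mxE; case: unliftP => //= j _; rewrite mxE. Qed.

Lemma consrZ m c h (x : 'rV[R]_m) : c *: consr h x = consr (c * h) (c *: x).
Proof. by apply/rowP => i; rewrite !mxE; case: unliftP => //= j _; rewrite mxE. Qed.

Lemma consrN m h (x : 'rV[R]_m) : - consr h x = consr (- h) (- x).
Proof. by rewrite -scaleN1r consrZ mulN1r scaleN1r. Qed.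

Lemma enorm_consr_le m h (x : 'rV[R]_m) : enorm (consr h x) <= `|h| + enorm x.
Proof.
rewrite -(@ler_pXn2r _ 2) ?nnegrE ?addr_ge0 ?enorm_ge0 // sqr_enorm_consr.
rewrite sqrrD real_normK ?num_real // -addrA lerD2l lerDr.
by rewrite mulrn_wge0 // mulr_ge0 ?enorm_ge0.
Qed.

Lemma enorm_consr0 m (x : 'rV[R]_m) : enorm (consr 0 x) = enorm x.
Proof. by rewrite !enormE dotp_consr mul0r add0r. Qed.

Lemma enorm_consrh0 m h : enorm (consr h (0 : 'rV[R]_m)) = `|h|.
Proof.
apply/eqP; rewrite eq_le enorm_consr_geh andbT.
by rewrite (le_trans (enorm_consr_le _ _)) // enorm0 addr0.
Qed.

Lemma dotp_extl m h k (x y : 'rV[R]_m) : dotp (extl x h) (extl y k) = h * k + dotp x y.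
Proof.
rewrite /dotp big_ord_recr !mxE unlift_none addrC; congr (_ + _).
apply: eq_bigr => i _.
have -> : widen_ord (leqnSn m) i = lift ord_max i.
  by apply/val_inj; rewrite /= /bump leqNgt ltn_ord.
by rewrite !mxE liftK.
Qed.

Lemma enorm_extl m h (x : 'rV[R]_m) : enorm (extl x h) = enorm (consr h x).
Proof. by rewrite !enormE dotp_extl dotp_consr. Qed.

Lemma extlD m h k (x y : 'rV[R]_m) : extl x h + extl y k = extl (x + y) (h + k).
Proof. by apply/rowP => i; rewrite !mxE; case: unliftP => //= j _; rewrite mxE. Qed.

Lemma extlZ m c h (x : 'rV[R]_m) : c *: extl x h = extl (c *: x) (c * h).
Proof. by apply/rowP => i; rewrite !mxE; case: unliftP => //= j _; rewrite mxE. Qed.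

(* The cyclic permutation of coordinates carrying [consr h x] to [extl x h]. *)
Definition rotmx m : 'M[R]_m.+1 := \matrix_i extl (tailr (evec R i)) ((evec R i : 'rV_m.+1) 0 0).

Lemma row_sum_evec m (x : 'rV[R]_m) : x = \sum_i x 0 i *: evec R i.
Proof.
apply/rowP => j; rewrite summxE (bigD1 j) //= big1 ?addr0; first by rewrite !mxE !eqxx mulr1.
by move=> i ij; rewrite !mxE eqxx eq_sym (negbTE ij) mulr0.
Qed.

Lemma evec_ord0 m : evec R (@ord0 m) = consr 1 0.
Proof.
apply/rowP => i; rewrite !mxE eqxx /=; case: unliftP => [j ->|->]; rewrite ?eqxx // mxE.
by rewrite eq_sym (negbTE (neq_lift _ _)).
Qed.

Lemma evec_lift m (i : 'I_m) : evec R (lift ord0 i) = consr 0 (evec R i).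
Proof.
apply/rowP => k; rewrite !mxE eqxx /=; case: unliftP => [j ->|->].
  by rewrite mxE eqxx (inj_eq lift_inj).
by rewrite (negbTE (neq_lift _ _)).
Qed.

Lemma row_rotmx0 m : row ord0 (rotmx m) = extl 0 1.
Proof. by rewrite rowK evec_ord0 tailr_consr consr0. Qed.

Lemma row_rotmxS m i : row (lift ord0 i) (rotmx m) = extl (evec R i) 0.
Proof. by rewrite rowK evec_lift tailr_consr consr0. Qed.

Lemma consr_rotmx m h (x : 'rV[R]_m) : consr h x *m rotmx m = extl x h.
Proof.
rewrite mulmx_sum_row big_ord_recl row_rotmx0 consr0 extlZ scaler0 mulr1.
under eq_bigr do rewrite row_rotmxS consr_lift extlZ mulr0.
rewrite (_ : \sum_(i < m) _ = extl x 0); first by rewrite extlD add0r addr0.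
rewrite [in RHS](row_sum_evec x).
by elim/big_rec2 : _ => [|i u v _ ->]; rewrite ?extlD ?addr0 //; apply/rowP => i; rewrite !mxE; case: unliftP => //= j _; rewrite mxE.
Qed.

Lemma rotmx_orth m : rotmx m *m (rotmx m)^T = 1%:M.
Proof.
apply/matrixP => i j; rewrite !mxE.
have H k : evec R k *m rotmx m = row k (rotmx m) by rewrite rowE.
transitivity (dotp (evec R i *m rotmx m) (evec R j *m rotmx m)).
  by rewrite /dotp; apply: eq_bigr => k _; rewrite !H !mxE.
rewrite -(consr_tailr (evec R i)) -(consr_tailr (evec R j)) !consr_rotmx.
rewrite dotp_extl -dotp_consr !consr_tailr dotp_evec mxE eqxx /=.
by rewrite eq_sym.
Qed.

Lemma front_extl m h (x : 'rV[R]_m) : front (extl x h) = x.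
Proof.
apply/rowP => i; rewrite !mxE.
have -> : widen_ord (leqnSn m) i = lift ord_max i.
  by apply/val_inj; rewrite /= /bump leqNgt ltn_ord.
by rewrite liftK.
Qed.

Lemma extl_max m h (x : 'rV[R]_m) : extl x h 0 ord_max = h.
Proof. by rewrite mxE unlift_none. Qed.

Lemma extl_front m (w : 'rV[R]_m.+1) : extl (front w) (w 0 ord_max) = w.
Proof.
apply/rowP => i; rewrite !mxE; case: unliftP => [j ->|-> //].
rewrite mxE; congr (w _ _); apply/val_inj; rewrite /= /bump leqNgt ltn_ord //.
Qed.

Lemma evec_max m : evec R (@ord_max m) = extl 0 1.
Proof.
apply/rowP => i; rewrite !mxE eqxx /=; case: unliftP => [j ->|->]; rewrite ?eqxx // mxE.
by rewrite eq_sym (negbTE (neq_lift _ _)).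
Qed.

(** The topology of row vectors is that of the sup norm, which lies between the Euclidean norm and
    its quotient by [m]; [m.+1] keeps the division meaningful when [m = 0]. *)
Lemma nbhs_enormP m (x : 'rV[R]_m) (A : set 'rV[R]_m) :
  nbhs x A <-> exists2 e, 0 < e & forall z, enorm (z - x) < e -> A z.
Proof.
split.
  move=> /nbhs_ballP [e /= e0 eA]; exists e => // z zx; apply: eA.
  rewrite -ball_normE /ball_ /= distrC.
  case: m x A z zx => [|m] x A z zx.
    by rewrite (_ : z - x = 0) ?normr0 //; apply/rowP => -[].
  rewrite [X in X < _]/Num.norm /= mx_normrE; apply/bigmax_ltP; split => //= -[i j] _.
  rewrite (ord1 i) /=.
  by rewrite (le_lt_trans _ zx) // ler_abs_coord_enorm.
move=> [e e0 eA]; apply/nbhs_ballP; exists (e / m.+1%:R) => /=; first by rewrite divr_gt0.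
move=> z zx; apply: eA; rewrite (@le_lt_trans _ _ (m%:R * (e / m.+1%:R))) //.
  move: zx; rewrite -ball_normE /ball_ /= [X in X < _]/Num.norm /= mx_normrE.
  move=> /bigmax_ltP[_ zx]; apply: enorm_le_max => i; rewrite !mxE distrC; apply: ltW.
  by have := zx (0, i) isT; rewrite /= !mxE.
by rewrite mulrCA gtr_pMr // ltr_pdivrMr // mul1r ltr_nat.
Qed.

Lemma continuous_enormP m (f : 'rV[R]_m -> R) x : {for x, continuous f} <->
  forall e, 0 < e -> exists2 d, 0 < d & forall z, enorm (z - x) < d -> `|f z - f x| < e.
Proof.
split => [fx e e0|H].
  have /cvgrPdist_lt /(_ e e0) /nbhs_enormP[d d0 dP] := fx.
  by exists d => // z /dP; rewrite distrC.
apply/(@cvgrPdist_lt _ _ _ (nbhs x) (nbhs_filter x)) => e /H [d d0 dP].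
by apply/nbhs_enormP; exists d => // z /dP; rewrite distrC.
Qed.

Lemma continuous_enorm m : continuous (@enorm R m).
Proof.
move=> x; apply/continuous_enormP => e e0; exists e => // z; apply: le_lt_trans.
rewrite ler_norml lerBlDr; apply/andP; split.
  rewrite lerNl opprB lerBlDr -[X in X <= _]enormN.
  by rewrite -(enormN (z - x)) opprB (le_trans _ (enorm_triangle _ _)) // enormN subrK.
by rewrite (le_trans _ (enorm_triangle _ _)) // subrK.
Qed.

Lemma enorm_continuous_map m k (f : 'rV[R]_m -> 'rV[R]_k) C :
  (forall x y, enorm (f x - f y) <= C * enorm (x - y)) -> continuous f.
Proof.
move=> fC x A /nbhs_enormP[e e0 eA]; apply/nbhs_enormP.
exists (e / (`|C| + 1)); first by rewrite divr_gt0 // ltr_wpDl.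
move=> z zx; apply: eA; rewrite (le_lt_trans (fC _ _)) //.
move: zx; rewrite ltr_pdivlMr ?ltr_wpDl //; apply: le_lt_trans.
rewrite mulrC ler_wpM2l ?enorm_ge0 //.
by rewrite (le_trans (ler_norm C)) // lerDl.
Qed.

End Euclid.

(** * Invariance of Lebesgue measure *)

Section Invariance.
Variable R : realType.

Lemma eq_indic (T U : Type) (A : set T) (B : set U) x y :
  (A x <-> B y) -> \1_A x = \1_B y :> R.
Proof.
by move=> [AB BA]; rewrite !indicE; congr (_%:R); congr nat_of_bool; apply/idP/idP; rewrite !inE.
Qed.

(** An open set is the union of the boxes it contains that have a rational centre and half-side
    [1 / (k + 1)], a countable family. Two points of such a box differ by less than [2 / (k + 1)] in
    each coordinate, which dictates how large [k] must be. *)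
Lemma open_measurable_rV m (U : set 'rV[R]_m) : open U -> measurable U.
Proof.
move=> oU.
pose itv (q : rat) (k : nat) : set (measurableTypeR R) :=
  [set` `](ratr q - k.+1%:R^-1 : R), (ratr q + k.+1%:R^-1)[].
pose box (z : 'rV[rat]_m * nat) : set 'rV[R]_m :=
  \bigcap_(i in [set: 'I_m]) ((fun x => x ord0 i) @^-1` itv (z.1 0 i) z.2).
have mbox z : measurable (box z).
  apply: fin_bigcap_measurable => [|i _]; first exact: finite_finset.
  rewrite -[X in measurable X]setTI; apply: measurable_rVcoord => //.
  exact: measurable_itv.
pose F z := if `[< box z `<=` U >] then box z else set0.
have -> : U = \bigcup_z F z.
  apply/seteqP; split => [x Ux|x [z _]]; last first.
    by rewrite /F; case: asboolP => // zU; exact: zU.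
  have /nbhs_enormP[e e0 eU] : nbhs x U by exact: open_nbhs_nbhs.
  have [k ke] : exists k, 0 + k.+1%:R^-1 < e / (m.+1%:R * 2).
    by apply: ltr_add_invr; rewrite divr_gt0.
  rewrite add0r in ke.
  have qP i : {q : rat | `|ratr q - x 0 i| < k.+1%:R^-1}.
    apply: cid; have [|q] := @rat_in_itvoo R (x 0 i - k.+1%:R^-1) (x 0 i + k.+1%:R^-1).
      by rewrite ltrD2l gtrN ?invr_gt0.
    by rewrite in_itv /= => qx; exists q; rewrite ltr_distl.
  exists (\row_i sval (qP i), k) => //.
  rewrite /F asboolT.
    by move=> i _; rewrite /preimage /itv /= in_itv /= mxE -ltr_distl distrC; exact: (svalP (qP i)).
  move=> y yb; apply: eU; apply: (@le_lt_trans _ _ (m%:R * (2 * k.+1%:R^-1))).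
    apply: enorm_le_max => i; rewrite !mxE.
    have : `|y 0 i - ratr (sval (qP i))| < k.+1%:R^-1.
      by have := yb i I; rewrite /preimage /itv /= in_itv /= mxE -ltr_distl.
    move=> yq.
    have qx := svalP (qP i); rewrite -(subrKA (ratr (sval (qP i)))).
    by rewrite (le_trans (ler_normD _ _)) // mulr_natl mulr2n lerD // ltW.
  apply: (@le_lt_trans _ _ (m.+1%:R * (2 * k.+1%:R^-1))).
    by rewrite ler_wpM2r ?mulr_ge0 ?ler_nat.
  by move: ke; rewrite ltr_pdivlMr ?mulr_gt0 // mulrC mulrA.
apply: countable_bigcupT_measurable; first exact: countableP.
by move=> z; rewrite /F; case: asboolP.
Qed.

Lemma continuous_measurable_rV m (f : 'rV[R]_m -> R) :
  continuous f -> measurable_fun setT f.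
Proof.
move=> /continuousP cf; apply: (measurability _ (RGenOpens.measurableE R)).
move=> _ [_ [a [b ->] <-]]; rewrite setTI; apply: open_measurable_rV.
exact/cf/interval_open.
Qed.

Lemma measurable_continuous_map m k (f : 'rV[R]_m -> 'rV[R]_k) :
  continuous f -> measurable_fun setT f.
Proof.
move=> cf; apply: measurable_fun_rVP => i; apply: continuous_measurable_rV => x.
apply: (@continuous_comp _ _ _ f (fun y : 'rV[R]_k => y ord0 i)); first exact: cf.
exact: coord_continuous.
Qed.

(** All changes of variables below are instances of this one: an identity between measures of sets,
    with a constant Jacobian [k], passes to integrals through the pushforward. *)
Lemma ge0_integral_scale_measure d d' (T : measurableType d) (U : measurableType d')
    (mu : {measure set T -> \bar R}) (nu : {measure set U -> \bar R})
    (phi : T -> U) (k : R) (f : U -> \bar R) :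
  measurable_fun setT phi -> 0 <= k ->
  (forall A, measurable A -> mu (phi @^-1` A) = (k%:E * nu A)%E) ->
  measurable_fun setT f -> (forall x, 0 <= f x)%E ->
  (\int[mu]_x f (phi x) = k%:E * \int[nu]_x f x)%E.
Proof.
move=> mphi k0 H mf f0.
have [nu' nu'E] := pushforward_sig mu mphi.
transitivity (\int[nu']_x f x)%E.
  by rewrite nu'E ge0_integral_pushforward.
rewrite -(@ge0_integral_mscale _ _ _ nu setT measurableT (NngNum k0) f) //.
apply: eq_measure_integral => A mA _.
by rewrite nu'E /pushforward H.
Qed.

Lemma integral_scale_measure d d' (T : measurableType d) (U : measurableType d')
    (mu : {measure set T -> \bar R}) (nu : {measure set U -> \bar R})
    (phi : T -> U) (k : R) (f : U -> R) :
  measurable_fun setT phi -> 0 <= k ->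
  (forall A, measurable A -> mu (phi @^-1` A) = (k%:E * nu A)%E) ->
  nu.-integrable setT (EFin \o f) ->
  mu.-integrable setT (EFin \o (f \o phi)) /\
  Rintegral mu setT (f \o phi) = k * Rintegral nu setT f.
Proof.
move=> mphi k0 H fi; have /integrableP[mf foo] := fi.
have E g : measurable_fun setT g -> (forall x, 0 <= g x)%E ->
    (\int[mu]_x g (phi x) = k%:E * \int[nu]_x g x)%E.
  exact: ge0_integral_scale_measure.
split.
  apply/integrableP; split; first exact: (measurableT_comp mf mphi).
  rewrite (E (abse \o (EFin \o f))) //=; last exact: measurableT_comp.
  by rewrite lte_mul_pinfty.
rewrite /Rintegral [in LHS]integralE [in RHS]integralE.
rewrite (eq_integral (fun x => ((EFin \o f) ^\+ (phi x))%E)); last first.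
  by move=> x _; rewrite !funeposE.
rewrite [X in (_ - X)%E](eq_integral (fun x => ((EFin \o f) ^\- (phi x))%E)); last first.
  by move=> x _; rewrite !funenegE.
rewrite (E ((EFin \o f) ^\+)%E) //; last exact: measurable_funepos.
rewrite (E ((EFin \o f) ^\-)%E) //; last exact: measurable_funeneg.
have i1 := integrable_fin_num measurableT (integrable_funepos measurableT fi).
have i2 := integrable_fin_num measurableT (integrable_funeneg measurableT fi).
rewrite -muleBr //; last by rewrite fin_num_adde_defr.
by rewrite fineM // fin_numB i1 i2.
Qed.

Lemma lebesgue_measure_translation (a : R) (A : set (measurableTypeR R)) :
  measurable A -> @lebesgue_measure R ((fun x => x + a) @^-1` A) = lebesgue_measure A.
Proof.
have ma : measurable_fun setT (fun x : measurableTypeR R => x + a : measurableTypeR R).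
  exact: measurable_funD.
have [nu nuE] := pushforward_sig (@lebesgue_measure R) ma.
suff H : forall X, ocitv X -> lebesgue_measure X = nu X.
  by move=> mA; rewrite (lebesgue_measure_unique H mA) nuE.
move=> X /ocitvP[->|[[u v] /= uv ->]]; first by rewrite !measure0.
rewrite nuE /pushforward.
have -> : (fun x : R => x + a) @^-1` `]u, v] = `](u - a), (v - a)]%classic.
  by apply/seteqP; split => x /=; rewrite !in_itv /= ltrBlDr lerBrDr.
rewrite [LHS]lebesgue_measure_itv [RHS](lebesgue_measure_itv `](u - a), (v - a)]) /= !lte_fin.
by rewrite uv ltrD2r uv -!EFinD; congr (_%:E); lra.
Qed.

Lemma ge0_integral_lebesgue_translation (a : R) (f : R -> \bar R) :
  measurable_fun [set: measurableTypeR R] f -> (forall x, 0 <= f x)%E ->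
  (\int[@lebesgue_measure R]_x f (x + a)%R = \int[@lebesgue_measure R]_x f x)%E.
Proof.
move=> mf f0.
rewrite (@ge0_integral_scale_measure _ _ (measurableTypeR R) (measurableTypeR R)
  (@lebesgue_measure R) (@lebesgue_measure R) (fun x => x + a) 1 f) ?mul1e //.
- exact: measurable_funD.
- by move=> A mA; rewrite mul1e; exact: lebesgue_measure_translation.
Qed.

Lemma measurable_translation m (a : 'rV[R]_m) :
  measurable_fun setT (fun x : 'rV[R]_m => x + a).
Proof.
apply: measurable_continuous_map; apply: (@enorm_continuous_map _ _ _ _ 1) => x y.
by rewrite mul1r opprD addrACA subrr addr0.
Qed.

Lemma ge0_integral_translation m (a : 'rV[R]_m) (f : 'rV[R]_m -> \bar R) :
  measurable_fun setT f -> (forall x, 0 <= f x)%E ->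
  (\int[muV R m]_x f (x + a)%R = \int[muV R m]_x f x)%E.
Proof.
elim: m a f => [|m IH] a f mf f0.
  by congr integral; apply/funext => x; congr f; apply/rowP => -[].
have mfa : measurable_fun setT (fun x : 'rV[R]_m.+1 => f (x + a)).
  exact: (measurableT_comp mf (measurable_translation a)).
rewrite (ge0_integral_muVS mfa (fun x => f0 _)) (ge0_integral_muVS mf f0).
transitivity (\int[@lebesgue_measure R]_x (\int[muV R m]_y f (consr (x + a ord0 ord0)%R y)))%E.
  apply: eq_integral => x _.
  rewrite -(IH (tailr a) (fun y => f (consr (x + a ord0 ord0)%R y))) //; last first.
    exact: measurable_section.
  by apply: eq_integral => y _; rewrite -[in LHS](consr_tailr a) consrD.
rewrite (@ge0_integral_lebesgue_translation (a ord0 ord0)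
  (fun x => \int[muV R m]_y f (consr x y))%E) //.
  apply: (@measurable_fun_fubini_tonelli_F _ _ _ _ _ (muV R m) (fun z : measurableTypeR R * 'rV[R]_m => f (consr z.1 z.2))) => //.
  exact: (measurableT_comp mf (@measurable_consr R m)).
by move=> x; exact: integral_ge0.
Qed.

(* Uniqueness of Haar measure: the two sides are the two orders of integration
   of [\1_B x * \1_A (x + T y)]. *)
Lemma haar_swap m (T T' : 'rV[R]_m -> 'rV[R]_m) (A B : set 'rV[R]_m) :
  measurable_fun setT T -> (forall x y, T (x + y) = T x + T y) ->
  (forall x, T (T' x) = x) ->
  measurable A -> measurable B -> (forall x, B x -> B (- x)) ->
  (muV R m (T @^-1` A) * muV R m B = muV R m (T @^-1` B) * muV R m A)%E.
Proof.
move=> mT Tadd TT' mA mB Bsym.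
have mTA C : measurable C -> measurable (T @^-1` C).
  by move=> mC; rewrite -[X in measurable X]setTI; exact: mT.
have mind C : measurable C -> measurable_fun [set: 'rV[R]_m] (\1_C : _ -> R).
  by move=> mC; exact: measurable_indic.
have ind1 C (c : 'rV[R]_m) : measurable C ->
    (\int[muV R m]_y (\1_C (c + T y)%R)%:E)%E = muV R m (T @^-1` C).
  move=> mC; rewrite -(setIT (T @^-1` C)) -integral_indic //; last exact: mTA.
  rewrite -(@ge0_integral_translation m (T' c) (fun y => (\1_(T @^-1` C) y)%:E)); last 2 first.
  - by apply/measurable_EFinP/measurable_indic; exact: mTA.
  - by move=> x; rewrite lee_fin.
  apply: eq_integral => y _; congr EFin; apply: eq_indic.
  by rewrite /preimage /= Tadd TT' addrC.
pose F (x y : 'rV[R]_m) := (\1_B x * \1_A (x + T y) : R).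
have mxy : measurable_fun setT (fun z : 'rV[R]_m * 'rV[R]_m => z.1 + T z.2).
  apply: measurable_fun_rVP => i.
  apply: (eq_measurable_fun (fun z : 'rV[R]_m * 'rV[R]_m => z.1 ord0 i + T z.2 ord0 i : measurableTypeR R)).
    by move=> z _; rewrite mxE.
  apply: measurable_funD.
    exact: (measurableT_comp (measurable_rVcoord i) measurable_fst).
  exact: (measurableT_comp (measurable_rVcoord i) (measurableT_comp mT measurable_snd)).
have mF : measurable_fun setT (fun z : 'rV[R]_m * 'rV[R]_m => (F z.1 z.2)%:E).
  apply/measurable_EFinP; apply: measurable_funM.
    by apply: measurableT_comp => //; exact: measurable_indic.
  by apply: (measurableT_comp _ mxy); exact: measurable_indic.
have F0 z : (0 <= (F z.1 z.2)%:E)%E by rewrite lee_fin mulr_ge0.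
have := @fubini_tonelli _ _ _ _ _ (muV R m) (muV R m) _ mF F0.
have -> : (\int[muV R m]_x \int[muV R m]_y (F (x, y).1 (x, y).2)%:E =
    muV R m (T @^-1` A) * muV R m B)%E.
  rewrite /= -[in RHS](setIT B) -integral_indic // -ge0_integralZl //; last first.
    by apply/measurable_EFinP; exact: measurable_indic.
  apply: eq_integral => x _; rewrite -(ind1 A x) // muleC -ge0_integralZl //.
  apply/measurable_EFinP.
  exact: (measurableT_comp (mind A mA) (measurableT_comp mxy (pair1_measurable x))).
move=> ->.
rewrite /= -[in RHS](setIT A) -integral_indic // -ge0_integralZl //; last first.
  by apply/measurable_EFinP; exact: measurable_indic.
transitivity (\int[muV R m]_y \int[muV R m]_x (\1_B (x - T y) * \1_A x)%:E)%E.
  apply: eq_integral => y _.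
  rewrite -(@ge0_integral_translation m (T y) (fun x => (\1_B (x - T y) * \1_A x)%:E)).
  - by apply: eq_integral => x _; rewrite addrK.
  - apply/measurable_EFinP; apply: measurable_funM; last exact: measurable_indic.
    by apply: measurableT_comp; [exact: measurable_indic|exact: measurable_translation].
  - by move=> x; rewrite lee_fin mulr_ge0.
have BE x y : (\1_B (x - T y) : R) = \1_B (- x + T y).
  by apply: eq_indic; split => /Bsym; rewrite opprD opprK.
have mG : measurable_fun setT (fun z : 'rV[R]_m * 'rV[R]_m => (\1_B (z.1 - T z.2) * \1_A z.1 : R)%:E).
  apply/measurable_EFinP; apply: measurable_funM; last first.
    by apply: measurableT_comp => //; exact: measurable_indic.
  apply: (measurableT_comp (mind B mB)).
  apply: measurable_fun_rVP => i.
  apply: (eq_measurable_fun (fun z : 'rV[R]_m * 'rV[R]_m => z.1 ord0 i - T z.2 ord0 i : measurableTypeR R)).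
    by move=> z _; rewrite !mxE.
  apply: measurable_funB.
    exact: (measurableT_comp (measurable_rVcoord i) measurable_fst).
  exact: (measurableT_comp (measurable_rVcoord i) (measurableT_comp mT measurable_snd)).
rewrite -(@fubini_tonelli _ _ _ _ _ (muV R m) (muV R m) _ mG); last first.
  by move=> z; rewrite lee_fin mulr_ge0.
apply: eq_integral => x _ /=; rewrite -(ind1 B (- x)) // muleC -ge0_integralZl //.
  by apply: eq_integral => y _; rewrite BE mulrC EFinM.
apply/measurable_EFinP.
exact: (measurableT_comp (mind B mB) (measurableT_comp mxy (pair1_measurable (- x)))).
Qed.

End Invariance.

(** * Rotations, dilations and translations under the integral sign *)

Section ChangeOfVariables.
Variable R : realType.

Definition cube m (r : R) : set 'rV[R]_m := [set x | forall i, `|x 0 i| < r].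
Arguments cube m r : clear implicits.

Lemma measurable_cube m r : measurable (cube m r).
Proof.
have -> : cube m r = \bigcap_(i in [set: 'I_m])
    ((fun x : 'rV[R]_m => x ord0 i : measurableTypeR R) @^-1` [set` `](- r), r[]).
  apply/seteqP; split => x xr i; last by have := xr i I; rewrite /preimage /= in_itv /= ltr_norml.
  by move=> _; rewrite /preimage /= in_itv /= -ltr_norml; exact: xr.
apply: fin_bigcap_measurable => [|i _]; first exact: finite_finset.
rewrite -[X in measurable X]setTI; exact: measurable_rVcoord.
Qed.

Lemma muV_cube m r : 0 <= r -> muV R m (cube m r) = ((2 * r) ^+ m)%:E.
Proof.
move=> r0; have E k : muV R k (cube k r) = (\int[muV R k]_x (\1_(cube k r) x)%:E)%E.
  by rewrite integral_indic ?setIT //; exact: measurable_cube.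
elim: m => [|m IH].
  rewrite E integral_muV0; last by apply/measurable_EFinP/measurable_indic; exact: measurable_cube.
  by rewrite expr0 indicE mem_set // => -[].
rewrite E ge0_integral_muVS; last 2 first.
- by apply/measurable_EFinP/measurable_indic; exact: measurable_cube.
- by move=> x; rewrite lee_fin.
pose D : set (measurableTypeR R) := [set` `](- r), r[].
transitivity (\int[@lebesgue_measure R]_x ((\1_D x)%:E * ((2 * r) ^+ m)%:E))%E.
  apply: eq_integral => x _; rewrite -IH E -ge0_integralZl //; last first.
    by apply/measurable_EFinP/measurable_indic; exact: measurable_cube.
  apply: eq_integral => y _; rewrite -EFinM; congr EFin.
  have [xr|xr] := boolP (`|x| < r).
    have -> : \1_D x = 1 :> R by rewrite indicE mem_set // /D /= in_itv /= -ltr_norml.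
    rewrite mul1r; apply: eq_indic; split => xyr i.
      by have := xyr (lift ord0 i); rewrite consr_lift.
    by case: (unliftP ord0 i) => [j ->|->]; rewrite ?consr_lift ?consr0.
  have -> : \1_D x = 0 :> R.
    by rewrite indicE memNset // /D /= in_itv /= -ltr_norml; exact/negP.
  rewrite mul0r indicE memNset // => /(_ ord0); rewrite consr0; exact/negP.
rewrite ge0_integralZr //; last 2 first.
- by apply/measurable_EFinP/measurable_indic; exact: measurable_itv.
- by rewrite lee_fin exprn_ge0 // mulr_ge0.
rewrite integral_indic //; last exact: measurable_itv.
rewrite setIT /D [X in (X * _)%E](lebesgue_measure_itv `](- r), r[) /= lte_fin.
case: ifPn => [_|]; first by rewrite -EFinD -EFinM exprS; congr (_ * _)%:E; lra.
rewrite -leNgt => r1; have -> : r = 0 by lra.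
by rewrite mul0e mulr0 exprS mul0r.
Qed.

Definition eball m (r : R) : set 'rV[R]_m := [set x | enorm x < r].
Arguments eball m r : clear implicits.

Lemma measurable_eball m r : measurable (eball m r).
Proof.
apply: open_measurable_rV; rewrite (_ : eball m r = (@enorm R m) @^-1` [set x | x < r]) //.
apply: open_comp; last exact: open_lt.
by move=> x _; exact: continuous_enorm.
Qed.

Lemma eball_cube m r : eball m r `<=` cube m r.
Proof. by move=> x xr i; rewrite (le_lt_trans (ler_abs_coord_enorm _ _)). Qed.

Lemma muV_eball_le m r : 0 <= r -> (muV R m (eball m r) <= ((2 * r) ^+ m)%:E)%E.
Proof.
move=> r0; rewrite -muV_cube //; apply: le_measure; rewrite ?inE.
- exact: measurable_eball.
- exact: measurable_cube.
- exact: eball_cube.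
Qed.

Lemma muV_eball_gt0 m r : 0 < r -> (0 < muV R m (eball m r))%E.
Proof.
move=> r0; apply: (@lt_le_trans _ _ (muV R m (cube m (r / m.+1%:R)))).
  by rewrite muV_cube ?divr_ge0 ?ltW // lte_fin exprn_gt0 // mulr_gt0 // divr_gt0.
apply: le_measure; rewrite ?inE.
- exact: measurable_cube.
- exact: measurable_eball.
- move=> x xr; apply: (@le_lt_trans _ _ (m%:R * (r / m.+1%:R))).
    by apply: enorm_le_max => i; apply: ltW.
  by rewrite mulrCA gtr_pMr // ltr_pdivrMr // mul1r ltr_nat.
Qed.

Lemma continuous_mulmxr m (M : 'M[R]_m) : continuous (fun x : 'rV[R]_m => x *m M).
Proof.
apply: (@enorm_continuous_map _ _ _ _ (m%:R * \sum_i enorm (row i M))) => x y.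
rewrite -mulmxBl mulmx_sum_row (le_trans (enorm_sum _)) //.
have m0 : 0 <= \sum_i enorm (row i M) by apply: sumr_ge0 => i _; exact: enorm_ge0.
apply: (@le_trans _ _ (\sum_(i < m) (enorm (row i M) * enorm (x - y)))).
  apply: ler_sum => i _; rewrite enormZ mulrC ler_wpM2l ?enorm_ge0 //.
  exact: ler_abs_coord_enorm.
rewrite -mulr_suml ler_wpM2r ?enorm_ge0 //.
case: m M x y m0 => [|m] M x y m0; first by rewrite big_ord0 mulr0.
by rewrite ler_peMl // ler1n.
Qed.

(** In [haar_swap] the test set is the unit ball: it is its own preimage, and its measure is
    positive and finite, so it cancels. *)
Lemma muV_orth m (M : 'M[R]_m) (A : set 'rV[R]_m) : M *m M^T = 1%:M -> measurable A ->
  muV R m ((fun x => x *m M) @^-1` A) = muV R m A.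
Proof.
move=> MM mA; have mT : measurable_fun setT (fun x : 'rV[R]_m => x *m M).
  by apply: measurable_continuous_map; exact: continuous_mulmxr.
have := @haar_swap R m (fun x => x *m M) (fun x => x *m M^T) A (eball m 1) mT.
have -> : (fun x => x *m M) @^-1` eball m 1 = eball m 1.
  by apply/seteqP; split => x; rewrite /preimage /eball /= enorm_mulmx.
move=> H; have {H} : (muV R m ((fun x => x *m M) @^-1` A) * muV R m (eball m 1) =
    muV R m (eball m 1) * muV R m A)%E.
  apply: H => //.
  - by move=> x y; rewrite mulmxDl.
  - by move=> x; rewrite -mulmxA (mulmx1C MM) mulmx1.
  - exact: measurable_eball.
  - by move=> x; rewrite /eball /= enormN.
rewrite [RHS]muleC.
have b0 := muV_eball_gt0 m (ltr01 : 0 < 1 :> R).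
have boo : (muV R m (eball m 1) < +oo)%E.
  by rewrite (le_lt_trans (muV_eball_le m ler01)) ?ltry.
have bf : muV R m (eball m 1) \is a fin_num by rewrite ge0_fin_numE // ltW.
move: (muV R m (eball m 1)) bf b0 boo => b /fineK <- b0 _.
rewrite lte_fin in b0 => E.
have := congr1 (fun z => z * ((fine b)^-1)%:E)%E E.
by rewrite -!muleA -!EFinM mulfV ?gt_eqF // !mule1.
Qed.

Lemma continuous_scaler m (c : R) : continuous (fun x : 'rV[R]_m => c *: x).
Proof.
apply: (@enorm_continuous_map _ _ _ _ `|c|) => x y.
by rewrite -scalerBr enormZ.
Qed.

(** Here the test set of [haar_swap] is a cube: its preimage is again a cube, and the measures of
    both are known explicitly. *)
Lemma muV_scale m (c : R) (A : set 'rV[R]_m) : 0 < c -> measurable A ->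
  muV R m ((fun x => c *: x) @^-1` A) = ((c ^- m)%:E * muV R m A)%E.
Proof.
move=> c0 mA; have mT : measurable_fun setT (fun x : 'rV[R]_m => c *: x).
  by apply: measurable_continuous_map; exact: continuous_scaler.
have := @haar_swap R m (fun x => c *: x) (fun x => c^-1 *: x) A (cube m 1) mT.
have -> : (fun x => c *: x) @^-1` cube m 1 = cube m c^-1.
  apply/seteqP; split => x xc i; have := xc i.
    by rewrite mxE normrM gtr0_norm // mulrC -ltr_pdivlMr // mul1r.
  by rewrite mxE normrM (gtr0_norm c0) -ltr_pdivlMl // mulr1.
move=> H; have {H} : (muV R m ((fun x => c *: x) @^-1` A) * muV R m (cube m 1) =
    muV R m (cube m c^-1) * muV R m A)%E.
  apply: H => //.
  - by move=> x y; rewrite scalerDr.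
  - by move=> x; rewrite scalerA mulfV ?gt_eqF // scale1r.
  - exact: measurable_cube.
  - by move=> x xc i; rewrite mxE normrN.
rewrite !muV_cube ?ler01 ?invr_ge0 ?ltW // => E.
have := congr1 (fun z => z * ((2 ^- m : R))%:E)%E E.
rewrite mulr1 -!muleA -!EFinM mulfV ?expf_neq0 // mule1 => ->.
rewrite (muleC (muV R m A)) muleA -EFinM; congr (_ * _)%E; congr EFin.
by rewrite exprMn exprVn mulrC mulrA mulVf ?mul1r ?expf_neq0.
Qed.

Notation I m f := (Rintegral (muV R m) setT f).
Notation integ m f := ((muV R m).-integrable setT (EFin \o f)).

Lemma Rint_translate m (a : 'rV[R]_m) (f : 'rV[R]_m -> R) : integ m f ->
  integ m (fun x => f (x + a)) /\ I m (fun x => f (x + a)) = I m f.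
Proof.
move=> fi.
have [||//|//|] := @integral_scale_measure R _ _ _ _ (muV R m) (muV R m) (fun x => x + a) 1 f.
- exact: measurable_translation.
- by [].
- move=> A mA; rewrite mul1e.
  have mta : measurable ((fun x => x + a) @^-1` A).
    by rewrite -[X in measurable X]setTI; exact: measurable_translation.
  rewrite -(setIT (_ @^-1` A)) -integral_indic // -[in RHS](setIT A) -integral_indic //.
  rewrite -[RHS](@ge0_integral_translation R m a) //; last first.
    exact/measurable_EFinP/measurable_indic.
- by move=> H1 H2; split => //; rewrite -[RHS]mul1r.
Qed.

Lemma Rint_orth m (M : 'M[R]_m) (f : 'rV[R]_m -> R) : M *m M^T = 1%:M -> integ m f ->
  integ m (fun x => f (x *m M)) /\ I m (fun x => f (x *m M)) = I m f.
Proof.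
move=> MM fi.
have [||//|//|] := @integral_scale_measure R _ _ _ _ (muV R m) (muV R m) (fun x => x *m M) 1 f.
- by apply: measurable_continuous_map; exact: continuous_mulmxr.
- by [].
- by move=> A mA; rewrite mul1e; exact: muV_orth.
- by move=> H1 H2; split => //; rewrite -[RHS]mul1r.
Qed.

Lemma Rint_scale m (c : R) (f : 'rV[R]_m -> R) : 0 < c -> integ m f ->
  integ m (fun x => f (c *: x)) /\ I m (fun x => f (c *: x)) = c ^- m * I m f.
Proof.
move=> c0 fi.
apply: (@integral_scale_measure R _ _ _ _ (muV R m) (muV R m) (fun x => c *: x) (c ^- m) f) => //.
- by apply: measurable_continuous_map; exact: continuous_scaler.
- by rewrite invr_ge0 exprn_ge0 // ltW.
- by move=> A mA; exact: muV_scale.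
Qed.

Lemma Rint_opp m (f : 'rV[R]_m -> R) : integ m f ->
  integ m (fun x => f (- x)) /\ I m (fun x => f (- x)) = I m f.
Proof.
move=> fi; have [|] := @Rint_orth m (- 1%:M) f _ fi.
  by rewrite linearN /= trmx1 mulNmx mul1mx opprK.
have -> : (fun x => f (x *m - 1%:M)) = (fun x => f (- x)); last by [].
by apply/funext => x; rewrite mulmxN mulmx1.
Qed.

End ChangeOfVariables.

Arguments cube {R} m r.
Arguments eball {R} m r.

(** * Power weights *)

Section PowerWeights.
Variable R : realType.
Implicit Types (m : nat) (p q r : R).

Notation I m f := (Rintegral (muV R m) setT f).
Notation integ m f := ((muV R m).-integrable setT (EFin \o f)).

Lemma powR_expn (x r : R) k : 0 <= x -> (x ^+ k) `^ r = (x `^ r) ^+ k.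
Proof.
by move=> x0; rewrite -powR_mulrn // -powRrM mulrC powRrM powR_mulrn // powR_ge0.
Qed.

Lemma powR2_lt1 r : r < 0 -> 2 `^ r < 1 :> R.
Proof.
move=> r0; have := ler_powR (ler1n R 2) (ltW r0); rewrite powRr0 lt_neqAle => ->.
by rewrite powR_eq1 !negb_or (lt_eqF r0) -[1]/(1%:R) eqr_nat /= andbT -leNgt ler0n.
Qed.

Lemma le0_ger_powR (x y r : R) : 0 < x -> r <= 0 -> x <= y -> y `^ r <= x `^ r.
Proof.
move=> x0 r0 xy; have y0 := lt_le_trans x0 xy.
have -> : r = - (- r) by rewrite opprK.
rewrite [_ `^ _]powRN [X in _ <= X]powRN lef_pV2 ?posrE ?powR_gt0 //.
by rewrite ge0_ler_powR // ?nnegrE ?oppr_ge0 // ltW.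
Qed.

(* The dyadic shells [|x| < rho * be ^ k] carry the values of [f] up to [A * al ^ k]. *)
Lemma dyadic_integral m (f : 'rV[R]_m -> R) (A rho al be : R) :
  measurable_fun setT f -> (forall x, 0 <= f x) ->
  0 <= A -> 0 <= rho -> 0 <= al -> 0 <= be -> al * be ^+ m < 1 ->
  (forall x, f x <= 0 \/ exists2 k, enorm x < rho * be ^+ k & f x <= A * al ^+ k) ->
  integ m f /\ I m f <= A * (2 * rho) ^+ m / (1 - al * be ^+ m).
Proof.
move=> mf f0 A0 rho0 al0 be0 th1 fk.
set th := al * be ^+ m in th1 *.
have th0 : 0 <= th by rewrite mulr_ge0 // exprn_ge0.
set B := A * _ ^+ m / _.
pose g k (x : 'rV[R]_m) : \bar R := ((A * al ^+ k)%:E * (\1_(eball m (rho * be ^+ k)) x)%:E)%E.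
have g0 k x : (0 <= g k x)%E.
  by rewrite /g -EFinM lee_fin mulr_ge0 // mulr_ge0 // exprn_ge0.
have mi k : measurable_fun [set: 'rV[R]_m] (fun x => (\1_(eball m (rho * be ^+ k)) x)%:E : \bar R).
  by apply/measurable_EFinP/measurable_indic; exact: measurable_eball.
have mg k : measurable_fun setT (g k) by exact: measurable_funeM.
have le : (\int[muV R m]_x (f x)%:E <= B%:E)%E.
  apply: (@le_trans _ _ (\int[muV R m]_x (\sum_(0 <= k <oo) g k x))%E).
    apply: ge0_le_integral => //.
    - by move=> x _; rewrite lee_fin.
    - exact/measurable_EFinP.
    - by apply: (@ge0_emeasurable_sum _ _ _ setT g xpredT) => [k x _ _|k _]; [exact: g0|exact: mg].
    - move=> x _; have [fx|[k xk fx]] := fk x.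
        by apply: (@le_trans _ _ 0%E); [rewrite lee_fin|exact: nneseries_ge0].
      apply: (@le_trans _ _ (\sum_(0 <= i < k.+1) g i x)%E); last first.
        by apply: nneseries_lim_ge => *; exact: g0.
      rewrite big_nat_recr //=; apply: (@le_trans _ _ (g k x)).
        by rewrite /g indicE mem_set // mule1 lee_fin.
      by rewrite leeDr // sume_ge0.
  rewrite integral_nneseries //; apply: lime_le.
    by apply: is_cvg_nneseries => k _ _; exact: integral_ge0.
  near=> n.
  apply: (@le_trans _ _ (\sum_(0 <= k < n) ((A * (2 * rho) ^+ m) * th ^+ k)%:E)%E).
    apply: lee_sum => k _; rewrite ge0_integralZl //; last first.
      by rewrite lee_fin mulr_ge0 // exprn_ge0.
    rewrite integral_indic //; last exact: measurable_eball.
    rewrite setIT; apply: (@le_trans _ _ ((A * al ^+ k)%:E * ((2 * (rho * be ^+ k)) ^+ m)%:E)%E).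
      rewrite lee_wpmul2l ?lee_fin ?mulr_ge0 ?exprn_ge0 //.
      by apply: muV_eball_le; rewrite mulr_ge0 // exprn_ge0.
    have -> : (2 * (rho * be ^+ k)) ^+ m = (2 * rho) ^+ m * (be ^+ m) ^+ k.
      by rewrite mulrA exprMn -!exprM mulnC.
    by rewrite -EFinM lee_fin /th [(al * _) ^+ k]exprMn mulrACA.
  rewrite sumEFin lee_fin.
  have := @geometric_seriesE R (A * (2 * rho) ^+ m) th; rewrite lt_eqF // => /(_ isT).
  move=> /(congr1 (fun u => u n)); rewrite /series /geometric /= => ->.
  have th1' : 0 <= (1 - th)^-1 by rewrite invr_ge0 subr_ge0 ltW.
  rewrite /B ler_wpM2r //.
  rewrite ler_piMr ?mulr_ge0 ?exprn_ge0 ?mulr_ge0 //.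
  by rewrite lerBlDr lerDl exprn_ge0.
have fi : integ m f.
  apply/integrableP; split; first exact/measurable_EFinP.
  under eq_integral do rewrite /= ger0_norm //.
  by rewrite (le_lt_trans le) ?ltry.
split => //; rewrite -lee_fin /Rintegral fineK //.
exact: integrable_fin_num.
Unshelve. all: by end_near.
Qed.

Lemma dyadic_integral_abs m (g : 'rV[R]_m -> R) (A rho al be : R) :
  measurable_fun setT g ->
  0 <= A -> 0 <= rho -> 0 <= al -> 0 <= be -> al * be ^+ m < 1 ->
  (forall x, `|g x| <= 0 \/ exists2 k, enorm x < rho * be ^+ k & `|g x| <= A * al ^+ k) ->
  integ m g /\ I m (fun x => `|g x|) <= A * (2 * rho) ^+ m / (1 - al * be ^+ m).
Proof.
move=> mg A0 rho0 al0 be0 th1 gk.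
have mag : measurable_fun setT (fun x => `|g x|) by exact: measurableT_comp.
have [gi gle] := dyadic_integral mag (fun x => normr_ge0 (g x)) A0 rho0 al0 be0 th1 gk.
split => //; apply: le_integrable gi => //; first exact/measurable_EFinP.
by move=> x _ /=; rewrite normr_id.
Qed.

Lemma exists_dyadic_up (y : R) : exists k, y < 2 ^+ k.
Proof.
exists (Num.bound y); apply: (@lt_le_trans _ _ (Num.bound y)%:R).
  by rewrite (le_lt_trans (ler_norm y)) // -[X in _ < X%:R](_ : Num.bound `|y| = _) ?archi_boundP // /Num.bound normr_id.
by rewrite -natrX ler_nat ltnW // ltn_expl.
Qed.

(** The shells [rho 2 ^ k <= |x| < rho 2 ^ (k + 1)] contribute a geometric series of ratio
    [2 ^ (m - p) < 1]; the factor [4 ^ m] is the volume of a cube of side [4 rho] around the first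
    ball, up to [rho ^ m]. The constant precedes [K], [rho] and [g], so it may be used uniformly in
    all blow-ups. *)
Lemma tail_bound m p : m%:R < p -> exists2 C, 0 <= C &
  forall (K rho : R) (g : 'rV[R]_m -> R), 0 < rho -> 0 <= K -> measurable_fun setT g ->
  (forall x, `|g x| <= if rho <= enorm x then K * enorm x `^ (- p) else 0) ->
  integ m g /\ I m (fun x => `|g x|) <= K * C * rho `^ (m%:R - p).
Proof.
move=> mp; pose th : R := 2 `^ (- p) * 2 ^+ m.
have thE : th = 2 `^ (m%:R - p) by rewrite /th -powR_mulrn // -powRD ?pnatr_eq0 ?implybT // addrC.
have th1 : th < 1 by rewrite thE powR2_lt1 // subr_lt0.
have p0 : 0 <= p by rewrite (le_trans _ (ltW mp)).
exists (4 ^+ m / (1 - th)); first by rewrite divr_ge0 ?exprn_ge0 // subr_ge0 ltW.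
move=> K rho g rho0 K0 mg gle.
have [||||||gi gI] := @dyadic_integral_abs m g (K * rho `^ (- p)) (2 * rho) (2 `^ (- p)) 2 mg.
- by rewrite mulr_ge0 // powR_ge0.
- by rewrite mulr_ge0 // ltW.
- exact: powR_ge0.
- by [].
- exact: th1.
- move=> x; have := gle x; case: ifPn => [rx gx|_ gx]; [right|by left].
  have [k0 k0P] := exists_dyadic_up (enorm x / rho).
  have ex : exists k, enorm x < 2 * rho * 2 ^+ k.
    exists k0; move: k0P; rewrite ltr_pdivrMr // => /lt_le_trans; apply.
    by rewrite mulrC ler_wpM2r ?exprn_ge0 // ler_peMl ?ler1n // ltW.
  case: (ex_minnP ex) => k kx kmin; exists k => //.
  have kl : rho * 2 ^+ k <= enorm x.
    case: k kx kmin => [|k] kx kmin; first by rewrite expr0 mulr1.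
    rewrite leNgt; apply/negP => xk; have := kmin k.
    by rewrite ltnn => H; have /H : enorm x < 2 * rho * 2 ^+ k by rewrite (lt_le_trans xk) // exprS mulrCA mulrA.
  apply: (le_trans gx); rewrite -mulrA ler_wpM2l //.
  have rk : 0 < rho * 2 ^+ k by rewrite mulr_gt0 // exprn_gt0.
  rewrite -powR_expn // -powRM ?exprn_ge0 ?(ltW rho0) // !powRN lef_pV2 ?posrE ?powR_gt0 //.
    by rewrite ge0_ler_powR // ?nnegrE ?enorm_ge0 // ltW.
  exact: lt_le_trans kl.
split => //; apply: (le_trans gI); rewrite -/th le_eqVlt; apply/orP; left; apply/eqP.
have -> : rho `^ (m%:R - p) = rho `^ (- p) * rho ^+ m.
  by rewrite -powR_mulrn ?(ltW rho0) // -powRD ?(lt0r_neq0 rho0) ?implybT // addrC.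
have -> : (2 * (2 * rho)) ^+ m = 4 ^+ m * rho ^+ m by rewrite mulrA exprMn; congr (_ ^+ _ * _); ring.
ring.
Qed.

(** The same series with shells shrinking to the origin, of ratio [2 ^ (- (m + q)) < 1]. *)
Lemma near_bound m q : - m%:R < q -> exists2 C, 0 <= C &
  forall (K rho : R) (g : 'rV[R]_m -> R), 0 < rho -> 0 <= K -> measurable_fun setT g ->
  (forall x, `|g x| <= if enorm x < rho then K * enorm x `^ q else 0) ->
  integ m g /\ I m (fun x => `|g x|) <= K * C * rho `^ (m%:R + q).
Proof.
move=> mq; pose th : R := 2 `^ (- q) * 2^-1 ^+ m.
have thE : th = 2 `^ (- (m%:R + q)).
  by rewrite /th exprVn -powR_invn // -powRD ?pnatr_eq0 ?implybT // opprD addrC.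
have th1 : th < 1 by rewrite thE powR2_lt1 // oppr_lt0 -ltrBlDl sub0r.
(* On a shell the weight is largest at the outer radius if [q >= 0] and at the inner radius, half as
   large, if [q < 0]; [M] covers both cases. *)
pose M : R := Num.max 1 (2 `^ (- q)).
have M1 : 1 <= M by rewrite le_max lexx.
exists (M * 2 ^+ m / (1 - th)).
  by rewrite divr_ge0 ?subr_ge0 ?(ltW th1) // mulr_ge0 ?exprn_ge0 // (le_trans _ M1).
move=> K rho g rho0 K0 mg gle.
have [||||||gi gI] := @dyadic_integral_abs m g (K * (M * rho `^ q)) rho (2 `^ (- q)) 2^-1 mg.
- by rewrite !mulr_ge0 ?powR_ge0 // (le_trans _ M1).
- exact: ltW.
- exact: powR_ge0.
- by [].
- exact: th1.
- move=> x; have := gle x; case: ifPn => [rx gx|_ gx]; [right|by left].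
  (* The origin lies in all the balls and is assigned to the first. The power of [0] is [1] for
     [q = 0] and [0] otherwise, and both values are within the bound. *)
  have [x0|x0] := eqVneq (enorm x) 0.
    exists 0%N; first by rewrite expr0 mulr1.
    rewrite expr0 mulr1 (le_trans gx) // ler_wpM2l // x0.
    have [->|q0] := eqVneq q 0; first by rewrite !powRr0 mulr1.
    by rewrite powR0 // mulr_ge0 ?powR_ge0 // (le_trans _ M1).
  have xp : 0 < enorm x by rewrite lt_def x0 enorm_ge0.
  have [k0 k0P] := exists_dyadic_up (rho / enorm x).
  have ex : exists k, rho * 2^-1 ^+ k.+1 <= enorm x.
    exists k0; rewrite exprVn ler_pdivrMr ?exprn_gt0 // mulrC -ler_pdivrMr //.
    by rewrite (le_trans (ltW k0P)) // exprS ler_peMl ?exprn_ge0 // ler1n.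
  case: (ex_minnP ex) => k kx kmin; exists k.
    case: k kx kmin => [|k] kx kmin; first by rewrite expr0 mulr1.
    by rewrite ltNge; apply/negP => /kmin; rewrite ltnn.
  have xk : enorm x < rho * 2^-1 ^+ k.
    case: k kx kmin => [|k] kx kmin; first by rewrite expr0 mulr1.
    by rewrite ltNge; apply/negP => /kmin; rewrite ltnn.
  apply: (le_trans gx); rewrite -mulrA ler_wpM2l //.
  have rk : 0 < rho * 2^-1 ^+ k by rewrite mulr_gt0 // exprn_gt0.
  have E : rho `^ q * (2 `^ (- q)) ^+ k = (rho * 2^-1 ^+ k) `^ q.
    rewrite powRM ?exprn_ge0 ?(ltW rho0) // exprVn -powR_expn //; congr (_ * _).
    by rewrite powRN -powR_inv1 ?powR_ge0 // -powRrM mulrN1 -powR_inv1 ?exprn_ge0 // -powRrM mulN1r.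
  rewrite -mulrA E; have [q0|q0] := leP 0 q.
    apply: (@le_trans _ _ (1 * (rho * 2^-1 ^+ k) `^ q)); last by rewrite ler_wpM2r ?powR_ge0.
    by rewrite mul1r ge0_ler_powR // ?nnegrE ?ltW.
  apply: (@le_trans _ _ (2 `^ (- q) * (rho * 2^-1 ^+ k) `^ q)); last first.
    by rewrite ler_wpM2r ?powR_ge0 // le_max lexx orbT.
  have -> : 2 `^ (- q) * (rho * 2^-1 ^+ k) `^ q = (rho * 2^-1 ^+ k.+1) `^ q.
    rewrite exprS [in RHS]mulrCA [in RHS]powRM ?ltW //; congr (_ * _).
    by rewrite -(@powR_inv1 _ 2) // -powRrM mulN1r.
  by apply: le0_ger_powR kx; [rewrite mulr_gt0 // exprn_gt0|exact: ltW].
split => //; apply: (le_trans gI); rewrite -/th le_eqVlt; apply/orP; left; apply/eqP.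
have -> : rho `^ (m%:R + q) = rho `^ q * rho ^+ m.
  by rewrite -powR_mulrn ?(ltW rho0) // -powRD ?(lt0r_neq0 rho0) ?implybT // addrC.
rewrite exprMn; ring.
Qed.

(** Of the same size as the bound [1 / (1 + |x| ^ p)] on the kernel, but a power of a single base,
    so that translations and dilations are absorbed by comparing bases, as in [decay_comp]. *)
Definition decay p m (x : 'rV[R]_m) : R := (1 + enorm x) `^ (- p).

Lemma measurable_powR_enorm m p : measurable_fun setT (fun x : 'rV[R]_m => enorm x `^ p).
Proof.
apply: (@measurableT_comp _ _ _ _ _ _ (fun y : R => y `^ p) _ (@enorm R m)).
  exact: measurable_powR.
by apply: continuous_measurable_rV; exact: continuous_enorm.
Qed.

Lemma measurable_decay m p : measurable_fun setT (@decay p m).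
Proof.
apply: (@measurableT_comp _ _ _ _ _ _ (fun y : R => y `^ (- p)) _ (fun x => 1 + @enorm R m x)).
  exact: measurable_powR.
apply: measurable_funD => //.
by apply: continuous_measurable_rV; exact: continuous_enorm.
Qed.

Lemma decay_ge0 p m (x : 'rV[R]_m) : 0 <= decay p x.
Proof. exact: powR_ge0. Qed.

Lemma decay_integrable m p : m%:R < p -> integ m (@decay p m).
Proof.
move=> mp; pose th : R := 2 `^ (- p) * 2 ^+ m.
have thE : th = 2 `^ (m%:R - p) by rewrite /th -powR_mulrn // -powRD ?pnatr_eq0 ?implybT // addrC.
have th1 : th < 1 by rewrite thE powR2_lt1 // subr_lt0.
have p0 : 0 <= p by rewrite (le_trans _ (ltW mp)).
have [|||||||//] := @dyadic_integral m (@decay p m) (2 `^ p) 1 (2 `^ (- p)) 2 (@measurable_decay m p).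
- by move=> x; exact: decay_ge0.
- exact: powR_ge0.
- by [].
- exact: powR_ge0.
- by [].
- exact: th1.
move=> x; right; have [k0 k0P] := exists_dyadic_up (enorm x).
have ex : exists k, enorm x < 1 * 2 ^+ k by exists k0; rewrite mul1r.
case: (ex_minnP ex) => k kx kmin; exists k => //.
have kl : 2 ^+ k / 2 <= 1 + enorm x.
  case: k kx kmin => [|k] kx kmin.
    by rewrite expr0; have := enorm_ge0 x; lra.
  rewrite exprS mulrAC mulfV // mul1r leNgt; apply/negP => xk; have := kmin k.
  rewrite ltnn mul1r => H; have /H // : enorm x < 2 ^+ k.
  by rewrite (le_lt_trans _ xk) // lerDr.
have k0' : 0 < 2 ^+ k / 2 :> R by rewrite divr_gt0 // exprn_gt0.
apply: (@le_trans _ _ ((2 ^+ k / 2) `^ (- p))).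
  rewrite /decay !powRN lef_pV2 ?posrE ?powR_gt0 //.
    by rewrite ge0_ler_powR // ?nnegrE ?addr_ge0 ?enorm_ge0 // ltW.
  by rewrite ltr_pwDl // enorm_ge0.
rewrite powRM ?exprn_ge0 // powR_expn // mulrC -{1}(@powR_inv1 _ 2) // -powRrM mulN1r opprK.
by [].
Qed.

Lemma decay_section p m h (y : 'rV[R]_m) : 0 <= p -> decay p (consr h y) <= decay p y.
Proof.
move=> p0; have y0 := enorm_ge0 y; have hy := enorm_consr_ge h y.
rewrite /decay !powRN lef_pV2 ?posrE ?powR_gt0 ?ltr_pwDl ?enorm_ge0 //.
by rewrite ge0_ler_powR // ?nnegrE ?addr_ge0 ?enorm_ge0 // lerD2l.
Qed.

Lemma measurable_section_real m (f : 'rV[R]_m.+1 -> R) (x : R) :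
  measurable_fun setT f -> measurable_fun setT (fun y => f (consr x y)).
Proof.
move=> mf; apply/measurable_EFinP.
by apply: (@measurable_section R m (EFin \o f)); exact/measurable_EFinP.
Qed.

Lemma decay_hintegrable m p : m%:R < p -> hintegrable (@decay p m).
Proof.
elim: m => [|m IH] mp /=; first exact: measurable_decay.
have mp' : m%:R < p by rewrite (lt_trans _ mp) // ltr_nat.
split; first exact: decay_integrable.
move=> x; apply: (hintegrable_le _ _ (IH mp')).
  by apply: measurable_section_real; exact: measurable_decay.
move=> y; rewrite ger0_norm ?decay_ge0 // decay_section //.
by rewrite (le_trans _ (ltW mp')).
Qed.

Lemma hintegrableZ m (f : 'rV[R]_m -> R) (c : R) : hintegrable f -> hintegrable (fun x => c * f x).
Proof.
elim: m f => [|m IH] f /=; first by move=> mf; exact: measurable_funM.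
move=> [fi fs]; split; last by move=> x; exact: IH.
rewrite (_ : EFin \o _ = (fun x => c%:E * (EFin \o f) x))%E; first exact: integrableZl.
by apply/funext => x /=; rewrite EFinM.
Qed.

Lemma hintegrable_decay m p K (f : 'rV[R]_m -> R) : m%:R < p -> measurable_fun setT f ->
  (forall x, `|f x| <= K * decay p x) -> hintegrable f.
Proof.
move=> mp mf fK; apply: (hintegrable_le mf fK).
exact/hintegrableZ/decay_hintegrable.
Qed.

End PowerWeights.

(** * Functions of class C^k along segments *)

Section LineCalculus.
Variable R : realType.

Lemma mvt_from0 (f df : R -> R) (b : R) :
  (forall t : R, is_derive t (1 : R) f (df t)) ->
  exists c, [/\ `|c| <= `|b|, 0 <= b -> 0 <= c <= b & f b - f 0 = df c * b].
Proof.
move=> fd; have fc (i : interval R) : {within [set` i], continuous f}.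
  by apply: derivable_within_continuous => t _; have [] := fd t.
have [b0|b0] := leP 0 b.
  have [c] := @MVT_segment R f df 0 b b0 (fun t _ => fd t) (fc _).
  rewrite in_itv /= => /andP[c0 cb] ->; exists c; rewrite subr0; split => //.
    by rewrite !ger0_norm.
  by rewrite c0.
have [c] := @MVT_segment R f df b 0 (ltW b0) (fun t _ => fd t) (fc _).
rewrite in_itv /= => /andP[c0 cb] E; exists c; split.
- by rewrite !ler0_norm ?lerN2 // ltW.
- by [].
- by move: E; rewrite sub0r; lra.
Qed.

Lemma is_derive_line m (f : 'rV[R]_m -> R) (a v : 'rV[R]_m) (t : R) :
  derivable f (a + t *: v) v ->
  is_derive t (1 : R) (fun s : R => f (a + s *: v)) ('D_v f (a + t *: v)).
Proof.
move=> fd.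
have E : (fun h : R => h^-1 *: (((fun s => f (a + s *: v)) \o shift t) (h *: (1 : R)) - f (a + t *: v)))
   = (fun h => h^-1 *: ((f \o shift (a + t *: v)) (h *: v) - f (a + t *: v))).
  apply/funext => h /=; congr (_ *: (f _ - _)).
  by rewrite /GRing.scale /= mulr1 -/(GRing.scale _ _) scalerDl addrCA.
by split; [rewrite /derivable E|rewrite /derive E].
Qed.

(** The corners of the path from [0] to [w] that runs parallel to the axes, along which only partial
    derivatives occur. *)
Definition trunc m (k : nat) (w : 'rV[R]_m) : 'rV[R]_m :=
  \row_(i < m) (if (i < k)%N then w 0 i else 0).

Lemma trunc0 m (w : 'rV[R]_m) : trunc 0 w = 0.
Proof. by apply/rowP => i; rewrite !mxE. Qed.

Lemma trunc_full m (w : 'rV[R]_m) : trunc m w = w.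
Proof. by apply/rowP => i; rewrite !mxE ltn_ord. Qed.

Lemma truncS m (w : 'rV[R]_m) (i : 'I_m) : trunc i.+1 w = trunc i w + w 0 i *: evec R i.
Proof.
apply/rowP => j; rewrite !mxE eqxx /= ltnS leq_eqVlt (inj_eq val_inj).
by case: eqVneq => [->|_]; rewrite ?ltnn /= ?mulr1 ?add0r ?mulr0 ?addr0.
Qed.

Lemma enorm_trunc_step m (w : 'rV[R]_m) (i : 'I_m) (c : R) : `|c| <= `|w 0 i| ->
  enorm (trunc i w + c *: evec R i) <= enorm w.
Proof.
move=> cw; apply: ler_wsqrtr; apply: ler_sum => j _; rewrite !mxE eqxx /=.
case: (eqVneq j i) => [->|ji].
  rewrite ltnn add0r mulr1 -(real_normK (num_real c)) -(real_normK (num_real (w 0 i))).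
  by rewrite ler_pXn2r ?nnegrE.
by rewrite mulr0 addr0; case: ifP => // _; rewrite expr0n /= sqr_ge0.
Qed.

(** Telescoping along the axis-parallel path and the mean value theorem on each leg; the legs stay
    in the ball of radius [|w|] about [a]. In applications [p] is the gradient at [a] and [e] its
    oscillation. *)
Lemma box_mvt m (f : 'rV[R]_m -> R) (p : 'I_m -> R) (e : R) (a w : 'rV[R]_m) :
  (forall i x, derivable f x (evec R i)) ->
  (forall i z, enorm (z - a) <= enorm w -> `|partial i f z - p i| <= e) ->
  `|f (a + w) - f a - \sum_i p i * w 0 i| <= e * \sum_i `|w 0 i|.
Proof.
move=> fd fp.
have E : f (a + w) - f a = \sum_(i < m) (f (a + trunc i.+1 w) - f (a + trunc i w)).
  have T := @telescope_sumr _ 0 m (fun k => f (a + trunc k w)) (leq0n m).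
  by rewrite big_mkord /= trunc0 trunc_full addr0 in T; rewrite T.
rewrite E -sumrB mulr_sumr (le_trans (ler_norm_sum _ _ _)) //.
apply: ler_sum => i _.
pose phi (s : R) := f (a + trunc i w + s *: evec R i).
have phid (t : R) : is_derive t (1 : R) phi (partial i f (a + trunc i w + t *: evec R i)).
  exact: is_derive_line.
have [c [cw _ cE]] := mvt_from0 (w 0 i) phid.
have -> : f (a + trunc i.+1 w) - f (a + trunc i w) = phi (w 0 i) - phi 0.
  by rewrite /phi scale0r addr0 truncS addrA.
rewrite cE -mulrBl normrM ler_wpM2r // fp //.
by rewrite [X in enorm X]addrC !addrA addNr add0r enorm_trunc_step.
Qed.

Lemma Ck1_derivable m (f : 'rV[R]_m -> R) : Ck 1 f ->
  forall i x, derivable f x (evec R i).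
Proof. by move=> [_ H] i; have [] := H i. Qed.

Lemma Ck1_continuous_partial m (f : 'rV[R]_m -> R) : Ck 1 f ->
  forall i, continuous (partial i f).
Proof. by move=> [_ H] i; have [] := H i. Qed.

Lemma CkW m k (f : 'rV[R]_m -> R) : Ck k.+1 f -> Ck k f.
Proof.
elim: k f => [|k IH] f; first by case.
move=> [cf H]; split => // i; have [fd /IH] := H i; by split.
Qed.

Lemma sum_abs_coord_ge0 m (w : 'rV[R]_m) : 0 <= \sum_i `|w 0 i|.
Proof. by apply: sumr_ge0. Qed.

Lemma enorm_ge_sum m (w : 'rV[R]_m) : \sum_i `|w 0 i| <= m%:R * enorm w.
Proof.
apply: (@le_trans _ _ (\sum_(i < m) enorm w)).
  by apply: ler_sum => i _; exact: ler_abs_coord_enorm.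
by rewrite sumr_const card_ord mulr_natl.
Qed.

Lemma Ck1_uniform_partial m (f : 'rV[R]_m -> R) (a : 'rV[R]_m) (e : R) : Ck 1 f -> 0 < e ->
  exists2 d, 0 < d & forall i z, enorm (z - a) < d -> `|partial i f z - partial i f a| <= e.
Proof.
move=> fC e0.
have H i : {d | 0 < d & forall z, enorm (z - a) < d -> `|partial i f z - partial i f a| <= e}.
  apply: cid2; have /(_ a) /continuous_enormP /(_ e e0) [d d0 dP] := Ck1_continuous_partial fC (i:=i).
  by exists d => // z /dP /ltW.
have dp i : 0 <= (s2val (H i))^-1.
  have di0 : 0 < s2val (H i) := s2valP (H i).
  by rewrite invr_ge0; exact: ltW.
pose s := \sum_i (s2val (H i))^-1.
have s0 : 0 <= s by apply: sumr_ge0.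
(* This radius lies below each of the finitely many radii, because its inverse exceeds each of their
   inverses; it stands in for a minimum over a possibly empty family. *)
exists (s + 1)^-1; first by rewrite invr_gt0 ltr_wpDl.
move=> i z zd; apply: (s2valP' (H i)); rewrite (lt_le_trans zd) //.
have di0 : 0 < s2val (H i) := s2valP (H i).
rewrite -[leRHS]invrK lef_pV2 ?posrE ?invr_gt0 ?ltr_wpDl //.
by rewrite /s (bigD1 i) //= -addrA lerDl addr_ge0 // sumr_ge0.
Qed.

(** [Ck] speaks of the axes only. Continuity of the partial derivatives gives differentiability in
    an arbitrary direction, by [box_mvt] at the point [b] with the gradient there. *)
Lemma is_derive_line_Ck1 m (f : 'rV[R]_m -> R) (a w : 'rV[R]_m) (t : R) : Ck 1 f ->
  is_derive t (1 : R) (fun s : R => f (a + s *: w)) (\sum_i w 0 i * partial i f (a + t *: w)).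
Proof.
move=> fC; set L := \sum_i _; set b := a + t *: w.
have H : (fun h : R => h^-1 *: (((fun s => f (a + s *: w)) \o shift t) (h *: (1 : R)) - f b)) @ 0^' --> L.
  apply/cvgrPdist_le => e e0.
  set S := \sum_i `|w 0 i|.
  have S0 : 0 <= S := sum_abs_coord_ge0 w.
  have e1 : 0 < e / (S + 1) by rewrite divr_gt0 // ltr_wpDl.
  have [d d0 dP] := Ck1_uniform_partial b fC e1.
  have w0 := enorm_ge0 w.
  near=> h.
  have h0 : h != 0 by near: h; exact: nbhs_dnbhs_neq.
  have hd : `|h| < d / (enorm w + 1).
    near: h; apply: nbhs_dnbhs; apply/nbhs_ballP; exists (d / (enorm w + 1)).
      by rewrite /= divr_gt0 // ltr_wpDl.
    by move=> z; rewrite /ball /= sub0r normrN.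
  have := @box_mvt m f (fun i => partial i f b) (e / (S + 1)) b (h *: w) (Ck1_derivable fC).
  have -> : \sum_i `|(h *: w) 0 i| = `|h| * S.
    by rewrite mulr_sumr; apply: eq_bigr => i _; rewrite mxE normrM.
  have -> : \sum_i partial i f b * (h *: w) 0 i = h * L.
    by rewrite mulr_sumr; apply: eq_bigr => i _; rewrite mxE mulrC mulrA.
  move=> Hb; have {Hb} : `|f (b + h *: w) - f b - h * L| <= e / (S + 1) * (`|h| * S).
    apply: Hb => i z zb; apply: dP; rewrite (le_lt_trans zb) // enormZ.
    apply: (@le_lt_trans _ _ (`|h| * (enorm w + 1))); first by rewrite ler_wpM2l // lerDl.
    by rewrite -ltr_pdivlMr // ltr_wpDl.
  rewrite /= /GRing.scale /= mulr1 -/(GRing.scale _ _).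
  have -> : a + (h + t) *: w = b + h *: w by rewrite /b scalerDl addrCA addrC.
  have -> : L - h^-1 * (f (b + h *: w) - f b) = - (h^-1 * (f (b + h *: w) - f b - h * L)).
    by rewrite [in RHS]mulrBr mulKf // opprB.
  rewrite normrN normrM normfV => Hb.
  rewrite mulrC ler_pdivrMr ?normr_gt0 //; apply: (le_trans Hb).
  rewrite mulrCA mulrC ler_wpM2r // mulrAC ler_pdivrMr ?ltr_wpDl //.
  by rewrite ler_wpM2l ?ltW // ltrDl.
split; first by apply/cvg_ex; exists L.
exact/cvg_lim.
Unshelve. all: by end_near.
Qed.

Lemma taylor1 m (f : 'rV[R]_m -> R) (a w : 'rV[R]_m) (L B : R) : Ck 1 f ->
  (forall t, 0 <= t <= 1 -> `|\sum_i w 0 i * partial i f (a + t *: w) - L| <= B) ->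
  `|f (a + w) - f a - L| <= B.
Proof.
move=> fC H; have [c [_ /(_ ler01) c01]] := mvt_from0 1 (fun t : R => is_derive_line_Ck1 a w t fC).
by rewrite scale1r scale0r addr0 mulr1 => ->; exact: H.
Qed.

(** The mean value theorem is used once for each order of derivative, from the third down, which
    gives the remainder the factor 1 instead of 1/6; only its cubic order matters. *)
Lemma taylor2 m (f : 'rV[R]_m -> R) (a w : 'rV[R]_m) (B : R) : Ck 3 f ->
  (forall i j k t, 0 <= t <= 1 -> `|partial k (partial j (partial i f)) (a + t *: w)| <= B) ->
  `|f (a + w) - f a - \sum_i w 0 i * partial i f a
     - 2^-1 * \sum_i w 0 i * \sum_j w 0 j * partial j (partial i f) a|
  <= B * (\sum_i `|w 0 i|) ^+ 3.
Proof.
move=> fC H; set S := \sum_i `|w 0 i|; set D := \sum_i w 0 i * \sum_j _.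
have S0 : 0 <= S := sum_abs_coord_ge0 w.
have C2 i : Ck 2 (partial i f) by case: fC => _ /(_ i)[].
have C1 i j : Ck 1 (partial j (partial i f)) by case: (C2 i) => _ /(_ j)[].
have abs_sum (g : 'I_m -> R) (b : R) : (forall i, `|g i| <= b) -> `|\sum_i w 0 i * g i| <= b * S.
  move=> gb; rewrite (le_trans (ler_norm_sum _ _ _)) // mulr_sumr; apply: ler_sum => i _.
  by rewrite normrM mulrC ler_wpM2r.
have step2 i j t : 0 <= t <= 1 ->
    `|partial j (partial i f) (a + t *: w) - partial j (partial i f) a| <= B * S.
  move=> /andP[t0 t1]; rewrite -[X in `|X|]subr0; apply: taylor1 => // u /andP[u0 u1].
  rewrite subr0 (_ : \sum_i0 _ = t * \sum_k w 0 k * partial k (partial j (partial i f)) (a + (u * t) *: w)); last first.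
    by rewrite mulr_sumr; apply: eq_bigr => k _; rewrite mxE scalerA mulrA.
  rewrite normrM ger0_norm // -[leRHS]mul1r ler_pM //; apply: abs_sum => k; apply: H.
  by rewrite mulr_ge0 // mulr_ile1.
have step1 i t : 0 <= t <= 1 -> `|partial i f (a + t *: w) - partial i f a
    - t * \sum_j w 0 j * partial j (partial i f) a| <= B * S ^+ 2.
  move=> /andP[t0 t1]; apply: taylor1; first exact: (CkW (C2 i)).
  move=> u /andP[u0 u1].
  rewrite (_ : _ - _ = t * \sum_j w 0 j * (partial j (partial i f) (a + (u * t) *: w) - partial j (partial i f) a)).
    rewrite normrM ger0_norm // -[leRHS]mul1r ler_pM // expr2 mulrA; apply: abs_sum => j.
    by apply: step2; rewrite mulr_ge0 // mulr_ile1.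
  under [in RHS]eq_bigr do rewrite mulrBr.
  rewrite sumrB [in RHS]mulrBr; congr (_ - _); rewrite mulr_sumr; apply: eq_bigr => j _.
  by rewrite mxE scalerA mulrA.
(* The restriction to the segment minus its Taylor polynomial in [t]; [step1] bounds its
   derivative. *)
pose phi (t : R) := f (a + t *: w) - (t * \sum_i w 0 i * partial i f a + 2^-1 * t ^+ 2 * D).
pose dphi (t : R) := \sum_i w 0 i * partial i f (a + t *: w) - (\sum_i w 0 i * partial i f a + t * D).
have phid (t : R) : is_derive t (1 : R) phi (dphi t).
  apply: is_deriveB; first exact: (is_derive_line_Ck1 a w t (CkW (CkW fC))).
  apply: is_derive_eq; rewrite /GRing.scale /= !(mulr1, mulr0, addr0, add0r, expr1).
  congr (_ + _); rewrite -mulr_natl; field => //.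
have [c [_ /(_ ler01) c01]] := mvt_from0 1 phid.
rewrite mulr1 /phi scale1r scale0r addr0 expr1n expr0n /= !(mulr0, mul0r, mulr1, mul1r, addr0, subr0).
rewrite (_ : _ - _ - f a = f (a + w) - f a - \sum_i w 0 i * partial i f a - 2^-1 * D) => [->|]; last by ring.
rewrite /dphi (_ : _ - _ = \sum_i w 0 i * (partial i f (a + c *: w) - partial i f a
    - c * \sum_j w 0 j * partial j (partial i f) a)).
  by rewrite exprSr mulrA; apply: abs_sum => i; exact: step1.
rewrite /D mulr_sumr -big_split /= -sumrB; apply: eq_bigr => i _; ring.
Qed.

End LineCalculus.

(** * Boundary charts *)

Section Charts.
Variables (R : realType) (n : nat).
Implicit Types (E : set 'rV[R]_n.+1) (x y z u d : 'rV[R]_n.+1) (M : 'M[R]_n.+1)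
  (gam : 'rV[R]_n -> R).

Lemma frontD u z : front (u + z) = front u + front z.
Proof. by apply/rowP => i; rewrite !mxE. Qed.

Lemma frontZ c u : front (c *: u) = c *: front u.
Proof. by apply/rowP => i; rewrite !mxE. Qed.

Lemma frontB u z : front (u - z) = front u - front z.
Proof. by apply/rowP => i; rewrite !mxE. Qed.

Lemma front0 : front (0 : 'rV[R]_n.+1) = 0.
Proof. by apply/rowP => i; rewrite !mxE. Qed.

Lemma enorm_front_le u : enorm (front u) <= enorm u.
Proof. by rewrite -{2}(extl_front u) enorm_extl enorm_consr_ge. Qed.

(** A defining function of [E] in the chart: negative in [E], positive off its closure, zero on its
    boundary. *)
Definition chartF x M gam z : R :=
  ((z - x) *m M) 0 ord_max - gam (front ((z - x) *m M)).

Definition chart_grad x M gam y : 'rV[R]_n :=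
  \row_i partial i gam (front ((y - x) *m M)).

(** The gradient of [chartF] at [y] in the original coordinates: an outward normal at [y], not
    normalised, read off from the chart at a different point [x]. *)
Definition chart_nvec x M gam y : 'rV[R]_n.+1 := extl (- chart_grad x M gam y) 1 *m M^T.

Lemma chartF_increment x M gam y u : chartF x M gam (y + u) - chartF x M gam y =
  (u *m M) 0 ord_max - (gam (front ((y - x) *m M) + front (u *m M)) - gam (front ((y - x) *m M))).
Proof.
rewrite /chartF.
have -> : (y + u - x) *m M = (y - x) *m M + u *m M by rewrite -mulmxDl addrAC.
by rewrite frontD mxE; ring.
Qed.

Lemma dotp_nvec x M gam y u : dotp u (chart_nvec x M gam y) =
  (u *m M) 0 ord_max - \sum_i partial i gam (front ((y - x) *m M)) * front (u *m M) 0 i.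
Proof.
rewrite /chart_nvec -dotp_mulmxT -{1}(extl_front (u *m M)) dotp_extl mulr1; congr (_ + _).
by rewrite -sumrN; apply: eq_bigr => i _; rewrite !mxE mulrN mulrC.
Qed.

Lemma enorm_mulmxT M u : M *m M^T = 1%:M -> enorm (u *m M^T) = enorm u.
Proof. by move=> MM; rewrite enorm_mulmx // trmxK; exact: mulmx1C. Qed.

Lemma enorm_nvec_ge1 x M gam y : M *m M^T = 1%:M -> 1 <= enorm (chart_nvec x M gam y).
Proof.
move=> MM; rewrite /chart_nvec enorm_mulmxT // enorm_extl.
by rewrite (le_trans _ (enorm_consr_geh _ _)) // normr1.
Qed.

Lemma chartF_continuous x M gam : M *m M^T = 1%:M -> continuous gam ->
  continuous (chartF x M gam).
Proof.
move=> MM cg z.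
have c1 : continuous (fun z : 'rV[R]_n.+1 => (z - x) *m M).
  apply: (@enorm_continuous_map _ _ _ _ 1) => a b.
  by rewrite -mulmxBl enorm_mulmx // mul1r opprB addrA subrK.
have c2 : continuous (fun z : 'rV[R]_n.+1 => front ((z - x) *m M)).
  apply: (@enorm_continuous_map _ _ _ _ 1) => a b.
  have -> : front ((a - x) *m M) - front ((b - x) *m M) = front ((a - b) *m M).
    by rewrite -frontB -mulmxBl opprB addrA subrK.
  by rewrite (le_trans (enorm_front_le _)) // enorm_mulmx // mul1r.
apply: (@continuousB R R^o _ (fun z => ((z - x) *m M) 0 ord_max) (fun z => gam (front ((z - x) *m M)))).
  apply: (@continuous_comp _ _ _ _ (fun u : 'rV[R]_n.+1 => u 0 ord_max)); first exact: c1.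
  exact: coord_continuous.
by apply: (@continuous_comp _ _ _ _ gam); [exact: c2|exact: cg].
Qed.

Lemma chartF_in E x M r gam z : bchart E x M r gam -> enorm (z - x) < r ->
  E z <-> chartF x M gam z < 0.
Proof. by case=> _ _ _ _ H /H; rewrite /chartF subr_lt0. Qed.

Lemma chartF_out E x M r gam z : bchart E x M r gam -> continuous gam ->
  enorm (z - x) < r -> 0 < chartF x M gam z -> ~ closure E z.
Proof.
move=> ch cg zr Fz cl; have [MM _ _ _ _] := ch.
have /continuous_enormP/(_ _ Fz)[d d0 dP] := @chartF_continuous x M gam MM cg z.
have [z' [Ez' []]] : E `&` [set z' | enorm (z' - x) < r /\ 0 < chartF x M gam z'] !=set0.
  apply: cl; apply/nbhs_enormP; exists (Num.min d (r - enorm (z - x))).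
    by rewrite lt_min d0 subr_gt0.
  move=> z'; rewrite lt_min => /andP[zd zr'] /=; split.
    have := enorm_triangle (z' - z) (z - x); rewrite addrA subrK; lra.
  by have := dP _ zd; rewrite ltr_norml => /andP[+ _]; lra.
move=> /= z'r; move: Ez' => /(chartF_in ch z'r); lra.
Qed.

Lemma chartF_bdry E x M r gam y : open E -> bchart E x M r gam -> continuous gam ->
  enorm (y - x) < r -> bdry E y -> chartF x M gam y = 0.
Proof.
move=> oE ch cg yr [cy iy]; apply/eqP; rewrite eq_le; apply/andP; split; rewrite leNgt.
  by apply/negP => /(chartF_out ch cg yr); apply.
apply/negP => /(chartF_in ch yr) Ey; apply: iy.
by rewrite (interior_id E).1.
Qed.

Lemma Ck1_increment gam (a d : 'rV[R]_n) (e : R) : Ck 1 gam -> 0 < e ->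
  exists2 dl, 0 < dl & forall ep, 0 < ep < dl ->
  `|gam (a + ep *: d) - gam a - ep * \sum_i partial i gam a * d 0 i| <= e * ep.
Proof.
move=> gC e0; set S := \sum_i `|d 0 i|.
have S0 : 0 <= S := sum_abs_coord_ge0 d.
have e1 : 0 < e / (S + 1) by rewrite divr_gt0 // ltr_wpDl.
have [dl dl0 dlP] := Ck1_uniform_partial a gC e1.
have d0 := enorm_ge0 d.
exists (dl / (enorm d + 1)); first by rewrite divr_gt0 // ltr_wpDl.
move=> ep /andP[ep0 epd].
have := @box_mvt R n gam (fun i => partial i gam a) (e / (S + 1)) a (ep *: d) (Ck1_derivable gC).
have -> : \sum_i `|(ep *: d) 0 i| = ep * S.
  by rewrite mulr_sumr; apply: eq_bigr => i _; rewrite mxE normrM gtr0_norm.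
have -> : \sum_i partial i gam a * (ep *: d) 0 i = ep * \sum_i partial i gam a * d 0 i.
  by rewrite mulr_sumr; apply: eq_bigr => i _; rewrite mxE mulrCA.
move=> Hb; apply: (le_trans (Hb _)).
  move=> i z zb; apply: dlP; rewrite (le_lt_trans zb) // enormZ gtr0_norm //.
  apply: (@le_lt_trans _ _ (ep * (enorm d + 1))); first by rewrite ler_wpM2l ?lerDl // ltW.
  by rewrite -ltr_pdivlMr // ltr_wpDl.
rewrite mulrCA mulrC ler_wpM2r ?(ltW ep0) // mulrAC ler_pdivrMr ?ltr_wpDl //.
by rewrite ler_wpM2l ?lerDl // ltW.
Qed.

(** Along a ray that leaves [y] transversally, the first-order term of [chartF] decides the sign,
    because the remainder is at most half of it for short times. *)
Lemma halfspace E x M r gam y d : open E -> bchart E x M r gam -> Ck 1 gam ->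
  enorm (y - x) < r -> bdry E y -> dotp d (chart_nvec x M gam y) != 0 ->
  exists2 dl, 0 < dl & forall ep, 0 < ep < dl ->
    E (y + ep *: d) <-> dotp d (chart_nvec x M gam y) < 0.
Proof.
move=> oE ch gC yr By; set L := dotp d _ => L0.
have cg : continuous gam by case: gC.
have e0 : 0 < `|L| / 2 by rewrite divr_gt0 ?normr_gt0.
have [dl dl0 dlP] := Ck1_increment (front ((y - x) *m M)) (front (d *m M)) gC e0.
have d0 := enorm_ge0 d.
exists (Num.min dl ((r - enorm (y - x)) / (enorm d + 1))).
  by rewrite lt_min dl0 divr_gt0 ?subr_gt0 // ltr_wpDl.
move=> ep /andP[ep0]; rewrite lt_min => /andP[epd epr].
have zr : enorm (y + ep *: d - x) < r.
  rewrite addrAC (le_lt_trans (enorm_triangle _ _)) // enormZ gtr0_norm //.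
  have : ep * (enorm d + 1) < r - enorm (y - x) by rewrite -ltr_pdivlMr // ltr_wpDl.
  by rewrite mulrDr; lra.
have Ein := chartF_in ch zr.
have F0 := chartF_bdry oE ch cg yr By.
have inc := chartF_increment x M gam y (ep *: d); rewrite F0 subr0 in inc.
have fE : front ((ep *: d) *m M) = ep *: front (d *m M) by rewrite -scalemxAl frontZ.
have lE : ((ep *: d) *m M) 0 ord_max = ep * (d *m M) 0 ord_max by rewrite -scalemxAl mxE.
rewrite inc fE lE in Ein; move: Ein.
have LE : L = _ := dotp_nvec x M gam y d.
have {}dlP := dlP ep; rewrite ep0 epd in dlP; move: (dlP isT) LE.
set S := \sum_i _; set g1 := gam _; set g0 := gam _; set c := (d *m M) 0 ord_max.
rewrite ler_norml => /andP[h1 h2] LE ->.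
have cE : c = L + S by rewrite LE; ring.
have hL : L = `|L| \/ L = - `|L| by case: (ler0P L) => _; [right; rewrite opprK|left].
have aL : 0 < `|L| by rewrite normr_gt0.
have epL : 0 < ep * `|L| by rewrite mulr_gt0.
have E1 : ep * c = ep * L + ep * S by rewrite cE mulrDr.
have E2 : `|L| / 2 * ep = ep * `|L| / 2 by ring.
rewrite E1; rewrite E2 in h1 h2.
case: hL => hL.
  have E3 : ep * L = ep * `|L| by rewrite -hL.
  by split; lra.
have E3 : ep * L = - (ep * `|L|) by rewrite {1}hL mulrN.
by split; lra.
Qed.

Lemma chart_nvec_self E y M r gam : bchart E y M r gam -> chart_nvec y M gam y = chart_normal M.
Proof.
case=> MM _ _ dg _; rewrite /chart_nvec /chart_normal evec_max; congr (extl _ _ *m _).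
apply/rowP => i; rewrite !mxE subrr mul0mx front0.
by have [_ ->] := dg i; rewrite oppr0.
Qed.

Lemma enorm_chart_normal M : M *m M^T = 1%:M -> enorm (chart_normal M) = 1.
Proof. by move=> MM; rewrite /chart_normal enorm_mulmxT // enorm_evec. Qed.

(* Otherwise [d], the difference of the unit normals, would point strictly into
   [E] for one chart and strictly out of [E] for the other. *)
Lemma chart_nvec_normal E x M r gam y M' r' gam' : open E ->
  bchart E x M r gam -> Ck 1 gam -> enorm (y - x) < r -> bdry E y ->
  bchart E y M' r' gam' -> Ck 1 gam' ->
  chart_nvec x M gam y = enorm (chart_nvec x M gam y) *: chart_normal M'.
Proof.
move=> oE ch gC yr By ch' gC'; have [MM _ _ _ _] := ch; have [MM' r'0 _ _ _] := ch'.
set v := chart_nvec x M gam y; set w := chart_normal M'.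
have v1 : 1 <= enorm v by exact: enorm_nvec_ge1.
have v0 : 0 < enorm v by rewrite (lt_le_trans ltr01).
have w1 : enorm w = 1 by exact: enorm_chart_normal.
pose d := (enorm v)^-1 *: v - w.
have ww : dotp w w = 1 by rewrite -sqr_enorm w1 expr1n.
have vv : dotp v v = enorm v ^+ 2 by rewrite sqr_enorm.
set c := dotp v w.
have dw : dotp d w = (enorm v)^-1 * c - 1 by rewrite dotpDl dotpZl dotpNl ww.
have dv : dotp d v = enorm v * (1 - (enorm v)^-1 * c).
  rewrite dotpDl dotpZl dotpNl vv (dotpC w) -/c mulrBr mulr1 mulVKf ?gt_eqF //.
  by rewrite expr2 mulKf // gt_eqF.
have dd : enorm d ^+ 2 = 2 * (1 - (enorm v)^-1 * c).
  rewrite sqr_enorm {2}/d dotpDr dotpZr dotpNr dw dv mulKf ?gt_eqF //; ring.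
have [d0|d0] := eqVneq (enorm d) 0.
  move/enorm_eq0/eqP: d0; rewrite subr_eq0 => /eqP <-.
  by rewrite scalerA mulfV ?gt_eqF // scale1r.
have dp : 0 < 1 - (enorm v)^-1 * c.
  by rewrite -(pmulr_rgt0 _ (ltr0n R 2)) -dd exprn_gt0 // lt_def d0 enorm_ge0.
have dv0 : 0 < dotp d v by rewrite dv mulr_gt0.
have dw0 : dotp d (chart_nvec y M' gam' y) < 0.
  by rewrite (chart_nvec_self ch') dw; lra.
have [|e1 e10 H1] := halfspace oE ch gC yr By (d := d); first by rewrite gt_eqF.
have yy : enorm (y - y) < r' by rewrite subrr enorm0.
have [|e2 e20 H2] := halfspace oE ch' gC' yy By (d := d); first by rewrite lt_eqF.
have ep0 : 0 < Num.min e1 e2 / 2 by rewrite divr_gt0 // lt_min e10.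
have lt12 : Num.min e1 e2 / 2 < Num.min e1 e2 by rewrite gtr_pMr ?invf_lt1 ?ltr1n // lt_min e10.
have : E (y + Num.min e1 e2 / 2 *: d).
  by apply/H2 => //; rewrite ep0 (lt_le_trans lt12) // ge_min lexx orbT.
move/H1; rewrite ep0 (lt_le_trans lt12) ?ge_min ?lexx // => /(_ isT).
by rewrite ltNge (ltW dv0).
Qed.

(** In the frame of the chart at [y], the first-order term of the chart at [x] depends on the height
    alone: the two charts have the same tangent plane. *)
Lemma chart_nvec_frame E x M r gam y M' r' gam' (h : R) (w : 'rV[R]_n) : open E ->
  bchart E x M r gam -> Ck 1 gam -> enorm (y - x) < r -> bdry E y ->
  bchart E y M' r' gam' -> Ck 1 gam' ->
  dotp (extl w h *m M'^T) (chart_nvec x M gam y) = enorm (chart_nvec x M gam y) * h.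
Proof.
move=> oE ch gC yr By ch' gC'.
rewrite {1}(chart_nvec_normal oE ch gC yr By ch' gC') dotpZr; congr (_ * _).
have [MM' _ _ _ _] := ch'; rewrite /chart_normal dotp_mulmx ?trmxK; last exact: mulmx1C.
by rewrite dotp_evec extl_max.
Qed.

(** Contact of order [p] with the graph of [Q]. One constant measures both the error and the inverse
    of the radius, so the property weakens as [C] grows, which [compact_uniform] requires. The upper
    region avoids the closure of [E], so that [tauE] is [-1] there. *)
Definition sandwich E y M (Q : 'rV[R]_n -> R) (p C : R) : Prop :=
  forall (w : 'rV[R]_n) (h : R), enorm (consr h w) < C^-1 ->
    (h < Q w - C * enorm w `^ p -> E (y + extl w h *m M^T)) /\
    (Q w + C * enorm w `^ p < h -> ~ closure E (y + extl w h *m M^T)).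

Lemma sandwich_mono E y M Q p C C' : 0 < C -> C <= C' ->
  sandwich E y M Q p C -> sandwich E y M Q p C'.
Proof.
move=> C0 CC H w h wh.
have C'0 : 0 < C' by rewrite (lt_le_trans C0).
have wC : enorm (consr h w) < C^-1.
  by rewrite (lt_le_trans wh) // lef_pV2.
have cc : C * enorm w `^ p <= C' * enorm w `^ p by rewrite ler_wpM2r // powR_ge0.
have [H1 H2] := H w h wC; split => hh; [apply: H1|apply: H2]; lra.
Qed.

Lemma sandwich_of_sign E x M r gam y M' Q p C :
  bchart E x M r gam -> continuous gam -> M' *m M'^T = 1%:M ->
  enorm (y - x) < r / 2 -> 2 / r <= C ->
  (forall (w : 'rV[R]_n) (h : R), enorm (consr h w) < C^-1 ->
    (h < Q w - C * enorm w `^ p -> chartF x M gam (y + extl w h *m M'^T) < 0) /\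
    (Q w + C * enorm w `^ p < h -> 0 < chartF x M gam (y + extl w h *m M'^T))) ->
  sandwich E y M' Q p C.
Proof.
move=> ch cg MM' yr rC H w h wh; have [_ r0 _ _ _] := ch.
have zr : enorm (y + extl w h *m M'^T - x) < r.
  rewrite addrAC (le_lt_trans (enorm_triangle _ _)) //.
  rewrite enorm_mulmxT // enorm_extl.
  have C2 : C^-1 <= r / 2.
    by rewrite -[r / 2]invrK lef_pV2 ?posrE ?invr_gt0 ?divr_gt0 // ?invf_div // (lt_le_trans _ rC) // divr_gt0.
  lra.
have [H1 H2] := H w h wh; split => hh.
  by apply/(chartF_in ch zr); exact: H1.
by apply: (chartF_out ch cg zr); exact: H2.
Qed.

End Charts.

(** * Sandwiching the domain between model regions *)

Section Sandwich.
Variables (R : realType) (n : nat).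
Implicit Types (E : set 'rV[R]_n.+1) (x y : 'rV[R]_n.+1).

Lemma locally_bounded_family (I : finType) (f : I -> 'rV[R]_n -> R) (c : 'rV[R]_n) :
  (forall i, {for c, continuous (f i)}) ->
  exists d B, [/\ 0 < d, 0 <= B & forall i z, enorm (z - c) < d -> `|f i z| <= B].
Proof.
move=> fc.
have H i : {d | 0 < d & forall z, enorm (z - c) < d -> `|f i z - f i c| < 1}.
  by apply: cid2; have /continuous_enormP/(_ _ ltr01) := fc i.
have dp i : 0 <= (s2val (H i))^-1.
  have di0 : 0 < s2val (H i) := s2valP (H i).
  by rewrite invr_ge0; exact: ltW.
pose s := \sum_i (s2val (H i))^-1.
have s0 : 0 <= s by apply: sumr_ge0.
pose B := \sum_i (`|f i c| + 1).
have Bi i : 0 <= `|f i c| + 1 by rewrite addr_ge0.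
exists (s + 1)^-1, B; split; [by rewrite invr_gt0 ltr_wpDl|exact: sumr_ge0|].
move=> i z zd.
have di0 : 0 < s2val (H i) := s2valP (H i).
have : `|f i z - f i c| < 1.
  apply: (s2valP' (H i)); rewrite (lt_le_trans zd) //.
  rewrite -[leRHS]invrK lef_pV2 ?posrE ?invr_gt0 ?ltr_wpDl //.
  by rewrite /s (bigD1 i) //= -addrA lerDl addr_ge0 // sumr_ge0.
move=> fz; apply: (@le_trans _ _ (`|f i c| + 1)).
  by rewrite -(subrK (f i c) (f i z)) (le_trans (ler_normD _ _)) // addrC lerD2l ltW.
by rewrite /B (bigD1 i) //= lerDl sumr_ge0.
Qed.

(** Here [h] is the height of a point, [k] its tangential distance and [u] its norm. If [k <= |h|],
    then [u <= 2 |h|] and the smallness of [u ^ be] makes the error less than [|h|]; if [|h| < k],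
    then [u <= 2 k] and the error is at most [C k ^ (1 + be)], which is less than [|h|] by
    assumption. *)
Lemma dominated_sign1 (C1 C be N h k u F : R) :
  0 < be -> 1 <= C1 -> 1 <= N -> 0 <= k -> 0 <= u -> u <= `|h| + k ->
  `|F - N * h| <= C1 * u `^ (1 + be) ->
  C1 * 2 `^ (1 + be) <= C -> (2 * C1 + 1) `^ be^-1 <= C -> u < C^-1 ->
  (h < 0 - C * k `^ (1 + be) -> F < 0) /\ (0 + C * k `^ (1 + be) < h -> 0 < F).
Proof.
move=> be0 C11 N1 k0 u0 uhk Fe C2 C3 uC.
have C10 : 0 < C1 by rewrite (lt_le_trans ltr01).
have D0 : 0 < 2 * C1 + 1 by lra.
have Dp : 0 < (2 * C1 + 1) `^ be^-1 by exact: powR_gt0.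
have C0 : 0 < C by rewrite (lt_le_trans Dp).
have be1 : 0 <= 1 + be by lra.
have ub : u `^ be <= (2 * C1 + 1)^-1.
  have uD : u <= ((2 * C1 + 1) `^ be^-1)^-1 by rewrite (le_trans (ltW uC)) // lef_pV2.
  have : u `^ be <= (((2 * C1 + 1) `^ be^-1)^-1) `^ be.
    by rewrite ge0_ler_powR ?nnegrE ?invr_ge0 // ltW.
  move/le_trans; apply.
  have DE : ((2 * C1 + 1) `^ be^-1) `^ be = 2 * C1 + 1.
    by rewrite -powRrM mulVf ?gt_eqF // powRr1 // ltW.
  rewrite -[X in X `^ be]powR_inv1 ?powR_ge0 // (powRAC _ (-1) be) DE.
  by rewrite powR_inv1 // ltW.
have key : C * k `^ (1 + be) < `|h| -> C1 * u `^ (1 + be) < `|h|.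
  move=> hh; have h0 : 0 < `|h| by rewrite (le_lt_trans _ hh) // mulr_ge0 ?powR_ge0 // ltW.
  have [kh|hk] := leP k `|h|.
    have u2 : u <= 2 * `|h| by lra.
    rewrite powRD; last by apply/implyP; rewrite gt_eqF //; lra.
    rewrite powRr1 //.
    have : u * u `^ be <= 2 * `|h| * (2 * C1 + 1)^-1 by rewrite ler_pM ?powR_ge0.
    move=> e1; have : C1 * (u * u `^ be) <= C1 * (2 * `|h| * (2 * C1 + 1)^-1) by rewrite ler_pM2l.
    move/le_lt_trans; apply.
    by rewrite !mulrA ltr_pdivrMr // [X in X < _]mulrC ltr_pM2l //; lra.
  have u2 : u <= 2 * k by lra.
  apply: (le_lt_trans _ hh); apply: (@le_trans _ _ (C1 * (2 * k) `^ (1 + be))).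
    by rewrite ler_pM2l // ge0_ler_powR ?nnegrE // mulr_ge0.
  by rewrite powRM // mulrA ler_wpM2r ?powR_ge0.
have Nh : `|h| <= N * `|h| by rewrite ler_peMl.
move: Fe; rewrite ler_norml => /andP[F1 F2].
split => hh.
  have h0 : h < 0 by rewrite (lt_le_trans hh) // sub0r oppr_le0 mulr_ge0 ?powR_ge0 // ltW.
  have := key; rewrite ltr0_norm // in Nh *; move=> /(_ ltac:(lra)); rewrite mulrN in Nh; lra.
have h0 : 0 < h by rewrite (le_lt_trans _ hh) // add0r mulr_ge0 ?powR_ge0 // ltW.
have := key; rewrite gtr0_norm // in Nh *; move=> /(_ ltac:(lra)); lra.
Qed.

(** The threshold is [|h| = D k ^ 2]. Below it [u] is comparable to [k], and both error terms are of
    order [k ^ 3]. Above it [|q|] and the error are each at most [|h| / 4], so [h] alone decides the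
    sign. The term [|h| u] comes from the cross terms of a quadratic form in tilted coordinates. *)
Lemma dominated_sign2 (C1 D C h k u q F : R) :
  1 <= C1 -> D = 4 * C1 -> 0 <= k -> 0 <= u -> u <= `|h| + k -> `|h| <= u -> k <= u ->
  `|F - h + q| <= C1 * (u ^+ 3 + `|h| * u) -> `|q| <= C1 * k ^+ 2 ->
  C1 * ((1 + D) ^+ 3 + D * (1 + D)) <= C -> u < C^-1 ->
  (h < q - C * k ^+ 3 -> F < 0) /\ (q + C * k ^+ 3 < h -> 0 < F).
Proof.
move=> C11 DE k0 u0 uhk hu ku Fe qk CC uC.
have D1 : 1 <= D by lra.
have C20 : 20 * C1 <= C.
  apply: le_trans CC; rewrite mulrC ler_pM2l; last by lra.
  have : 5 * 4 <= D * (1 + D) by rewrite mulrC ler_pM //; lra.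
  have : 0 <= (1 + D) ^+ 3 by rewrite exprn_ge0 //; lra.
  lra.
have C0 : 0 < C by lra.
have uC1 : u * C < 1 by rewrite -ltr_pdivlMr // mul1r.
have u20 : 20 * C1 * u <= 1.
  by apply: le_trans (ltW uC1); rewrite [leRHS]mulrC ler_wpM2r.
have u1 : u <= 1 by apply: le_trans u20; rewrite ler_peMl //; lra.
have k3 : 0 <= k ^+ 3 by rewrite exprn_ge0.
have Ck3 : 0 <= C * k ^+ 3 by rewrite mulr_ge0 // ltW.
have h0 : 0 <= `|h| by [].
have [hD|hD] := leP `|h| (D * k ^+ 2).
  have uk : u <= (1 + D) * k.
    have : D * k ^+ 2 <= D * k.
      by rewrite ler_wpM2l ?(le_trans ler01) // expr2 ler_piMr // (le_trans ku).
    lra.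
  have e1 : u ^+ 3 <= (1 + D) ^+ 3 * k ^+ 3.
    by rewrite -exprMn ler_pXn2r ?nnegrE // mulr_ge0 //; lra.
  have e2 : `|h| * u <= D * (1 + D) * k ^+ 3.
    have -> : D * (1 + D) * k ^+ 3 = (D * k ^+ 2) * ((1 + D) * k) by ring.
    by rewrite ler_pM.
  have e3 : C1 * (u ^+ 3 + `|h| * u) <= C * k ^+ 3.
    apply: (@le_trans _ _ (C1 * ((1 + D) ^+ 3 + D * (1 + D)) * k ^+ 3)).
      rewrite -mulrA ler_pM2l; last by lra.
      by rewrite mulrDl lerD.
    by rewrite ler_wpM2r.
  move: Fe; rewrite ler_norml => /andP[F1 F2]; split; lra.
have qh : 4 * `|q| <= `|h|.
  by apply: ltW; apply: le_lt_trans hD; rewrite DE -mulrA ler_pM2l.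
have kh : k ^+ 2 <= `|h|.
  apply: ltW; apply: le_lt_trans hD; rewrite -[leLHS]mul1r ler_wpM2r //.
  by rewrite exprn_ge0.
have u2 : u ^+ 2 <= 4 * `|h|.
  have : u ^+ 2 <= (`|h| + k) ^+ 2 by rewrite ler_pXn2r ?nnegrE // addr_ge0.
  have : `|h| ^+ 2 <= `|h| by rewrite expr2 ler_piMr // (le_trans hu).
  have : 0 <= (`|h| - k) ^+ 2 by exact: sqr_ge0.
  have -> : (`|h| - k) ^+ 2 = `|h| ^+ 2 - 2 * (`|h| * k) + k ^+ 2 by ring.
  have -> : (`|h| + k) ^+ 2 = `|h| ^+ 2 + 2 * (`|h| * k) + k ^+ 2 by ring.
  lra.
have e : C1 * (u ^+ 3 + `|h| * u) <= `|h| / 4.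
  apply: (@le_trans _ _ (C1 * (5 * `|h| * u))).
    rewrite ler_pM2l; last by lra.
    have : u ^+ 3 <= 4 * `|h| * u by rewrite exprSr ler_wpM2r.
    lra.
  have -> : C1 * (5 * `|h| * u) = (20 * C1 * u) * (`|h| / 4) by field.
  by rewrite ler_piMl // divr_ge0.
move: Fe; rewrite ler_norml => /andP[F1 F2].
have [q1 q2] : - `|q| <= q /\ q <= `|q| by split; [rewrite lerNl -normrN ler_norm|exact: ler_norm].
split => hh.
  have hn : h < 0 by case: (ltrP h 0) => // hp; rewrite (ger0_norm hp) in qh; lra.
  have hE := ltr0_norm hn; set X := C1 * _ in e F1 F2; lra.
have hp : 0 < h by case: (ltrP 0 h) => // hn; rewrite (ler0_norm hn) in qh; lra.
have hE := gtr0_norm hp; set X := C1 * _ in e F1 F2; lra.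
Qed.

(** The radius and the Hölder constant of the chart at [y] are not controlled as [y] varies. Only
    the frame [M'] of that chart is used, for the normal; the estimate comes from the fixed chart at
    [x], through [chart_nvec_frame]. *)
Lemma c1beta_sandwich_local E nu be x : open E -> 0 < be -> C1beta_boundary E be nu ->
  bdry E x -> exists C e, [/\ 0 < C, 0 < e & forall y, enorm (y - x) < e -> bdry E y ->
    exists M, [/\ M *m M^T = 1%:M, nu y = chart_normal M &
      sandwich E y M (fun=> 0) (1 + be) C]].
Proof.
move=> oE be0 Eb Bx; have [M [r [gam [ch [gC [[Cg gH] _]]]]]] := Eb x Bx.
have [MM r0 _ _ _] := ch.
have cg : continuous gam by case: gC.
pose C1 := `|Cg| * n%:R + 1.
have C11 : 1 <= C1 by rewrite lerDr mulr_ge0.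
pose C := Num.max (2 / r) (Num.max (C1 * 2 `^ (1 + be)) ((2 * C1 + 1) `^ be^-1)).
have Ca : 2 / r <= C by rewrite le_max lexx.
have Cb : C1 * 2 `^ (1 + be) <= C by rewrite !le_max lexx orbT.
have Cc : (2 * C1 + 1) `^ be^-1 <= C by rewrite !le_max lexx !orbT.
have C0 : 0 < C by rewrite (lt_le_trans _ Ca) // divr_gt0.
exists C, (r / 2); split => //; first by rewrite divr_gt0.
move=> y yr By.
have [M' [r' [gam' [ch' [gC' [_ nuy]]]]]] := Eb y By.
have [MM' _ _ _ _] := ch'.
have yr' : enorm (y - x) < r by rewrite (lt_trans yr) // gtr_pMr // invf_lt1 // ltr1n.
exists M'; split => //; apply: (sandwich_of_sign ch cg MM' yr Ca) => w h wh.
set u := extl w h *m M'^T.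
have uE : enorm u = enorm (consr h w) by rewrite /u enorm_mulmxT // enorm_extl.
apply: (@dominated_sign1 C1 C be (enorm (chart_nvec x M gam y)) h (enorm w) (enorm u)) => //.
- exact: enorm_nvec_ge1.
- exact: enorm_ge0.
- exact: enorm_ge0.
- by rewrite uE enorm_consr_le.
- have := chartF_increment x M gam y u.
  rewrite (chartF_bdry oE ch cg yr' By) subr0 => ->.
  rewrite -(chart_nvec_frame h w oE ch gC yr' By ch' gC') -/u dotp_nvec.
  set a := front _; set v := front _.
  rewrite (_ : _ - _ = - (gam (a + v) - gam a - \sum_i partial i gam a * v 0 i)); last by ring.
  rewrite normrN.
  have vu : enorm v <= enorm u by rewrite (le_trans (enorm_front_le _)) // enorm_mulmx.
  have ar : enorm a < r / 2 by rewrite (le_lt_trans (enorm_front_le _)) // enorm_mulmx.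
  have vr : enorm v < r / 2.
    rewrite (le_lt_trans vu) // uE (lt_le_trans wh) //.
    by rewrite -[r / 2]invrK lef_pV2 ?posrE ?invr_gt0 ?divr_gt0 // ?invf_div.
  have := @box_mvt R n gam (fun i => partial i gam a) (`|Cg| * enorm v `^ be) a v (Ck1_derivable gC).
  move=> H; apply: (le_trans (H _)) => {H}.
    move=> i z zv; have zr : enorm z < r.
      by rewrite -(subrK a z) (le_lt_trans (enorm_triangle _ _)) //; lra.
    apply: (le_trans (gH i z a zr _)); first by lra.
    apply: (@le_trans _ _ (`|Cg| * enorm (z - a) `^ be)).
      by rewrite ler_wpM2r ?powR_ge0 // ler_norm.
    by rewrite ler_wpM2l // ge0_ler_powR ?nnegrE ?enorm_ge0 // ltW.
  apply: (@le_trans _ _ (`|Cg| * enorm v `^ be * (n%:R * enorm v))).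
    by rewrite ler_wpM2l ?enorm_ge_sum // mulr_ge0 ?powR_ge0.
  have -> : `|Cg| * enorm v `^ be * (n%:R * enorm v) = `|Cg| * n%:R * enorm v `^ (1 + be).
    rewrite powRD; last by apply/implyP; rewrite gt_eqF //; lra.
    by rewrite powRr1 ?enorm_ge0 //; ring.
  apply: ler_pM; rewrite ?powR_ge0 ?mulr_ge0 //; first by rewrite lerDl.
  by rewrite ge0_ler_powR ?nnegrE ?enorm_ge0 //; lra.
- by rewrite uE.
Qed.

(* Local constants become uniform on compact sets because [P] is monotone in the constant. *)
Lemma compact_uniform (K : set 'rV[R]_n.+1) (P : R -> 'rV[R]_n.+1 -> Prop) :
  compact K ->
  (forall x, K x -> exists C e, [/\ 0 < C, 0 < e &
     forall y, enorm (y - x) < e -> K y -> P C y]) ->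
  (forall C C' y, 0 < C -> C <= C' -> P C y -> P C' y) ->
  exists C, 1 <= C /\ forall y, K y -> P C y.
Proof.
move=> /compact_near_coveringP cK H mono.
have := cK R (pinfty_nbhs R) (fun C y => K y -> P C y) _.
case=> [x Kx|M [Mr MP]].
  have [C [e [C0 e0 CP]]] := H x Kx.
  exists ([set y | enorm (y - x) < e], [set C' | C < C']).
    split; first by apply/nbhs_enormP; exists e.
    by exists C; split => //; exact: num_real.
  move=> [y C'] /= [yx CC'] Ky; apply: (mono C) => //; first exact: ltW.
  exact: CP.
exists (Num.max 1 (M + 1)); split; first by rewrite le_max lexx.
move=> y Ky; apply: (MP (Num.max 1 (M + 1))) => //.
by rewrite lt_max ltrDl ltr01 orbT.
Qed.

Lemma c1beta_sandwich E nu be (K : set 'rV[R]_n.+1) : open E -> 0 < be ->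
  C1beta_boundary E be nu -> compact K -> K `<=` bdry E ->
  exists C, 1 <= C /\ forall y, K y -> exists M, [/\ M *m M^T = 1%:M, nu y = chart_normal M &
      sandwich E y M (fun=> 0) (1 + be) C].
Proof.
move=> oE be0 Eb cK KB; apply: compact_uniform => //.
  move=> x Kx; have [C [e [C0 e0 CP]]] := c1beta_sandwich_local oE be0 Eb (KB x Kx).
  by exists C, e; split => // y yx Ky; apply: CP => //; exact: KB.
move=> C C' y C0 CC [M [MM nuy sw]]; exists M; split => //.
exact: sandwich_mono sw.
Qed.

End Sandwich.

(** * Second-order contact with boundaries of class C^3 *)

Section SecondOrder.
Variables (R : realType) (n : nat).
Implicit Types (E : set 'rV[R]_n.+1) (x y : 'rV[R]_n.+1).

Definition bil (A : 'M[R]_n) (v w : 'rV[R]_n) : R :=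
  \sum_i v 0 i * \sum_j w 0 j * A i j.

Definition hess (f : 'rV[R]_n -> R) (a : 'rV[R]_n) : 'M[R]_n :=
  \matrix_(i, j) partial j (partial i f) a.

Lemma bilDl A v v' w : bil A (v + v') w = bil A v w + bil A v' w.
Proof. by rewrite -big_split; apply: eq_bigr => i _; rewrite mxE mulrDl. Qed.

Lemma bilZl A c v w : bil A (c *: v) w = c * bil A v w.
Proof. by rewrite mulr_sumr; apply: eq_bigr => i _; rewrite mxE mulrA. Qed.

Lemma bilDr A v w w' : bil A v (w + w') = bil A v w + bil A v w'.
Proof.
rewrite -big_split; apply: eq_bigr => i _ /=; rewrite -mulrDr -big_split; congr (_ * _).
by apply: eq_bigr => j _; rewrite mxE mulrDl.
Qed.

Lemma bilZr A c v w : bil A v (c *: w) = c * bil A v w.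
Proof.
rewrite mulr_sumr; apply: eq_bigr => i _; rewrite mulrCA; congr (_ * _).
by rewrite mulr_sumr; apply: eq_bigr => j _; rewrite mxE mulrA.
Qed.

Lemma bilZ A c v w : bil (c *: A) v w = c * bil A v w.
Proof.
rewrite mulr_sumr; apply: eq_bigr => i _; rewrite mulrCA; congr (_ * _).
by rewrite mulr_sumr; apply: eq_bigr => j _; rewrite mxE mulrCA.
Qed.

Lemma bil_le (A : 'M[R]_n) (B : R) v w : (forall i j, `|A i j| <= B) ->
  `|bil A v w| <= B * n%:R ^+ 2 * (enorm v * enorm w).
Proof.
(* For [n = 0] the number [B] could be negative, but both sides vanish. *)
move=> AB; case: (n =P 0%N) => [n0|/eqP n0].
  rewrite /bil big1 ?normr0; last first.
    by move=> [i ilt] _; exfalso; move: (ilt); rewrite n0.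
  by have -> : n%:R = 0 :> R; [rewrite n0|rewrite expr0n /= mulr0 mul0r].
have B0 : 0 <= B.
  have n1 : (0 < n)%N by rewrite lt0n.
  exact: le_trans (normr_ge0 _) (AB (Ordinal n1) (Ordinal n1)).
have H (c : 'I_n -> R) (u : 'rV[R]_n) b : (forall i, `|c i| <= b) -> 0 <= b ->
    `|\sum_i u 0 i * c i| <= b * (n%:R * enorm u).
  move=> cb b0; rewrite (le_trans (ler_norm_sum _ _ _)) //.
  apply: (@le_trans _ _ (b * \sum_i `|u 0 i|)); last by rewrite ler_wpM2l ?enorm_ge_sum.
  by rewrite mulr_sumr; apply: ler_sum => i _; rewrite normrM mulrC ler_wpM2r.
have -> : B * n%:R ^+ 2 * (enorm v * enorm w) = (B * (n%:R * enorm w)) * (n%:R * enorm v) by ring.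
apply: (H); last by rewrite !mulr_ge0 ?enorm_ge0.
by move=> i; apply: H.
Qed.

Lemma taylor2_bil (f : 'rV[R]_n -> R) (a w : 'rV[R]_n) (B : R) : Ck 3 f -> 0 <= B ->
  (forall i j k z, enorm (z - a) <= enorm w -> `|partial k (partial j (partial i f)) z| <= B) ->
  `|f (a + w) - f a - \sum_i partial i f a * w 0 i - 2^-1 * bil (hess f a) w w|
  <= B * n%:R ^+ 3 * enorm w ^+ 3.
Proof.
move=> fC B0 H; have := @taylor2 R n f a w B fC.
rewrite (_ : \sum_i w 0 i * \sum_j w 0 j * partial j (partial i f) a = bil (hess f a) w w); last first.
  by apply: eq_bigr => i _; congr (_ * _); apply: eq_bigr => j _; rewrite mxE.
rewrite (_ : \sum_i w 0 i * partial i f a = \sum_i partial i f a * w 0 i); last first.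
  by apply: eq_bigr => i _; rewrite mulrC.
move=> T; apply: (le_trans (T _)).
  move=> i j k t /andP[t0 t1]; apply: H; rewrite addrAC subrr add0r enormZ ger0_norm //.
  by rewrite ler_piMl ?enorm_ge0.
rewrite -mulrA ler_wpM2l // -exprMn ler_pXn2r ?nnegrE ?sum_abs_coord_ge0 ?mulr_ge0 ?enorm_ge0 //.
exact: enorm_ge_sum.
Qed.

Lemma locally_bounded_Ck3 (f : 'rV[R]_n -> R) (c : 'rV[R]_n) : Ck 3 f ->
  exists d B, [/\ 0 < d, 0 <= B,
    forall i j k z, enorm (z - c) < d -> `|partial k (partial j (partial i f)) z| <= B &
    forall i j z, enorm (z - c) < d -> `|partial j (partial i f) z| <= B].
Proof.
move=> fC.
have C2 i : Ck 2 (partial i f) by case: fC => _ /(_ i)[].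
have C1 i j : Ck 1 (partial j (partial i f)) by case: (C2 i) => _ /(_ j)[].
have [d1 [B1 [d10 B10 H1]]] := @locally_bounded_family R n ('I_n * 'I_n * 'I_n)%type
  (fun t => partial t.2 (partial t.1.2 (partial t.1.1 f))) c
  (fun t => @Ck1_continuous_partial R n _ (C1 t.1.1 t.1.2) t.2 c).
have [d2 [B2 [d20 B20 H2]]] := @locally_bounded_family R n ('I_n * 'I_n)%type
  (fun t => partial t.2 (partial t.1 f)) c
  (fun t => @Ck1_continuous_partial R n _ (CkW (C2 t.1)) t.2 c).
exists (Num.min d1 d2), (B1 + B2); split.
- by rewrite lt_min d10.
- exact: addr_ge0.
- move=> i j k z; rewrite lt_min => /andP[z1 _].
  by rewrite (le_trans (H1 (i, j, k) z z1)) // lerDl.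
- move=> i j z; rewrite lt_min => /andP[_ z2].
  by rewrite (le_trans (H2 (i, j) z z2)) // lerDr.
Qed.

(** At the point [t w] both quadratic forms differ from the boundary graph by [O(t ^ 3)], so by
    homogeneity they agree as [t] tends to [0]. This links the form found in the chart at a nearby
    point to the chart at [y], in which the value [H y] is defined. *)
Lemma sandwich_unique E y M Q C r gam w : 0 < C -> bchart E y M r gam -> Ck 3 gam ->
  sandwich E y M Q 3 C -> (forall t v, Q (t *: v) = t ^+ 2 * Q v) ->
  Q w = 2^-1 * bil (hess gam 0) w w.
Proof.
move=> C0 ch gC sw Qh; have [MM r0 g0 dg H] := ch.
have [d [B [d0 B0 H3 _]]] := locally_bounded_Ck3 0 gC.
set q := 2^-1 * _.
pose W := enorm w; have W0 : 0 <= W := enorm_ge0 w.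
pose K := B * n%:R ^+ 3 * W ^+ 3.
have K0 : 0 <= K by rewrite !mulr_ge0 ?exprn_ge0.
pose L := C * W ^+ 3.
have L0 : 0 <= L by rewrite mulr_ge0 ?exprn_ge0 // ltW.
(* Every height tested below is at most [t b], so for [t < t0] all the test points lie in the
   domains of both the chart and the sandwich. *)
pose b := `|q| + K + `|Q w| + L + 1.
have b0 : 0 < b.
  by rewrite /b; have := normr_ge0 q; have := normr_ge0 (Q w); lra.
pose t0 := Num.min 1 (Num.min (d / (W + 1)) (Num.min C^-1 r / (b + W + 1))).
have t00 : 0 < t0.
  by rewrite !lt_min ltr01 /= !divr_gt0 ?lt_min ?invr_gt0 ?C0 ?r0 //; lra.
have tay t : 0 < t < t0 -> `|gam (t *: w) - t ^+ 2 * q| <= t ^+ 3 * K.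
  rewrite !lt_min => /andP[tp /and3P[t1 td _]].
  have tW : enorm (t *: w) < d.
    rewrite enormZ gtr0_norm // -/W; move: td; rewrite ltr_pdivlMr; last by lra.
    by rewrite mulrDr; lra.
  have := @taylor2_bil gam 0 (t *: w) B gC B0.
  rewrite add0r g0 subr0 big1 ?subr0; last by move=> i _; have [_ ->] := dg i; rewrite mul0r.
  rewrite bilZl bilZr enormZ gtr0_norm // => T.
  have -> : t ^+ 2 * q = 2^-1 * (t * (t * bil (hess gam 0) w w)) by rewrite /q; ring.
  have -> : t ^+ 3 * K = B * n%:R ^+ 3 * (t * enorm w) ^+ 3 by rewrite /K /W exprMn; ring.
  apply: T => i j k z zt; apply: H3; rewrite (le_lt_trans zt) //.
  by rewrite -(gtr0_norm tp) -enormZ.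
have point t h : 0 < t < t0 -> `|h| <= t * b ->
    [/\ enorm (consr h (t *: w)) < C^-1,
        E (y + extl (t *: w) h *m M^T) <-> h < gam (t *: w) &
        enorm (y + extl (t *: w) h *m M^T - y) < r].
  rewrite !lt_min => /andP[tp /and3P[t1 td]].
  rewrite ltr_pdivlMr; last by lra.
  rewrite lt_min => /andP[tC tr] hb.
  have hW : enorm (consr h (t *: w)) <= t * b + t * W.
    by rewrite (le_trans (enorm_consr_le _ _)) // enormZ (gtr0_norm tp) -/W lerD2r.
  have tt : t * (b + W + 1) = t * b + t * W + t by ring.
  have ur : enorm (y + extl (t *: w) h *m M^T - y) < r.
    by rewrite addrAC subrr add0r enorm_mulmxT // enorm_extl; lra.
  split => //; first by lra.
  have := H _ ur; rewrite addrAC subrr add0r -mulmxA (mulmx1C MM) mulmx1.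
  by rewrite extl_max front_extl.
have cmp t : 0 < t < t0 -> `|Q w - q| <= t * (K + L).
  move=> tt; have := tt; rewrite !lt_min => /andP[tp /and3P[t1 _ _]].
  have := tay t tt; rewrite ler_norml => /andP[T1 T2].
  have t2 : 0 < t ^+ 2 by rewrite exprn_gt0.
  have t3 : t ^+ 3 = t ^+ 2 * t by rewrite exprSr.
  have t32 : t ^+ 3 <= t ^+ 2 by rewrite t3 ler_piMr ?(ltW t2) // ltW.
  have t21 : t ^+ 2 <= t by rewrite expr2 ler_piMr // ltW.
  have t30 : 0 < t ^+ 3 by rewrite exprn_gt0.
  have tK : t ^+ 3 * K <= t ^+ 2 * K by rewrite ler_wpM2r.
  have sq1 : t ^+ 2 * `|q| <= t * `|q| by rewrite ler_wpM2r.
  have sq2 : t ^+ 2 * K <= t * K by rewrite ler_wpM2r.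
  have sq3 : t ^+ 2 * `|Q w| <= t * `|Q w| by rewrite ler_wpM2r.
  have sq4 : t ^+ 3 * L <= t * L by rewrite ler_wpM2r // (le_trans t32).
  have q1 : t ^+ 2 * q <= t ^+ 2 * `|q| by rewrite ler_wpM2l ?ler_norm // ltW.
  have q2 : - (t ^+ 2 * `|q|) <= t ^+ 2 * q.
    by rewrite -mulrN ler_wpM2l ?(ltW t2) // lerNl -normrN ler_norm.
  have Q1 : t ^+ 2 * Q w <= t ^+ 2 * `|Q w| by rewrite ler_wpM2l ?ler_norm // ltW.
  have Q2 : - (t ^+ 2 * `|Q w|) <= t ^+ 2 * Q w.
    by rewrite -mulrN ler_wpM2l ?(ltW t2) // lerNl -normrN ler_norm.
  have tb : t * b = t * `|q| + t * K + t * `|Q w| + t * L + t by rewrite /b; ring.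
  have t3L0 : 0 <= t ^+ 3 * L by rewrite mulr_ge0 // ltW.
  have tL0 : 0 <= t * L by rewrite mulr_ge0 // ltW.
  have tQ0 : 0 <= t * `|Q w| by rewrite mulr_ge0 // ltW.
  have tq0 : 0 <= t * `|q| by rewrite mulr_ge0 // ltW.
  have tK0 : 0 <= t * K by rewrite mulr_ge0 // ltW.
  have LE : C * enorm (t *: w) `^ 3 = t ^+ 3 * L.
    by rewrite powR_mulrn ?enorm_ge0 // enormZ gtr0_norm // exprMn /L /W; ring.
  have low : t ^+ 2 * Q w - t ^+ 3 * L <= gam (t *: w).
    rewrite leNgt; apply/negP => lt.
    have hb : `|gam (t *: w)| <= t * b by rewrite ler_norml; apply/andP; split; lra.
    have [wC Eh _] := point t _ tt hb.
    have [sw1 _] := sw _ _ wC; rewrite Qh LE in sw1.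
    by have /Eh := sw1 lt; rewrite ltxx.
  (* For [low] the point on the graph, which is not in [E], is enough. Here a height strictly
     between the two bounds is needed: its point lies in [E] by the chart and off the closure by the
     sandwich. *)
  have up : gam (t *: w) <= t ^+ 2 * Q w + t ^+ 3 * L.
    rewrite leNgt; apply/negP => lt.
    pose h := (gam (t *: w) + (t ^+ 2 * Q w + t ^+ 3 * L)) / 2.
    have h1 : h < gam (t *: w) by rewrite /h; lra.
    have h2 : t ^+ 2 * Q w + t ^+ 3 * L < h by rewrite /h; lra.
    have hb : `|h| <= t * b by rewrite ler_norml; apply/andP; split; lra.
    have [wC Eh _] := point t _ tt hb.
    have [_ sw2] := sw _ _ wC; rewrite Qh LE in sw2.
    by apply: (sw2 h2); apply: subset_closure; exact/Eh.
  have E1 : t ^+ 2 * (Q w - q) = t ^+ 2 * Q w - t ^+ 2 * q by ring.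
  have E2 : t ^+ 2 * (t * (K + L)) = t ^+ 3 * K + t ^+ 3 * L by rewrite t3; ring.
  rewrite ler_norml; apply/andP; split.
    by rewrite -(ler_pM2l t2) mulrN E1 E2; lra.
  by rewrite -(ler_pM2l t2) E1 E2; lra.
apply/eqP; rewrite -subr_eq0 -normr_le0; apply/ler_addgt0Pl => e e0; rewrite addr0.
pose t := Num.min (t0 / 2) (e / (K + L + 1)).
have KL : 0 < K + L + 1 by lra.
have t_gt0 : 0 < t by rewrite lt_min !divr_gt0.
have tt0 : t < t0 by rewrite gt_min gtr_pMr // invf_lt1 // ltr1n.
apply: (le_trans (cmp t _)); first by rewrite t_gt0.
have : t * (K + L + 1) <= e by rewrite -ler_pdivlMr // ge_min lexx orbT.
by rewrite mulrDr; lra.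
Qed.

(** The sandwich is again derived in the chart at [x], which controls the constants;
    [sandwich_unique] then identifies its quadratic form with half the Hessian of the chart at [y],
    whose trace is [n H y / 2]. *)
Lemma c3_sandwich_local E nu (H : 'rV[R]_n.+1 -> R) x : (1 <= n)%N -> open E -> C3_boundary E nu H ->
  bdry E x -> exists C e, [/\ 0 < C, 0 < e & forall y, enorm (y - x) < e -> bdry E y ->
    exists M A, [/\ M *m M^T = 1%:M, nu y = chart_normal M, \tr A = n%:R * H y / 2,
      forall w, `|bil A w w| <= C * enorm w ^+ 2 & sandwich E y M (fun w => bil A w w) 3 C]].
Proof.
move=> n1 oE Eb Bx; have [M [r [gam [ch [gC _]]]]] := Eb x Bx.
have [MM r0 _ _ _] := ch.
have gC1 : Ck 1 gam := CkW (CkW gC).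
have cg : continuous gam by case: gC.
have [d [B [d0 B0 H3 H2]]] := locally_bounded_Ck3 0 gC.
have n0 : 1 <= n%:R :> R by rewrite ler1n.
pose C1 := 1 + B * n%:R ^+ 3 + 2 * (B * n%:R ^+ 2).
have Bn3 : 0 <= B * n%:R ^+ 3 by rewrite mulr_ge0 ?exprn_ge0.
have Bn2 : 0 <= B * n%:R ^+ 2 by rewrite mulr_ge0 ?exprn_ge0.
have C11 : 1 <= C1 by rewrite /C1; lra.
pose D := 4 * C1.
pose C2 := C1 * ((1 + D) ^+ 3 + D * (1 + D)).
pose rd := Num.min r d.
have rd0 : 0 < rd by rewrite lt_min r0.
pose C := Num.max (2 / rd) (Num.max C2 C1).
have Ca : 2 / rd <= C by rewrite le_max lexx.
have Cb : C2 <= C by rewrite !le_max lexx orbT.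
have Cc : C1 <= C by rewrite !le_max lexx !orbT.
have C0 : 0 < C by lra.
exists C, (rd / 2); split => //; first by rewrite divr_gt0.
move=> y yrd By.
have rdr : rd <= r by rewrite ge_min lexx.
have rdd : rd <= d by rewrite ge_min lexx orbT.
have [M' [r' [gam' [ch' [gC' [nuy Hy]]]]]] := Eb y By.
have [MM' _ _ _ _] := ch'.
have gC1' : Ck 1 gam' := CkW (CkW gC').
have yr : enorm (y - x) < r / 2 by lra.
have yr' : enorm (y - x) < r by lra.
set nv := chart_nvec x M gam y; pose N := enorm nv.
have N1 : 1 <= N by exact: enorm_nvec_ge1.
have N0 : 0 < N by rewrite (lt_le_trans ltr01).
set a := front ((y - x) *m M).
have ad : enorm a < rd / 2 by rewrite (le_lt_trans (enorm_front_le _)) // enorm_mulmx.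
(* [xi w] and [eta] are the horizontal parts, in the chart at [x], of a tangent vector and of the
   unit normal at [y]. *)
pose xi (w : 'rV[R]_n) := front ((extl w 0 *m M'^T) *m M).
pose eta := front (chart_normal M' *m M).
have xiZ t w : xi (t *: w) = t *: xi w.
  by rewrite /xi -frontZ !scalemxAl extlZ mulr0.
have xi_le w : enorm (xi w) <= enorm w.
  by rewrite (le_trans (enorm_front_le _)) // enorm_mulmx // enorm_mulmxT // enorm_extl enorm_consr0.
have eta_le : enorm eta <= 1.
  by rewrite (le_trans (enorm_front_le _)) // enorm_mulmx // enorm_chart_normal.
have Ha i j : `|hess gam a i j| <= B by rewrite mxE; apply: H2; rewrite subr0; lra.
pose b := bil (hess gam a).
(* Near [y] the function [chartF / N] is the height minus this form, up to the errors allowed in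
   [dominated_sign2]: the second fundamental form as seen from the chart at [x]. *)
pose Q w := (2 * N)^-1 * b (xi w) (xi w).
have N2 : 0 <= (2 * N)^-1 <= 1.
  by rewrite invr_ge0 mulr_ge0 ?(ltW N0) // invf_le1 ?mulr_gt0 //; lra.
have Qh t w : Q (t *: w) = t ^+ 2 * Q w.
  by rewrite /Q /b xiZ bilZl bilZr; ring.
have Q_le w : `|Q w| <= C1 * enorm w ^+ 2.
  rewrite normrM ger0_norm; last by case/andP: N2.
  apply: (@le_trans _ _ (1 * `|b (xi w) (xi w)|)).
    by rewrite ler_wpM2r //; case/andP: N2.
  rewrite mul1r (le_trans (bil_le _ _ Ha)) //.
  apply: ler_pM => //; first by rewrite mulr_ge0 ?enorm_ge0.
    by rewrite /C1; lra.
  by rewrite expr2 ler_pM ?enorm_ge0.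
have sw : sandwich E y M' Q 3 C.
  have Ca' : 2 / r <= C by rewrite (le_trans _ Ca) // ler_pM2l // lef_pV2.
  apply: (sandwich_of_sign ch cg MM' yr Ca') => w h wh.
  set u := extl w h *m M'^T.
  have uE : enorm u = enorm (consr h w) by rewrite /u enorm_mulmxT // enorm_extl.
  set F := chartF x M gam (y + u).
  have urd : enorm u < rd / 2.
    rewrite uE (lt_le_trans wh) //.
    by rewrite -[rd / 2]invrK lef_pV2 ?posrE ?invr_gt0 ?divr_gt0 // ?invf_div.
  have vE : front (u *m M) = xi w + h *: eta.
    rewrite /xi /eta -frontZ -frontD scalemxAl -mulmxDl scalemxAl -mulmxDl.
    by rewrite /chart_normal evec_max extlZ extlD scaler0 addr0 add0r mulr1.
  have hu : `|h| <= enorm u by rewrite uE enorm_consr_geh.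
  have wu : enorm w <= enorm u by rewrite uE enorm_consr_ge.
  have vu : enorm (front (u *m M)) <= enorm u.
    by rewrite (le_trans (enorm_front_le _)) // enorm_mulmx.
  have FE : `|F - N * h + 2^-1 * b (front (u *m M)) (front (u *m M))| <= B * n%:R ^+ 3 * enorm u ^+ 3.
    have := chartF_increment x M gam y u.
    rewrite (chartF_bdry oE ch cg yr' By) subr0 -/F => ->.
    rewrite -(chart_nvec_frame h w oE ch gC1 yr' By ch' gC1') -/u dotp_nvec -/a.
    set v := front (u *m M) in vu *.
    rewrite (_ : _ + _ = - (gam (a + v) - gam a - \sum_i partial i gam a * v 0 i - 2^-1 * b v v)); last by ring.
    rewrite normrN; apply: (@le_trans _ _ (B * n%:R ^+ 3 * enorm v ^+ 3)).
      apply: taylor2_bil => // i j k z zv; apply: H3; rewrite subr0.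
      rewrite -(subrK a z) (le_lt_trans (enorm_triangle _ _)) //; lra.
    by rewrite ler_wpM2l // ler_pXn2r ?nnegrE ?enorm_ge0.
  have bE : `|b (xi w + h *: eta) (xi w + h *: eta) - b (xi w) (xi w)| <= 4 * (B * n%:R ^+ 2) * (`|h| * enorm u).
    rewrite (_ : _ - _ = h * (b (xi w + h *: eta) eta + b eta (xi w))); last first.
      by rewrite /b !(bilDl, bilDr, bilZl, bilZr); ring.
    rewrite normrM mulrCA ler_wpM2l // (le_trans (ler_normD _ _)) //.
    have e1 : `|b (xi w + h *: eta) eta| <= B * n%:R ^+ 2 * enorm u.
      rewrite (le_trans (bil_le _ _ Ha)) // ler_wpM2l // -vE.
      by rewrite -[leRHS]mulr1 ler_pM ?enorm_ge0.
    have e2 : `|b eta (xi w)| <= B * n%:R ^+ 2 * enorm u.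
      rewrite (le_trans (bil_le _ _ Ha)) // ler_wpM2l //.
      by rewrite -[leRHS]mul1r ler_pM ?enorm_ge0 // (le_trans (xi_le w)).
    have : 0 <= B * n%:R ^+ 2 * enorm u by rewrite mulr_ge0 ?enorm_ge0.
    rewrite -(mulrA 4); move: e1 e2; set z := B * n%:R ^+ 2 * enorm u; lra.
  have key : `|F / N - h + Q w| <= C1 * (enorm u ^+ 3 + `|h| * enorm u).
    have -> : F / N - h + Q w = N^-1 * ((F - N * h + 2^-1 * b (front (u *m M)) (front (u *m M)))
        - 2^-1 * (b (xi w + h *: eta) (xi w + h *: eta) - b (xi w) (xi w))).
      by rewrite vE /Q; field; rewrite gt_eqF.
    rewrite normrM gtr0_norm ?invr_gt0 // ler_pdivrMl //.
    apply: (@le_trans _ _ (1 * (C1 * (enorm u ^+ 3 + `|h| * enorm u)))); last first.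
      rewrite ler_wpM2r // mulr_ge0 ?addr_ge0 ?exprn_ge0 ?mulr_ge0 ?enorm_ge0 //; lra.
    rewrite mul1r (le_trans (ler_normB _ _)) // normrM ger0_norm ?invr_ge0 //.
    have u3 : 0 <= enorm u ^+ 3 by rewrite exprn_ge0 ?enorm_ge0.
    have hu0 : 0 <= `|h| * enorm u by rewrite mulr_ge0 ?enorm_ge0.
    apply: (@le_trans _ _ (B * n%:R ^+ 3 * enorm u ^+ 3 + 2 * (B * n%:R ^+ 2) * (`|h| * enorm u))).
      by apply: lerD => //; move: bE; set z := `|b _ _ - _|; set z' := `|h| * _; lra.
    rewrite mulrDr; apply: lerD; rewrite ler_wpM2r // /C1; lra.
  have [s1 s2] := @dominated_sign2 R C1 D C h (enorm w) (enorm u) (Q w) (F / N)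
    C11 erefl (enorm_ge0 _) (enorm_ge0 _) ltac:(by rewrite uE enorm_consr_le) hu wu key (Q_le w) Cb ltac:(by rewrite uE).
  rewrite powR_mulrn ?enorm_ge0 //; split => hh.
    by have := s1 hh; rewrite pmulr_llt0 ?invr_gt0.
  by have := s2 hh; rewrite pmulr_lgt0 ?invr_gt0.
have QE w : Q w = bil (2^-1 *: hess gam' 0) w w.
  by rewrite bilZ; exact: (sandwich_unique w C0 ch' gC' sw Qh).
exists M', (2^-1 *: hess gam' 0); split => //.
- rewrite Hy mxtraceZ [n%:R * _]mulrC divfK ?gt_eqF //; last by lra.
  by rewrite mulrC; congr (_ * _); apply: eq_bigr => i _; rewrite mxE.
- by move=> w; rewrite -QE (le_trans (Q_le w)) // ler_wpM2r // exprn_ge0 ?enorm_ge0.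
- by have -> : (fun w => bil (2^-1 *: hess gam' 0) w w) = Q by apply/funext => w; rewrite QE.
Qed.

Lemma c3_sandwich E nu (H : 'rV[R]_n.+1 -> R) (K : set 'rV[R]_n.+1) : (1 <= n)%N ->
  open E -> C3_boundary E nu H -> compact K -> K `<=` bdry E ->
  exists C, 1 <= C /\ forall y, K y ->
    exists M A, [/\ M *m M^T = 1%:M, nu y = chart_normal M, \tr A = n%:R * H y / 2,
      forall w, `|bil A w w| <= C * enorm w ^+ 2 & sandwich E y M (fun w => bil A w w) 3 C].
Proof.
move=> n1 oE Eb cK KB; apply: compact_uniform => //.
  move=> x Kx; have [C [e [C0 e0 CP]]] := c3_sandwich_local n1 oE Eb (KB x Kx).
  by exists C, e; split => // y yx Ky; apply: CP => //; exact: KB.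
move=> C C' y C0 CC [M [A [MM nuy trA Ale sw]]]; exists M, A; split => //.
  by move=> w; rewrite (le_trans (Ale w)) // ler_wpM2r // exprn_ge0 ?enorm_ge0.
exact: sandwich_mono sw.
Qed.

End SecondOrder.

(** * Integrals over thin slabs *)

Section Slabs.
Variable R : realType.

Notation I m f := (Rintegral (muV R m) setT f).
Notation integ m f := ((muV R m).-integrable setT (EFin \o f)).

Definition hd m (w : 'rV[R]_m.+1) : R := w ord0 ord0.

Lemma measurable_hd m : measurable_fun setT (@hd m).
Proof. exact: measurable_rVcoord. Qed.

Lemma consr_hd m (w : 'rV[R]_m.+1) : consr (hd w) (tailr w) = w.
Proof. exact: consr_tailr. Qed.

Lemma hd_consr m h (w : 'rV[R]_m) : hd (consr h w) = h.
Proof. exact: consr0. Qed.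

Lemma measurable_tail_comp m (f : 'rV[R]_m -> R) : measurable_fun setT f ->
  measurable_fun setT (fun w : 'rV[R]_m.+1 => f (tailr w)).
Proof. by move=> mf; apply: measurableT_comp => //; exact: measurable_tailr. Qed.

Lemma integ_le m (f g : 'rV[R]_m -> R) : measurable_fun setT f ->
  (forall x, `|f x| <= g x) -> integ m g -> integ m f.
Proof.
move=> mf fg gi; apply: le_integrable gi => //; first exact/measurable_EFinP.
by move=> x _ /=; rewrite lee_fin (le_trans (fg x)) // ler_norm.
Qed.

Lemma Rint_le m (f g : 'rV[R]_m -> R) : integ m f -> integ m g ->
  (forall x, f x <= g x) -> I m f <= I m g.
Proof. by move=> fi gi fg; apply: le_Rintegral. Qed.

Lemma Rint_abs_le m (f g : 'rV[R]_m -> R) : measurable_fun setT f ->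
  (forall x, `|f x| <= g x) -> integ m g -> integ m f /\ `|I m f| <= I m g.
Proof.
move=> mf fg gi; have fi := integ_le mf fg gi; split => //.
rewrite (le_trans (le_normr_Rintegral _ fi)) //; apply: Rint_le => //.
by apply: integ_le gi => [|x]; [exact: measurableT_comp|rewrite normr_id].
Qed.

Lemma integD m (f g : 'rV[R]_m -> R) : integ m f -> integ m g ->
  integ m (fun x => f x + g x).
Proof. by move=> fi gi; exact: (integrableD measurableT fi gi). Qed.

Lemma integZ m c (f : 'rV[R]_m -> R) : integ m f -> integ m (fun x => c * f x).
Proof.
move=> fi; rewrite (_ : EFin \o _ = (fun x => c%:E * (EFin \o f) x))%E; first exact: integrableZl.
by apply/funext => x /=; rewrite EFinM.
Qed.

Lemma integB m (f g : 'rV[R]_m -> R) : integ m f -> integ m g ->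
  integ m (fun x => f x - g x).
Proof. by move=> fi gi; exact: (integrableB measurableT fi gi). Qed.

Lemma RintD m (f g : 'rV[R]_m -> R) : integ m f -> integ m g ->
  I m (fun x => f x + g x) = I m f + I m g.
Proof. by move=> fi gi; exact: RintegralD. Qed.

Lemma RintB m (f g : 'rV[R]_m -> R) : integ m f -> integ m g ->
  I m (fun x => f x - g x) = I m f - I m g.
Proof. by move=> fi gi; exact: RintegralB. Qed.

Lemma RintZ m c (f : 'rV[R]_m -> R) : integ m f -> I m (fun x => c * f x) = c * I m f.
Proof. by move=> fi; exact: RintegralZl. Qed.

Lemma eq_Rint m (f g : 'rV[R]_m -> R) : f =1 g -> I m f = I m g.
Proof. by move=> fg; apply: eq_Rintegral => x _; exact: fg. Qed.

Lemma integ_measurable m (f : 'rV[R]_m -> R) : integ m f -> measurable_fun setT f.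
Proof. by move=> /integrableP[/measurable_EFinP]. Qed.

Lemma ge0_integral_swap m (f : 'rV[R]_m.+1 -> \bar R) :
  measurable_fun setT f -> (forall x, 0 <= f x)%E ->
  (\int[muV R m.+1]_x f x = \int[muV R m]_y \int[@lebesgue_measure R]_h f (consr h y))%E.
Proof.
move=> mf f0; rewrite ge0_integral_muVS //.
apply: (@fubini_tonelli _ _ _ _ _ (@lebesgue_measure R) (muV R m) (fun z : measurableTypeR R * 'rV[R]_m => f (consr z.1 z.2))) => //.
exact: (measurableT_comp mf (@measurable_consr R m)).
Qed.

Lemma slab_fiber m (S : set 'rV[R]_m.+1) (y : 'rV[R]_m) (a b c : R) (b1 b2 : bool) :
  a <= b -> (forall h, S (consr h y) <-> h \in Interval (BSide b1 a) (BSide b2 b)) -> 0 <= c ->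
  (\int[@lebesgue_measure R]_h (c * \1_S (consr h y))%:E = (c * (b - a))%:E)%E.
Proof.
move=> ab SE c0.
pose J : set (measurableTypeR R) := [set` Interval (BSide b1 a) (BSide b2 b)].
have mJ : measurable J by exact: measurable_itv.
transitivity (\int[@lebesgue_measure R]_h (c%:E * (\1_J h)%:E))%E.
  apply: eq_integral => h _; rewrite EFinM; congr (_ * _%:E)%E.
  by apply: eq_indic; exact: SE.
rewrite ge0_integralZl //; last by apply/measurable_EFinP; exact: measurable_indic.
rewrite integral_indic // setIT EFinM; congr (_ * _)%E.
rewrite [LHS](lebesgue_measure_itv (Interval (BSide b1 a) (BSide b2 b))) /= lte_fin EFinB.
case: ltP => // ba.
by have -> : b = a; [apply/le_anti; rewrite ba ab|rewrite subee].
Qed.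

Lemma ge0_slab_integral m (S : set 'rV[R]_m.+1) (a b psi : 'rV[R]_m -> R) (b1 b2 : bool) :
  measurable S -> measurable_fun setT psi -> (forall y, 0 <= psi y) ->
  (forall y, a y <= b y) ->
  (forall y h, S (consr h y) <-> h \in Interval (BSide b1 (a y)) (BSide b2 (b y))) ->
  (\int[muV R m.+1]_w (psi (tailr w) * \1_S w)%:E = \int[muV R m]_y (psi y * (b y - a y))%:E)%E.
Proof.
move=> mS mpsi psi0 ab SE; rewrite ge0_integral_swap; last 2 first.
- apply/measurable_EFinP/measurable_funM; first exact: measurable_tail_comp.
  exact: measurable_indic.
- by move=> w; rewrite lee_fin mulr_ge0.
apply: eq_integral => y _.
by rewrite -(slab_fiber (ab y) (SE y) (psi0 y)); apply: eq_integral => h _; rewrite tailr_consr.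
Qed.

Lemma slab_integral m (S : set 'rV[R]_m.+1) (a b psi : 'rV[R]_m -> R) (b1 b2 : bool) :
  measurable S -> measurable_fun setT psi -> (forall y, a y <= b y) ->
  (forall y h, S (consr h y) <-> h \in Interval (BSide b1 (a y)) (BSide b2 (b y))) ->
  integ m (fun y => psi y * (b y - a y)) ->
  integ m.+1 (fun w => psi (tailr w) * \1_S w) /\
  I m.+1 (fun w => psi (tailr w) * \1_S w) = I m (fun y => psi y * (b y - a y)).
Proof.
move=> mS mpsi ab SE pi.
have mabs : measurable_fun setT (fun y => `|psi y|) by exact: measurableT_comp.
have pos (ph : 'rV[R]_m -> R) : measurable_fun setT ph -> (forall y, 0 <= ph y) ->
    (forall y, ph y <= `|psi y|) ->
    [/\ integ m (fun y => ph y * (b y - a y)),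
     integ m.+1 (fun w => ph (tailr w) * \1_S w) &
     I m.+1 (fun w => ph (tailr w) * \1_S w) = I m (fun y => ph y * (b y - a y))].
  move=> mph ph0 phle.
  have E := ge0_slab_integral mS mph ph0 ab SE.
  have i1 : integ m (fun y => ph y * (b y - a y)).
    (* Measurability comes from Tonelli's theorem, as this function is the inner integral over the
       fibres; [a] and [b] are not themselves assumed measurable. *)
    have mba : measurable_fun setT (fun y => ph y * (b y - a y)).
      apply/measurable_EFinP.
      have := @measurable_fun_fubini_tonelli_G _ _ _ _ _ (@lebesgue_measure R)
        (fun z : measurableTypeR R * 'rV[R]_m => (ph (tailr (consr z.1 z.2)) * \1_S (consr z.1 z.2))%:E) _ _.
      have mf0 : measurable_fun setT (fun w : 'rV[R]_m.+1 => (ph (tailr w) * \1_S w)%:E).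
        apply/measurable_EFinP/measurable_funM; first exact: measurable_tail_comp.
        exact: measurable_indic.
      move=> /(_ (measurableT_comp mf0 (@measurable_consr R m))) H.
      apply: eq_measurable_fun (H _) => [y _|z]; last by rewrite lee_fin mulr_ge0.
      rewrite /fubini_G /=.
      by rewrite -(slab_fiber (ab y) (SE y) (ph0 y)); apply: eq_integral => h _; rewrite tailr_consr.
    apply: (@integ_le _ _ (fun y => `|psi y * (b y - a y)|)) => //.
      move=> y; rewrite !normrM ler_wpM2r // ger0_norm //.
    exact: (integrable_abse pi).
  split => //; last by rewrite /Rintegral E.
  apply/integrableP; split.
    apply/measurable_EFinP/measurable_funM; first exact: measurable_tail_comp.
    exact: measurable_indic.
  under eq_integral do rewrite /= ger0_norm ?mulr_ge0 //.
  rewrite E; have /integrableP[_] := i1; apply: le_lt_trans.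
  by rewrite le_eqVlt; apply/orP; left; apply/eqP/eq_integral => y _ /=;
    rewrite ger0_norm // mulr_ge0 // subr_ge0.
have [|||i1 j1 E1] := pos (fun y => Num.max (psi y) 0).
- exact: measurable_maxr.
- by move=> y; rewrite le_max lexx orbT.
- by move=> y; rewrite ge_max ler_norm normr_ge0.
have [|||i2 j2 E2] := pos (fun y => Num.max (- psi y) 0).
- by apply: measurable_maxr => //; exact: measurableT_comp.
- by move=> y; rewrite le_max lexx orbT.
- by move=> y; rewrite ge_max -normrN ler_norm normr_ge0.
have D y : psi y = Num.max (psi y) 0 - Num.max (- psi y) 0.
  by rewrite /Num.max /Order.max; case: ltP => h1; case: ltP => h2; lra.
have fE : (fun w => psi (tailr w) * \1_S w) =
    (fun w => Num.max (psi (tailr w)) 0 * \1_S w - Num.max (- psi (tailr w)) 0 * \1_S w) :> ('rV[R]_m.+1 -> R).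
  by apply/funext => w; rewrite -mulrBl -D.
split; first by rewrite fE; exact: integB.
rewrite fE RintB // E1 E2 -RintB //; apply: eq_Rint => y.
by rewrite -mulrBl -D.
Qed.

Lemma Rint_hyperplane0 m (f : 'rV[R]_m.+1 -> R) : measurable_fun setT f ->
  (forall w, hd w != 0 -> f w = 0) -> integ m.+1 f /\ I m.+1 f = 0.
Proof.
move=> mf f0.
have E : (\int[muV R m.+1]_w `|(f w)%:E| = 0)%E.
  rewrite ge0_integral_muVS //; last by apply: measurableT_comp => //; exact/measurable_EFinP.
  set F := fun x => _; rewrite -[RHS](@integral_set1 R F 0) [RHS]integral_mkcond.
  apply: eq_integral => x _; rewrite patchE; case: ifPn => // x0.
  rewrite /F integral0_eq // => y _; rewrite f0 ?abse0 // hd_consr.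
  by apply: contra x0 => /eqP ->; rewrite inE.
have fi : integ m.+1 f.
  by apply/integrableP; split; [exact/measurable_EFinP|rewrite /= E ltry].
split => //; apply/eqP; rewrite -normr_le0 (le_trans (le_normr_Rintegral _ fi)) //.
by rewrite /Rintegral; under eq_integral do rewrite -abse_EFin; rewrite E.
Qed.

(** The model of [- tauE] for a lower half-space. It takes only the values 1 and -1; its oddness
    fails at [0] alone, hence on a null hyperplane, which [Rint_hyperplane0] removes. *)
Definition theta (h : R) : R := if 0 < h then 1 else -1.

Lemma measurable_theta d (T : measurableType d) (f : T -> R) :
  measurable_fun setT f -> measurable_fun setT (fun x => theta (f x)).
Proof.
move=> mf; apply: measurable_fun_ifT => //; exact: measurable_fun_ltr.
Qed.

Lemma theta_abs h : `|theta h| = 1.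
Proof. by rewrite /theta; case: ifP; rewrite ?normrN normr1. Qed.

Lemma thetaZ c h : 0 < c -> theta (c * h) = theta h.
Proof. by move=> c0; rewrite /theta pmulr_rgt0. Qed.

Lemma Rint_theta_even m (g : 'rV[R]_m.+1 -> R) : integ m.+1 g -> (forall w, g (- w) = g w) ->
  integ m.+1 (fun w => g w * theta (hd w)) /\ I m.+1 (fun w => g w * theta (hd w)) = 0.
Proof.
move=> gi ge; have mg := integ_measurable gi.
have mt : measurable_fun setT (fun w : 'rV[R]_m.+1 => theta (hd w)).
  by apply: measurable_theta; exact: measurable_hd.
have ti : integ m.+1 (fun w => g w * theta (hd w)).
  apply: (@integ_le _ _ (fun w => `|g w|)); first exact: measurable_funM.
    by move=> w; rewrite normrM theta_abs mulr1.
  exact: (integrable_abse gi).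
split => //; have [oi oE] := Rint_opp ti.
have : I m.+1 (fun w => g w * theta (hd w)) + I m.+1 (fun w => g (- w) * theta (hd (- w))) = 0.
  rewrite -RintD //.
  have [|w w0|_ //] := @Rint_hyperplane0 m (fun w => g w * theta (hd w) + g (- w) * theta (hd (- w))).
    exact: integ_measurable (integD ti oi).
  rewrite ge -mulrDr /hd mxE -/(hd w) /theta oppr_gt0.
  by case: (ltrgtP (hd w) 0) w0 => // _ _; rewrite ?addNr ?subrr mulr0.
by rewrite oE; lra.
Qed.

Lemma measurable_fun_absr d (T : measurableType d) (f : T -> R) :
  measurable_fun setT f -> measurable_fun setT (fun x => `|f x|).
Proof. by move=> mf; exact: measurableT_comp. Qed.

Lemma measurable_set_bool d (T : measurableType d) (f : T -> bool) :
  measurable_fun setT f -> measurable [set x | f x].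
Proof.
move=> mf; have -> : [set x | f x] = setT `&` f @^-1` [set true].
  by apply/seteqP; split => x /=; [move=> fx; split|case].
exact: mf.
Qed.

(** The gain from the contact of the boundary with its model: the fibre over [y] has length
    [2 rho |y| ^ a], which softens the singularity [|y| ^ (- p)] to the exponent [a - p], integrable
    near [0] in dimension [m]. The bound on [psi] excludes the origin, where the power with a
    negative exponent would have the default value [0]. *)
Lemma slab_near m (p a : R) : 0 < a -> - m%:R < a - p -> exists2 C, 0 <= C &
  forall (K rho S : R) (c psi : 'rV[R]_m -> R) (f : 'rV[R]_m.+1 -> R),
  0 < S -> 0 <= rho -> 0 <= K -> measurable_fun setT c -> measurable_fun setT psi ->
  measurable_fun setT f -> (forall y, 0 <= psi y) ->
  (forall y, y != 0 -> psi y <= K * enorm y `^ (- p)) ->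
  (forall h y, `|f (consr h y)| <=
     if (enorm y < S) && (`|h - c y| <= rho * enorm y `^ a) then psi y else 0) ->
  integ m.+1 f /\ I m.+1 (fun w => `|f w|) <= K * C * (rho * S `^ (m%:R + (a - p))).
Proof.
move=> a0 /near_bound[C C0 CP]; exists (2 * C); first by rewrite mulr_ge0.
move=> K rho S c psi f S0 rho0 K0 mc mpsi mf psi0 psiK fle.
pose r (y : 'rV[R]_m) := rho * enorm y `^ a.
have mr : measurable_fun setT r by apply: measurable_funM => //; exact: measurable_powR_enorm.
have r0 y : 0 <= r y by rewrite mulr_ge0 ?powR_ge0.
pose ph (y : 'rV[R]_m) := if enorm y < S then psi y else 0.
have mS : measurable_fun setT (fun y : 'rV[R]_m => enorm y < S).
  apply: measurable_fun_ltr => //; apply: continuous_measurable_rV; exact: continuous_enorm.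
have mph : measurable_fun setT ph by apply: measurable_fun_ifT.
have ph0 y : 0 <= ph y by rewrite /ph; case: ifP.
pose Z : set 'rV[R]_m.+1 := [set w | `|hd w - c (tailr w)| <= r (tailr w)].
have mZ : measurable Z.
  apply: measurable_set_bool; apply: measurable_fun_ler.
    apply: measurable_fun_absr; apply: measurable_funB; first exact: measurable_hd.
    exact: measurable_tail_comp.
  exact: measurable_tail_comp.
have [|||gi gI] := CP (2 * (K * rho)) S (fun y => ph y * (c y + r y - (c y - r y))) S0.
- by rewrite !mulr_ge0.
- apply: measurable_funM => //; apply: measurable_funB; first exact: measurable_funD.
  exact: measurable_funB.
- move=> y; rewrite (_ : c y + r y - (c y - r y) = 2 * r y); last by ring.
  rewrite /ph; case: ifP => yS; last by rewrite mul0r normr0.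
  rewrite ger0_norm ?mulr_ge0 ?powR_ge0 //.
  have [->|y0] := eqVneq y 0.
    by rewrite /r enorm0 powR0 ?gt_eqF // !mulr0 mulr_ge0 ?powR_ge0 // !mulr_ge0.
  apply: (@le_trans _ _ (K * enorm y `^ (- p) * (2 * r y))).
    by rewrite ler_wpM2r ?psiK // mulr_ge0.
  have -> : enorm y `^ (a - p) = enorm y `^ a * enorm y `^ (- p).
    by rewrite powRD // (lt0r_neq0 (enorm_gt0 y0)) implybT.
  by rewrite le_eqVlt; apply/orP; left; apply/eqP; rewrite /r; ring.
have [|||si sI] := @slab_integral m Z (fun z => c z - r z) (fun z => c z + r z) ph true false mZ mph.
- by move=> y; have := r0 y; lra.
- by move=> y h; rewrite /Z /= hd_consr tailr_consr in_itv /= ler_distl.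
- exact: gi.
have fph w : `|f w| <= ph (tailr w) * \1_Z w.
  rewrite -{1}(consr_hd w) (le_trans (fle _ _)) // /ph.
  case: ifPn => [/andP[-> wZ]|]; last by case: ifP => _ _; rewrite ?mul0r // mulr_ge0.
  by rewrite indicE mem_set ?mulr1.
have fi := integ_le mf fph si; split => //.
apply: (@le_trans _ _ (I m.+1 (fun w => ph (tailr w) * \1_Z w))).
  apply: Rint_le => //; first exact: (integrable_abse fi).
rewrite sI; apply: (le_trans (Rint_le gi (integrable_abse gi) _)) => [y|].
  exact: ler_norm.
by apply: (le_trans gI); rewrite le_eqVlt; apply/orP; left; apply/eqP; ring.
Qed.

End Slabs.

(** * The kernel *)

Section DecayComparison.
Variable R : realType.

Lemma decay_comp m k (p A : R) (z : 'rV[R]_m) (w : 'rV[R]_k) : 0 <= p -> 0 < A ->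
  1 + enorm z <= A * (1 + enorm w) -> decay p w <= A `^ p * decay p z.
Proof.
move=> p0 A0 zw; have z0 : 0 < 1 + enorm z by rewrite ltr_pwDl ?enorm_ge0.
have w0 : 0 < 1 + enorm w by rewrite ltr_pwDl ?enorm_ge0.
rewrite /decay !powRN ler_pdivlMr ?powR_gt0 // ler_pdivrMl ?powR_gt0 //.
rewrite mulrC -powRM ?(ltW A0) ?(ltW w0) // ge0_ler_powR ?nnegrE ?(ltW z0) //.
by rewrite mulr_ge0 ?(ltW A0) ?(ltW w0).
Qed.

Lemma decay_mono m (p q : R) (z : 'rV[R]_m) : p <= q -> decay q z <= decay p z.
Proof. by move=> pq; rewrite /decay ler_powR ?lerDl ?enorm_ge0 // lerN2. Qed.

Lemma decay_le_pow m (p : R) (z : 'rV[R]_m) : 0 <= p -> z != 0 -> decay p z <= enorm z `^ (- p).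
Proof.
by move=> p0 z0; apply: le0_ger_powR; rewrite ?enorm_gt0 ?oppr_le0 // lerDr.
Qed.

Lemma decay_shift m (p : R) (z a : 'rV[R]_m) : 0 <= p -> enorm (z - a) <= 1 ->
  decay p z <= 2 `^ p * decay p a.
Proof.
move=> p0 za; apply: decay_comp => //.
have := enorm_triangle (a - z) z; rewrite subrK (enorm_distC a z).
by have := enorm_ge0 z; lra.
Qed.

Lemma inv_powR_decay m (p : R) (z : 'rV[R]_m) : 0 <= p ->
  (1 + enorm z `^ p)^-1 <= 2 `^ p * decay p z.
Proof.
move=> p0; have z0 := enorm_ge0 z; have zp := powR_ge0 (enorm z) p.
rewrite /decay powRN ler_pdivlMr ?powR_gt0 ?ltr_pwDl // ler_pdivrMl ?ltr_pwDl //.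
have [z1|z1] := lerP (enorm z) 1.
  apply: (@le_trans _ _ (1 * 2 `^ p)); last by rewrite ler_wpM2r ?powR_ge0 // lerDl.
  by rewrite mul1r ge0_ler_powR ?nnegrE ?addr_ge0 //; lra.
apply: (@le_trans _ _ (enorm z `^ p * 2 `^ p)); last by rewrite ler_wpM2r ?powR_ge0 // lerDr.
by rewrite -powRM // ge0_ler_powR ?nnegrE ?addr_ge0 ?mulr_ge0 //; lra.
Qed.

End DecayComparison.

Section Kernel.
Variables (R : realType) (n : nat) (s : R) (P : 'rV[R]_n.+1 -> R) (CC CNs : R).
Hypotheses (s01 : 0 < s < 1) (kh : kernel_hyp s P CC CNs).

Notation I m f := (Rintegral (muV R m) setT f).
Notation integ m f := ((muV R m).-integrable setT (EFin \o f)).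
Local Notation p := (n.+1%:R + 2 * s).

Let s0 : 0 < s. Proof. by case/andP: s01. Qed.
Let p0 : 0 < p. Proof. by rewrite ltr_wpDl // mulr_gt0. Qed.
Let Np : n.+1%:R < p. Proof. by rewrite ltrDl mulr_gt0. Qed.
Let np1 : n%:R < p. Proof. by rewrite (lt_trans _ Np) // ltr_nat. Qed.

Lemma kernel_CC_gt0 : 0 < CC. Proof. by case: kh => -[]. Qed.

Lemma kernel_C1 : Ck 1 P. Proof. by case: kh. Qed.

Lemma kernel_continuous : continuous P. Proof. by case: kernel_C1. Qed.

Lemma kernel_measurable : measurable_fun setT P.
Proof. exact: continuous_measurable_rV kernel_continuous. Qed.

Lemma kernel_radial x y : enorm x = enorm y -> P x = P y.
Proof. by case: kh => _ _ H _ _; exact: H. Qed.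

Lemma kernel_opp x : P (- x) = P x.
Proof. by apply: kernel_radial; rewrite enormN. Qed.

Definition kdec : R := CC * 2 `^ p.

Lemma kdec_ge0 : 0 <= kdec.
Proof. by rewrite mulr_ge0 ?powR_ge0 // ltW // kernel_CC_gt0. Qed.

Lemma kernel_gt0 y : 0 < P y.
Proof.
case: kh => _ _ _ [/(_ y)[H _] _] _; apply: lt_le_trans H.
by rewrite divr_gt0 ?invr_gt0 ?kernel_CC_gt0 // ltr_pwDl // powR_ge0.
Qed.

Lemma kernel_le y : P y <= kdec * decay p y.
Proof.
case: kh => _ _ _ [/(_ y)[_ H] _] _; apply: (le_trans H).
rewrite /kdec -mulrA ler_wpM2l ?(ltW kernel_CC_gt0) //.
exact: inv_powR_decay (ltW p0).
Qed.

Definition klow : R := CC^-1 / (1 + 2 `^ p).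

Lemma klow_gt0 : 0 < klow.
Proof. by rewrite divr_gt0 ?invr_gt0 ?kernel_CC_gt0 // ltr_pwDl // powR_ge0. Qed.

Lemma kernel_ge y : enorm y <= 2 -> klow <= P y.
Proof.
move=> y2; case: kh => _ _ _ [/(_ y)[H _] _] _; apply: le_trans H.
rewrite ler_wpM2l ?invr_ge0 ?(ltW kernel_CC_gt0) //.
rewrite lef_pV2 ?posrE ?ltr_pwDl ?powR_ge0 // lerD2l.
by rewrite ge0_ler_powR ?nnegrE ?enorm_ge0 ?(ltW p0).
Qed.

Definition klip : R := CC * 2 `^ (p + 1).

Lemma klip_ge0 : 0 <= klip.
Proof. by rewrite mulr_ge0 ?powR_ge0 // ltW // kernel_CC_gt0. Qed.

Lemma kernel_lip a w (D : R) :
  (forall t, 0 <= t <= 1 -> decay (p + 1) (a + t *: w) <= D) ->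
  `|P (a + w) - P a| <= klip * D * enorm w.
Proof.
move=> HD; rewrite -[X in `|X|]subr0; apply: (taylor1 kernel_C1) => t t01; rewrite subr0.
pose g : 'rV[R]_n.+1 := \row_i partial i P (a + t *: w).
have -> : \sum_i w 0 i * partial i P (a + t *: w) = dotp w g.
  by apply: eq_bigr => i _; rewrite mxE.
rewrite (le_trans (dotp_le _ _)) // mulrC ler_wpM2r ?enorm_ge0 //.
have -> : enorm g = gradnorm P (a + t *: w).
  by congr Num.sqrt; apply: eq_bigr => i _; rewrite mxE.
case: kh => _ _ _ [_ /(_ (a + t *: w)) H] _; apply: (le_trans H).
rewrite /klip -mulrA ler_wpM2l ?(ltW kernel_CC_gt0) //.
apply: (le_trans (inv_powR_decay _ _)); first by rewrite ltW // ltr_wpDl ?(ltW p0).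
by rewrite ler_wpM2l ?powR_ge0 // HD.
Qed.

Lemma kernel_lip_h h (y : 'rV[R]_n) :
  `|P (consr h y) - P (consr 0 y)| <= klip * decay (p + 1) y * `|h|.
Proof.
have := @kernel_lip (consr 0 y) (consr h 0) (decay (p + 1) y).
rewrite consrD add0r addr0 enorm_consrh0; apply => t _.
by rewrite consrZ consrD scaler0 addr0 decay_section // addr_ge0 // ltW.
Qed.

Lemma kernel_lip1 a w : enorm w <= 1 ->
  `|P (a + w) - P a| <= klip * (2 `^ (p + 1) * decay p a) * enorm w.
Proof.
move=> w1; apply: kernel_lip => t /andP[t0 t1].
apply: (@le_trans _ _ (2 `^ (p + 1) * decay (p + 1) a)).
  apply: decay_shift; first by rewrite addr_ge0 // ltW.
  rewrite addrAC subrr add0r enormZ ger0_norm //.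
  by rewrite -[leRHS]mulr1 ler_pM ?enorm_ge0.
by rewrite ler_wpM2l ?powR_ge0 // decay_mono // lerDl.
Qed.

Definition Ash (d : R) (w : 'rV[R]_n.+1) : R := P (consr d 0 - w).

Lemma Ash_consr d h y : Ash d (consr h y) = P (consr (h - d) y).
Proof. by rewrite /Ash consrN consrD sub0r -kernel_opp consrN opprB opprK. Qed.

Definition kash : R := kdec * 2 `^ p.

Lemma kash_ge0 : 0 <= kash.
Proof. by rewrite mulr_ge0 ?powR_ge0 // kdec_ge0. Qed.

Lemma Ash_gt0 d w : 0 < Ash d w. Proof. exact: kernel_gt0. Qed.

Lemma Ash_le d w : `|d| <= 1 -> Ash d w <= kash * decay p w.
Proof.
move=> d1; rewrite /Ash -kernel_opp opprB (le_trans (kernel_le _)) //.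
rewrite /kash -mulrA ler_wpM2l ?kdec_ge0 // decay_shift ?(ltW p0) //.
by rewrite addrAC subrr add0r enormN enorm_consrh0.
Qed.

Lemma measurable_affine m k (f : 'rV[R]_k -> R) (g : 'rV[R]_m -> 'rV[R]_k) :
  measurable_fun setT f -> continuous g -> measurable_fun setT (fun x => f (g x)).
Proof. by move=> mf cg; apply: measurableT_comp => //; exact: measurable_continuous_map. Qed.

Lemma measurable_Ash d : measurable_fun setT (Ash d).
Proof.
apply: measurable_affine; first exact: kernel_measurable.
apply: (@enorm_continuous_map _ _ _ _ 1) => x y.
by rewrite opprB addrC addrA subrK mul1r enorm_distC.
Qed.

Definition P0 (y : 'rV[R]_n) : R := P (consr 0 y).

Lemma measurable_P0 : measurable_fun setT P0.
Proof. exact: measurable_section_real kernel_measurable. Qed.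

Lemma P0_gt0 y : 0 < P0 y. Proof. exact: kernel_gt0. Qed.

Lemma P0_le y : P0 y <= kdec * decay p y.
Proof. by rewrite (le_trans (kernel_le _)) // ler_wpM2l ?kdec_ge0 // decay_section // ltW. Qed.

Lemma P0_extl y : P (extl y 0) = P0 y.
Proof. by apply: kernel_radial; rewrite enorm_extl. Qed.

Lemma P0_hintegrable : hintegrable P0.
Proof.
apply: (hintegrable_decay np1 measurable_P0 (K := kdec)) => y.
by rewrite gtr0_norm ?P0_gt0 // P0_le.
Qed.

Lemma P0_integ : integ n P0.
Proof. exact: hintegrable_integrable P0_hintegrable. Qed.

Definition I0 : R := I n P0.

Lemma intRN_P0 : intRN (fun y' : 'rV[R]_n => P (extl y' 0)) = I0.
Proof.
have -> : (fun y' : 'rV[R]_n => P (extl y' 0)) = P0 by apply/funext => y; exact: P0_extl.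
exact: intRN_Rintegral P0_hintegrable.
Qed.

Definition vol1 : R := fine (muV R n (eball n 1)).

Lemma vol1_gt0 : 0 < vol1.
Proof.
rewrite fine_gt0 // muV_eball_gt0 //=.
by rewrite (le_lt_trans (muV_eball_le n ler01)) ?ltry.
Qed.

Lemma eball_integ : integ n (\1_(eball n 1) : _ -> R).
Proof.
apply/integrableP; split; first by apply/measurable_EFinP/measurable_indic; exact: measurable_eball.
under eq_integral do rewrite /= ger0_norm //.
rewrite integral_indic //; last exact: measurable_eball.
by rewrite setIT (le_lt_trans (muV_eball_le n ler01)) ?ltry.
Qed.

Lemma Rint_eball : I n (\1_(eball n 1) : _ -> R) = vol1.
Proof. by rewrite /Rintegral integral_indic ?setIT //; exact: measurable_eball. Qed.

Lemma I0_gt0 : 0 < I0.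
Proof.
apply: (@lt_le_trans _ _ (klow * vol1)); first by rewrite mulr_gt0 ?klow_gt0 ?vol1_gt0.
rewrite -Rint_eball -RintZ; last exact: eball_integ.
apply: Rint_le; [exact/integZ/eball_integ|exact: P0_integ|] => y.
rewrite indicE; case: (boolP (y \in _)) => [|_]; last by rewrite mulr0 ltW // P0_gt0.
rewrite inE /eball /= mulr1 => y1; apply: kernel_ge; rewrite enorm_consr0; lra.
Qed.

Definition slab (a b : 'rV[R]_n -> R) : set 'rV[R]_n.+1 :=
  [set w | Num.min (a (tailr w)) (b (tailr w)) < hd w <= Num.max (a (tailr w)) (b (tailr w))].

Lemma measurable_slab a b : measurable_fun setT a -> measurable_fun setT b ->
  measurable (slab a b).
Proof.
move=> ma mb; apply: measurable_set_bool; apply: measurable_and.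
  apply: measurable_fun_ltr; last exact: measurable_hd.
  by apply: measurable_minr; exact: measurable_tail_comp.
apply: measurable_fun_ler; first exact: measurable_hd.
by apply: measurable_maxr; exact: measurable_tail_comp.
Qed.

Lemma maxBmin (a b : R) : Num.max a b - Num.min a b = `|b - a|.
Proof. by rewrite /Num.max /Num.min /Order.max /Order.min; case: ltP => ab; [rewrite gtr0_norm ?subr_gt0|rewrite ler0_norm ?subr_le0 // opprB]. Qed.

Lemma slab_integral_abs (a b psi : 'rV[R]_n -> R) :
  measurable_fun setT a -> measurable_fun setT b -> measurable_fun setT psi ->
  integ n (fun y => psi y * `|b y - a y|) ->
  integ n.+1 (fun w => psi (tailr w) * \1_(slab a b) w) /\
  I n.+1 (fun w => psi (tailr w) * \1_(slab a b) w) = I n (fun y => psi y * `|b y - a y|).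
Proof.
move=> ma mb mpsi pi.
have E : (fun y => psi y * `|b y - a y|) =
    (fun y => psi y * (Num.max (a y) (b y) - Num.min (a y) (b y))).
  by apply/funext => y; rewrite maxBmin.
rewrite E in pi *.
apply: (@slab_integral R n (slab a b) _ _ psi false false) => //.
- exact: measurable_slab.
- by move=> y; rewrite le_max ge_min lexx.
- by move=> y h; rewrite /slab /= hd_consr tailr_consr in_itv.
Qed.

Lemma theta_slab (a b : 'rV[R]_n -> R) w :
  theta (hd w - a (tailr w)) - theta (hd w - b (tailr w)) =
  2 * Num.sg (b (tailr w) - a (tailr w)) * \1_(slab a b) w.
Proof.
rewrite indicE; set u := a _; set v := b _; set h := hd w.
have -> : (w \in slab a b) = (Num.min u v < h <= Num.max u v).
  by apply/idP/idP; rewrite inE.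
rewrite /theta !subr_gt0 /Num.max /Num.min /Order.max /Order.min.
case: (ltrgtP u v) => uv.
- rewrite gtr0_sg ?subr_gt0 // mulr1.
  by case: (ltP u h) => uh; case: (ltP v h) => vh; rewrite ?mulr0 ?mulr1 /=; lra.
- rewrite ltr0_sg ?subr_lt0 //.
  by case: (ltP u h) => uh; case: (ltP v h) => vh; rewrite ?mulr0 ?mulr1 /=; lra.
- by rewrite uv !subrr sgr0 mulr0 mul0r.
Qed.

Lemma slab_dist (a b : 'rV[R]_n -> R) w : slab a b w ->
  `|hd w - a (tailr w)| <= `|b (tailr w) - a (tailr w)|.
Proof.
rewrite /slab /=; set u := a _; set v := b _; set h := hd w.
rewrite /Num.max /Num.min /Order.max /Order.min; case: (ltP u v) => uv /andP[h1 h2].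
  by rewrite !gtr0_norm ?subr_gt0 ?lerB // (lt_le_trans h1).
by rewrite !ler0_norm ?subr_le0 // lerN2 lerB // ltW.
Qed.

(* Freezing [P] on the hyperplane reduces the integral between the graphs of [d]
   and [q] to an integral over the hyperplane. *)
Lemma slab_expansion d (q om : 'rV[R]_n -> R) :
  measurable_fun setT q -> measurable_fun setT om ->
  integ n (fun y => om y * (q y - d) * P0 y) ->
  integ n (fun y => `|om y| * (q y - d) ^+ 2 * decay (p + 1) y) ->
  let f w := Ash d w * (theta (hd w - d) - theta (hd w - q (tailr w))) * om (tailr w) in
  integ n.+1 f /\
  `|I n.+1 f - 2 * I n (fun y => om y * (q y - d) * P0 y)| <=
    2 * klip * I n (fun y => `|om y| * (q y - d) ^+ 2 * decay (p + 1) y).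
Proof.
move=> mq mom i1 i2 f.
have md : measurable_fun setT (fun _ : 'rV[R]_n => d) by [].
pose psi1 y := om y * P0 y * (2 * Num.sg (q y - d)).
have msg : measurable_fun setT (fun y => Num.sg (q y - d)).
  have E : (fun y => Num.sg (q y - d)) = (fun y => if q y - d < 0 then -1 else if 0 < q y - d then 1 else 0).
    by apply/funext => y; case: (ltrgtP (q y - d) 0) => h; [exact: ltr0_sg|exact: gtr0_sg|rewrite h sgr0].
  rewrite E; have mqd : measurable_fun setT (fun y => q y - d) by exact: measurable_funB.
  apply: measurable_fun_ifT => //; first exact: measurable_fun_ltr.
  by apply: measurable_fun_ifT => //; exact: measurable_fun_ltr.
have mpsi1 : measurable_fun setT psi1.
  apply: measurable_funM; last exact: measurable_funM.
  by apply: measurable_funM => //; exact: measurable_P0.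
have E1 : (fun y => psi1 y * `|q y - d|) = (fun y => 2 * (om y * (q y - d) * P0 y)).
  apply/funext => y; rewrite /psi1 -[in RHS](mulr_sg_norm (q y - d)); ring.
have i1' : integ n (fun y => psi1 y * `|q y - d|) by rewrite E1; exact: integZ.
have [j1 J1] := slab_integral_abs md mq mpsi1 i1'.
(* One factor [|q - d|] is the distance over which the gradient bound on [P] is used; the thickness
   of the slab supplies the second. *)
pose psi2 y := 2 * klip * `|om y| * decay (p + 1) y * `|q y - d|.
have mpsi2 : measurable_fun setT psi2.
  apply: measurable_funM; last by apply: measurable_fun_absr; exact: measurable_funB.
  apply: measurable_funM; last exact: measurable_decay.
  by apply: measurable_funM => //; exact: measurable_fun_absr.
have E2 : (fun y => psi2 y * `|q y - d|) = (fun y => 2 * klip * (`|om y| * (q y - d) ^+ 2 * decay (p + 1) y)).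
  by apply/funext => y; rewrite /psi2 -[(q y - d) ^+ 2]real_normK ?num_real //; ring.
have i2' : integ n (fun y => psi2 y * `|q y - d|) by rewrite E2; exact: integZ.
have [j2 J2] := slab_integral_abs md mq mpsi2 i2'.
have mf : measurable_fun setT f.
  apply: measurable_funM; last exact: measurable_tail_comp.
  apply: measurable_funM; first exact: measurable_Ash.
  apply: measurable_funB; apply: measurable_theta; apply: measurable_funB => //.
  - exact: measurable_hd.
  - exact: measurable_hd.
  - exact: measurable_tail_comp.
have diff w : `|f w - psi1 (tailr w) * \1_(slab (fun=> d) q) w| <= psi2 (tailr w) * \1_(slab (fun=> d) q) w.
  have -> : f w = Ash d w * (2 * Num.sg (q (tailr w) - d) * \1_(slab (fun=> d) q) w) * om (tailr w).
    by rewrite /f (theta_slab (fun=> d) q).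
  rewrite indicE; case: (boolP (w \in _)) => [|_]; last by rewrite !(mulr0, mul0r) subrr normr0.
  rewrite inE => /slab_dist /= wd; rewrite !mulr1.
  have -> : Ash d w * (2 * Num.sg (q (tailr w) - d)) * om (tailr w) - psi1 (tailr w) =
      (P (consr (hd w - d) (tailr w)) - P (consr 0 (tailr w))) * (om (tailr w) * (2 * Num.sg (q (tailr w) - d))).
    by rewrite -Ash_consr consr_hd /psi1 /P0; ring.
  rewrite !normrM.
  have sg1 : `|Num.sg (q (tailr w) - d)| <= 1.
    by rewrite normr_sg; case: (_ != _).
  apply: (@le_trans _ _ (klip * decay (p + 1) (tailr w) * `|q (tailr w) - d| * (`|om (tailr w)| * (2 * 1)))).
    apply: ler_pM => //.
      by rewrite (le_trans (kernel_lip_h _ _)) // ler_wpM2l // mulr_ge0 ?klip_ge0 ?decay_ge0.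
    by rewrite ler_wpM2l // ger0_norm // ler_wpM2l.
  by rewrite le_eqVlt /psi2; apply/orP; left; apply/eqP; ring.
have [k2 K2] := Rint_abs_le (measurable_funB mf (integ_measurable j1)) diff j2.
have fi : integ n.+1 f.
  have := integD k2 j1; rewrite (_ : (fun x => _) = f) //.
  by apply/funext => w; rewrite subrK.
split => //.
rewrite J2 E2 RintZ // in K2; apply: le_trans K2; rewrite RintB // J1 E1 RintZ //.
Qed.

(** Over the unit ball of the hyperplane the slab stays within distance 2 of the displaced centre,
    where [P >= klow]. The resulting linear lower bound is what allows [apriori] to recover
    [|d|]. *)
Lemma slab_lower d : `|d| <= 1 ->
  2 * klow * vol1 * `|d| <= `|I n.+1 (fun w => Ash d w * (theta (hd w - d) - theta (hd w)))|.
Proof.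
move=> d1.
have md : measurable_fun setT (fun _ : 'rV[R]_n => d) by [].
have m0 : measurable_fun setT (fun _ : 'rV[R]_n => 0 : R) by [].
have i1 : integ n (fun y => \1_(eball n 1) y * `|0 - d|).
  have := integZ `|0 - d| eball_integ; rewrite (_ : (fun x => _) = (fun y => \1_(eball n 1) y * `|0 - d|)) //.
  by apply/funext => y; rewrite mulrC.
have mB : measurable_fun [set: 'rV[R]_n] (\1_(eball n 1) : _ -> R).
  by apply: measurable_indic; exact: measurable_eball.
have [j1 J1] := slab_integral_abs md m0 mB i1.
have fE w : Ash d w * (theta (hd w - d) - theta (hd w)) =
    2 * Num.sg (- d) * (Ash d w * \1_(slab (fun=> d) (fun=> 0)) w).
  have := theta_slab (fun=> d) (fun=> 0) w; rewrite subr0 sub0r => ->; ring.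
rewrite (eq_Rint fE).
have mS := measurable_slab md m0.
have mAS : measurable_fun setT (fun w => Ash d w * \1_(slab (fun=> d) (fun=> 0)) w).
  by apply: measurable_funM; [exact: measurable_Ash|exact: measurable_indic].
have iAS : integ n.+1 (fun w => Ash d w * \1_(slab (fun=> d) (fun=> 0)) w).
  apply: (@integ_le _ _ _ (fun w => kash * decay p w)) => //; last first.
    by apply: integZ; exact: decay_integrable.
  move=> w; rewrite ger0_norm ?mulr_ge0 ?(ltW (Ash_gt0 _ _)) //.
  rewrite indicE; case: (_ \in _); rewrite ?mulr1 ?Ash_le // mulr0.
  by rewrite mulr_ge0 ?kash_ge0 ?decay_ge0.
rewrite RintZ // normrM normrM (ger0_norm (ler0n R 2)).
have -> : 2 * klow * vol1 * `|d| = 2 * (klow * (vol1 * `|d|)) by ring.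
rewrite -mulrA ler_pM2l //.
have [->|dn0] := eqVneq d 0; first by rewrite normr0 !mulr0 mulr_ge0.
rewrite normr_sg oppr_eq0 dn0 mul1r.
apply: le_trans (ler_norm _).
have <- : I n.+1 (fun w => \1_(eball n 1) (tailr w) * \1_(slab (fun=> d) (fun=> 0)) w) = vol1 * `|d|.
  rewrite J1 (eq_Rint (g := fun y => `|d| * \1_(eball n 1) y)); last by move=> y; rewrite sub0r normrN mulrC.
  by rewrite RintZ ?Rint_eball 1?mulrC //; exact: eball_integ.
rewrite -RintZ //; apply: Rint_le => //; first exact: integZ.
move=> w; rewrite mulrA !indicE.
case: (boolP (w \in slab _ _)) => [|_]; last by rewrite !mulr0.
rewrite inE => wS; rewrite !mulr1.
case: (boolP (tailr w \in _)) => [|_]; last by rewrite mulr0 ltW // Ash_gt0.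
rewrite inE /eball /= mulr1 => w1.
rewrite -(consr_hd w) Ash_consr; apply: kernel_ge.
rewrite (le_trans (enorm_consr_le _ _)) //.
by have := slab_dist wS; rewrite sub0r normrN; lra.
Qed.

Lemma Ash_theta_int d (f : 'rV[R]_n.+1 -> R) : `|d| <= 1 -> measurable_fun setT f ->
  (forall w, `|f w| <= 2) -> integ n.+1 (fun w => Ash d w * f w).
Proof.
move=> d1 mf f2; apply: (@integ_le _ _ _ (fun w => 2 * kash * decay p w)).
- by apply: measurable_funM => //; exact: measurable_Ash.
- move=> w; rewrite normrM gtr0_norm ?Ash_gt0 // -mulrA mulrC.
  by apply: ler_pM => //; [rewrite ltW // Ash_gt0|exact: Ash_le].
- by apply: integZ; exact: decay_integrable.
Qed.

Lemma Ash_odd d : I n.+1 (fun w => Ash d w * theta (hd w - d)) = 0.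
Proof.
have iP : integ n.+1 P.
  apply: (@integ_le _ _ _ (fun w => kdec * decay p w)) => [|w|].
  - exact: kernel_measurable.
  - by rewrite gtr0_norm ?kernel_gt0 ?kernel_le.
  - by apply: integZ; exact: decay_integrable.
have [ti t0] := Rint_theta_even iP kernel_opp.
have [_] := Rint_translate (consr (- d) 0) ti; rewrite t0 => <-.
apply: eq_Rint => w; rewrite /Ash -kernel_opp opprB consrN oppr0.
by congr (_ * theta _); rewrite -[in RHS](consr_hd w) consrD hd_consr.
Qed.

End Kernel.

(** * The level-set equation in a boundary frame *)

Section Equation.
Variables (R : realType) (n : nat) (s : R) (P : 'rV[R]_n.+1 -> R) (CC CNs : R).
Hypotheses (s01 : 0 < s < 1) (kh : kernel_hyp s P CC CNs).
Variable (E : set 'rV[R]_n.+1).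
Hypothesis oE : open E.

Notation I m f := (Rintegral (muV R m) setT f).
Notation integ m f := ((muV R m).-integrable setT (EFin \o f)).
Local Notation p := (n.+1%:R + 2 * s).

Let s0 : 0 < s. Proof. by case/andP: s01. Qed.
Let p0 : 0 < p. Proof. by rewrite ltr_wpDl // mulr_gt0. Qed.
Let Np : n.+1%:R < p. Proof. by rewrite ltrDl mulr_gt0. Qed.

Lemma measurable_tauE : measurable_fun setT (@tauE R n.+1 E).
Proof.
apply: measurable_funB; apply: measurable_indic; first exact: open_measurable_rV.
by apply: open_measurable_rV; apply: closed_openC; exact: closed_closure.
Qed.

Lemma tauE_in z : E z -> tauE E z = 1.
Proof.
move=> Ez; rewrite /tauE !indicE mem_set // memNset ?subr0 //.
by apply; exact: subset_closure.
Qed.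

Lemma tauE_out z : ~ closure E z -> tauE E z = -1.
Proof.
move=> Ez; rewrite /tauE !indicE memNset ?mem_set ?sub0r //.
by move=> /(@subset_closure _ E).
Qed.

Lemma tauE_abs z : `|tauE E z| <= 1.
Proof.
rewrite /tauE !indicE.
by case: (z \in E); case: (z \in ~` closure E); rewrite ?subrr ?subr0 ?sub0r ?normrN ?normr0 ?normr1.
Qed.

Lemma Kern_scale lam w : 0 < lam ->
  Kern s P w (lam `^ (2 * s)) = lam ^- n.+1 * P (lam^-1 *: w).
Proof.
move=> l0; have s2 : 2 * s != 0 by rewrite mulf_neq0 // gt_eqF.
rewrite /Kern -!powRrM mulrN mulrCA mulfV // mulr1 powR_invn ?(ltW l0) //.
by rewrite mulrN mulfV // powR_inv1 // ltW.
Qed.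

(** Charts put the normal last, whereas [muV] splits off the first coordinate; [rotmx] brings the
    normal to the front. *)
Definition frame (M : 'M[R]_n.+1) (w : 'rV[R]_n.+1) : 'rV[R]_n.+1 := w *m (rotmx R n *m M^T).

Lemma frame_consr M h y : frame M (consr h y) = extl y h *m M^T.
Proof. by rewrite /frame mulmxA consr_rotmx. Qed.

Lemma framemx_orth (M : 'M[R]_n.+1) : M *m M^T = 1%:M ->
  (rotmx R n *m M^T) *m (rotmx R n *m M^T)^T = 1%:M.
Proof.
move=> MM; rewrite trmx_mul trmxK mulmxA -(mulmxA (rotmx R n)) (mulmx1C MM) mulmx1.
exact: rotmx_orth.
Qed.

Lemma enorm_frame (M : 'M[R]_n.+1) w : M *m M^T = 1%:M -> enorm (frame M w) = enorm w.
Proof. by move=> MM; rewrite enorm_mulmx //; exact: framemx_orth. Qed.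

Lemma frame_e0 M : frame M (consr 1 0) = chart_normal M.
Proof. by rewrite frame_consr /chart_normal evec_max. Qed.

Lemma frameB M u w : frame M (u - w) = frame M u - frame M w.
Proof. exact: mulmxBl. Qed.

Lemma frameZ M c w : frame M (c *: w) = c *: frame M w.
Proof. by rewrite /frame -scalemxAl. Qed.

Definition tauF (M : 'M[R]_n.+1) (y w : 'rV[R]_n.+1) : R := tauE E (y + frame M w).

Lemma tauF_abs M y w : `|tauF M y w| <= 1. Proof. exact: tauE_abs. Qed.

Lemma measurable_tauF (M : 'M[R]_n.+1) y : M *m M^T = 1%:M -> measurable_fun setT (tauF M y).
Proof.
move=> MM; apply: measurable_affine; first exact: measurable_tauE.
apply: (@enorm_continuous_map _ _ _ _ 1) => a b.
by rewrite opprD addrACA subrr add0r -frameB enorm_frame // mul1r.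
Qed.

Lemma measurable_tauF_scale (M : 'M[R]_n.+1) y c : M *m M^T = 1%:M ->
  measurable_fun setT (fun w : 'rV[R]_n.+1 => tauF M y (c *: w)).
Proof.
by move=> MM; apply: measurable_affine; [exact: measurable_tauF|exact: continuous_scaler].
Qed.

Definition uint (lam : R) (x z : 'rV[R]_n.+1) : R :=
  lam ^- n.+1 * P (lam^-1 *: (x - z)) * tauE E z.

Lemma continuous_scaled_dist (lam : R) (x : 'rV[R]_n.+1) :
  continuous (fun z : 'rV[R]_n.+1 => lam^-1 *: (x - z)).
Proof.
apply: (@enorm_continuous_map _ _ _ _ `|lam^-1|) => a b.
by rewrite -scalerBr enormZ opprB addrC addrA subrK enorm_distC.
Qed.

Lemma uint_measurable lam x : measurable_fun setT (uint lam x).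
Proof.
apply: measurable_funM; last exact: measurable_tauE.
apply: measurable_funM => //.
apply: measurable_affine; [exact: kernel_measurable kh|exact: continuous_scaled_dist].
Qed.

Lemma scaled_decay lam (x z : 'rV[R]_n.+1) : 0 < lam ->
  decay p (lam^-1 *: (x - z)) <= (1 + enorm x + lam) `^ p * decay p z.
Proof.
move=> l0; have x0 := enorm_ge0 x; apply: decay_comp; [exact: ltW|lra|].
rewrite enormZ gtr0_norm ?invr_gt0 //.
have t := enorm_triangle x (z - x); rewrite addrC subrK (enorm_distC z) in t.
set d := enorm (x - z) in t *; have d0 : 0 <= d by exact: enorm_ge0.
have -> : (1 + enorm x + lam) * (1 + lam^-1 * d) = 1 + enorm x + d + lam + (1 + enorm x) * (lam^-1 * d).
  by field; rewrite gt_eqF.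
have : 0 <= (1 + enorm x) * (lam^-1 * d) by rewrite !mulr_ge0 ?invr_ge0 ?(ltW l0) //; lra.
lra.
Qed.

Lemma uint_hintegrable lam x : 0 < lam -> hintegrable (uint lam x).
Proof.
move=> l0; apply: (hintegrable_decay Np (uint_measurable lam x)
  (K := lam ^- n.+1 * kdec n s CC * (1 + enorm x + lam) `^ p)) => z.
have ln : 0 <= lam ^- n.+1 by rewrite invr_ge0 exprn_ge0 // ltW.
rewrite /uint normrM -[leRHS]mulr1; apply: ler_pM => //; last exact: tauE_abs.
rewrite normrM ger0_norm // gtr0_norm ?(kernel_gt0 kh) //.
apply: (@le_trans _ _ (lam ^- n.+1 * (kdec n s CC * ((1 + enorm x + lam) `^ p * decay p z)))).
  rewrite ler_wpM2l // (le_trans (kernel_le s01 kh _)) // ler_wpM2l ?(kdec_ge0 kh) //.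
  exact: scaled_decay.
by rewrite !mulrA.
Qed.

Lemma uE_uint lam x : 0 < lam -> uE s P E x (lam `^ (2 * s)) = I n.+1 (uint lam x).
Proof.
move=> l0; rewrite -intRN_Rintegral; last exact: uint_hintegrable.
by congr intRN; apply/funext => z; rewrite Kern_scale.
Qed.

(** Continuity of [u] in quantitative form; it forces [u = 0] on the boundary of the set where
    [u > 0]. *)
Lemma uE_lip lam x : 0 < lam -> exists2 C, 0 <= C & forall w, enorm w <= lam ->
  `|uE s P E (x + w) (lam `^ (2 * s)) - uE s P E x (lam `^ (2 * s))| <= C * enorm w.
Proof.
move=> l0; have ln : 0 <= lam ^- n.+1 by rewrite invr_ge0 exprn_ge0 // ltW.
have iu y : integ n.+1 (uint lam y) by apply: hintegrable_integrable; exact: uint_hintegrable.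
pose K := lam ^- n.+1 * (klip n s CC * 2 `^ (p + 1) * (1 + enorm x + lam) `^ p * lam^-1).
have K0 : 0 <= K.
  rewrite /K; move: (klip _ _ _) (klip_ge0 kh) => k k0.
  by rewrite !mulr_ge0 ?powR_ge0 ?invr_ge0 ?exprn_ge0 ?(ltW l0).
exists (K * I n.+1 (@decay R p n.+1)).
  by rewrite mulr_ge0 // Rintegral_ge0 // => y _; exact: decay_ge0.
move=> w wl; rewrite !uE_uint // -RintB //.
have [] := @Rint_abs_le R _ (fun z => uint lam (x + w) z - uint lam x z) (fun z => K * enorm w * decay p z).
- by apply: measurable_funB; exact: uint_measurable.
- move=> z; rewrite /uint -mulrBl -mulrBr normrM -[leRHS]mulr1.
  apply: ler_pM => //; last exact: tauE_abs.
  rewrite normrM ger0_norm //.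
  have -> : lam^-1 *: (x + w - z) = lam^-1 *: (x - z) + lam^-1 *: w by rewrite -scalerDr addrAC.
  have lw : enorm (lam^-1 *: w) <= 1.
    by rewrite enormZ gtr0_norm ?invr_gt0 // ler_pdivrMl // mulr1.
  apply: (@le_trans _ _ (lam ^- n.+1 * (klip n s CC * (2 `^ (p + 1) * ((1 + enorm x + lam) `^ p * decay p z)) * (lam^-1 * enorm w)))).
    rewrite ler_wpM2l // (le_trans (kernel_lip1 s01 kh _ lw)) //.
    rewrite enormZ gtr0_norm ?invr_gt0 //.
    rewrite ler_wpM2r ?mulr_ge0 ?invr_ge0 ?enorm_ge0 ?(ltW l0) //.
    rewrite ler_wpM2l ?(klip_ge0 kh) // ler_wpM2l ?powR_ge0 //; exact: scaled_decay.
  rewrite /K le_eqVlt; apply/orP; left; apply/eqP.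
  by set k := klip _ _ _; set q := 2 `^ _; set q' := _ `^ p; set l := lam ^- _; ring.
- by apply: integZ; exact: decay_integrable.
move=> _; rewrite RintZ; last exact: decay_integrable.
by move/le_trans; apply; rewrite mulrAC.
Qed.

Lemma uE_bdry0 lam t x : 0 < lam -> sigma_s s t = lam `^ (2 * s) ->
  bdry (Et s P E t) x -> uE s P E x (lam `^ (2 * s)) = 0.
Proof.
move=> l0 st [cl ni]; have [C C0 HC] := uE_lip x l0.
set u := fun x => uE s P E x (lam `^ (2 * s)).
have EtE z : Et s P E t z <-> 0 < u z by rewrite /Et /= st.
apply: contrapT => ux0; rewrite -/(u x) in ux0.
have ua : 0 < `|u x| by rewrite normr_gt0; exact/eqP.
pose d := Num.min lam (`|u x| / (C + 1)).
have d0 : 0 < d by rewrite lt_min l0 divr_gt0 // ltr_wpDl.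
have near z : enorm (z - x) < d -> `|u z - u x| < `|u x|.
  rewrite lt_min => /andP[zl zu].
  have := HC (z - x) (ltW zl); rewrite (addrC x) subrK => /le_lt_trans; apply.
  move: zu; rewrite ltr_pdivlMr ?ltr_wpDl // mulrDr mulr1 mulrC.
  by apply: le_lt_trans; rewrite lerDl enorm_ge0.
have [up|un|u0] := ltrgtP (u x) 0; last by apply: ux0.
  have [z [/EtE uz zx]] : Et s P E t `&` [set z | enorm (z - x) < d] !=set0.
    by apply: cl; apply/nbhs_enormP; exists d.
  by have := near z zx; rewrite (ltr0_norm up) ltr_norml => /andP[_]; lra.
apply: ni; apply/nbhs_enormP; exists d => // z zx; apply/EtE.
by have := near z zx; rewrite (gtr0_norm un) ltr_norml => /andP[+ _]; lra.
Qed.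

Lemma Rint_frame (M : 'M[R]_n.+1) y lam f : M *m M^T = 1%:M -> 0 < lam -> integ n.+1 f ->
  integ n.+1 (fun w => f (y + frame M (lam *: w))) /\
  I n.+1 f = I n.+1 (fun w => lam ^+ n.+1 * f (y + frame M (lam *: w))).
Proof.
move=> MM l0 fi.
have [i1 E1] := Rint_translate y fi.
have [i2 E2] := Rint_orth (framemx_orth MM) i1.
have [i3 E3] := Rint_scale l0 i2.
have e w : (lam *: w) *m (rotmx R n *m M^T) + y = y + frame M (lam *: w) by rewrite addrC.
have i4 : integ n.+1 (fun w => f (y + frame M (lam *: w))).
  by apply: (eq_integrable _ _ _ _ i3) => // w _; rewrite /= e.
split => //.
have E4 : I n.+1 (fun w => f (y + frame M (lam *: w))) = lam ^- n.+1 * I n.+1 f.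
  transitivity (I n.+1 (fun w => f ((lam *: w) *m (rotmx R n *m M^T) + y))).
    by apply: eq_Rint => w; rewrite e.
  by apply: (etrans E3); congr (_ * _); apply: (etrans E2).
by rewrite (RintZ _ i4) E4 mulrA mulfV ?mul1r // expf_neq0 // gt_eqF.
Qed.

Lemma uE_frame (M : 'M[R]_n.+1) y lam d : M *m M^T = 1%:M -> 0 < lam ->
  uE s P E (y + (lam * d) *: chart_normal M) (lam `^ (2 * s)) =
  I n.+1 (fun w => Ash P d w * tauF M y (lam *: w)).
Proof.
move=> MM l0; pose x := y + (lam * d) *: chart_normal M.
rewrite -/x (uE_uint x l0).
have [_ ->] := Rint_frame y MM l0 (hintegrable_integrable (uint_hintegrable x l0)).
apply: eq_Rint => w; rewrite /uint -/(tauF M y (lam *: w)) !mulrA mulfV ?mul1r; last first.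
  by rewrite expf_neq0 // gt_eqF.
congr (_ * _); apply: (kernel_radial kh).
have -> : x - (y + frame M (lam *: w)) = lam *: frame M (consr d 0 - w).
  rewrite /x opprD addrACA subrr add0r frameB scalerBr -!frameZ; congr (_ - _).
  by rewrite -frame_e0 -frameZ !consrZ !scaler0 mulr1.
by rewrite scalerA mulVf ?gt_eqF // scale1r enorm_frame.
Qed.

(** The ball of radius [lam] in [admissible] becomes, after the blow-up, the bound [|d| <= 1] under
    which [Ash P d] is controlled like [P]. *)
Lemma admissible_equation nu t y v (M : 'M[R]_n.+1) lam : 0 < lam ->
  sigma_s s t = lam `^ (2 * s) -> M *m M^T = 1%:M -> nu y = chart_normal M ->
  admissible s P E nu t y v ->
  `|v * t / lam| <= 1 /\ I n.+1 (fun w => Ash P (v * t / lam) w * tauF M y (lam *: w)) = 0.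
Proof.
move=> l0 st MM nuy [Bx xl].
have s2 : 2 * s != 0 by rewrite mulf_neq0 // gt_eqF.
move: xl; rewrite addrAC subrr add0r enormZ nuy enorm_chart_normal // mulr1 st -powRrM mulfV // powRr1 ?(ltW l0) //.
move=> xl; split.
  by rewrite normrM normfV (gtr0_norm l0) ler_pdivrMr // mul1r ltW.
rewrite -uE_frame //; apply: (uE_bdry0 l0 st).
by rewrite [lam * _]mulrC divfK ?gt_eqF // -nuy.
Qed.

(* The two terms are the effects of the geometry of the boundary and of the displacement. *)
Lemma equation_split (M : 'M[R]_n.+1) y lam d (q : 'rV[R]_n -> R) : M *m M^T = 1%:M -> `|d| <= 1 ->
  measurable_fun setT q ->
  I n.+1 (fun w => Ash P d w * tauF M y (lam *: w)) = 0 ->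
  I n.+1 (fun w => Ash P d w * (tauF M y (lam *: w) + theta (hd w - q (tailr w)))) +
  I n.+1 (fun w => Ash P d w * (theta (hd w - d) - theta (hd w - q (tailr w)))) = 0.
Proof.
move=> MM d1 mq eq0.
have mt := measurable_tauF_scale y lam MM.
have mth (f : 'rV[R]_n -> R) : measurable_fun setT f ->
    measurable_fun setT (fun w : 'rV[R]_n.+1 => theta (hd w - f (tailr w))).
  move=> mf; apply: measurable_theta; apply: measurable_funB; first exact: measurable_hd.
  exact: measurable_tail_comp.
have b1 w : `|tauF M y (lam *: w) + theta (hd w - q (tailr w))| <= 2.
  by rewrite (le_trans (ler_normD _ _)) // theta_abs; have := tauF_abs M y (lam *: w); lra.
have b2 w : `|theta (hd w - d) - theta (hd w - q (tailr w))| <= 2.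
  by rewrite (le_trans (ler_normB _ _)) // !theta_abs.
rewrite -RintD.
- have iT : integ n.+1 (fun w => Ash P d w * tauF M y (lam *: w)).
    by apply: (Ash_theta_int s01 kh) => // w; rewrite (le_trans (tauF_abs _ _ _)) // ler1n.
  have iO : integ n.+1 (fun w => Ash P d w * theta (hd w - d)).
    apply: (Ash_theta_int s01 kh) => //; first exact: (mth (fun=> d)).
    by move=> w; rewrite theta_abs ler1n.
  rewrite (eq_Rint (g := fun w => Ash P d w * tauF M y (lam *: w) + Ash P d w * theta (hd w - d))).
    by rewrite RintD // eq0 (Ash_odd s01 kh) addr0.
  by move=> w; ring.
- by apply: (Ash_theta_int s01 kh) => //; apply: measurable_funD => //; exact: mth.
- by apply: (Ash_theta_int s01 kh) => //; apply: measurable_funB; [exact: (mth (fun=> d))|exact: mth].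
Qed.

End Equation.

(** * The contribution of the boundary geometry *)

Section Geometry.
Variable R : realType.

Notation I m f := (Rintegral (muV R m) setT f).
Notation integ m f := ((muV R m).-integrable setT (EFin \o f)).

Definition near m (S : R) (f : 'rV[R]_m -> R) (w : 'rV[R]_m) : R :=
  if enorm w < S then f w else 0.
Definition far m (S : R) (f : 'rV[R]_m -> R) (w : 'rV[R]_m) : R :=
  if S <= enorm w then f w else 0.

Lemma measurable_enorm m : measurable_fun setT (@enorm R m).
Proof. exact: continuous_measurable_rV (@continuous_enorm R m). Qed.

Lemma measurable_near m S f : measurable_fun setT f -> measurable_fun setT (@near m S f).
Proof.
move=> mf; apply: measurable_fun_ifT => //; apply: measurable_fun_ltr => //.
exact: measurable_enorm.
Qed.

Lemma measurable_far m S f : measurable_fun setT f -> measurable_fun setT (@far m S f).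
Proof.
move=> mf; apply: measurable_fun_ifT => //; apply: measurable_fun_ler => //.
exact: measurable_enorm.
Qed.

Lemma near_far m S f w : f w = @near m S f w + far S f w.
Proof. by rewrite /near /far; case: ltP; rewrite ?addr0 ?add0r. Qed.

Lemma Rint_near_far m S (f : 'rV[R]_m -> R) A B :
  integ m (near S f) /\ I m (fun w => `|near S f w|) <= A ->
  integ m (far S f) /\ I m (fun w => `|far S f w|) <= B ->
  integ m f /\ `|I m f| <= A + B.
Proof.
move=> [i1 b1] [i2 b2].
have e : f = (fun w => near S f w + far S f w) by apply/funext => w; exact: near_far.
have i : integ m f by rewrite e; exact: integD.
split => //; rewrite {1}e RintD // (le_trans (ler_normD _ _)) // lerD //.
  by apply: le_trans b1; exact: le_normr_Rintegral.
by apply: le_trans b2; exact: le_normr_Rintegral.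
Qed.

Lemma enorm_neq0 m (x : 'rV[R]_m) : 0 < enorm x -> x != 0.
Proof. by apply: contraTneq => ->; rewrite enorm0 ltxx. Qed.

Section Sandwich.
Variables (n : nat) (s : R) (P : 'rV[R]_n.+1 -> R) (CC CNs : R).
Hypotheses (s01 : 0 < s < 1) (kh : kernel_hyp s P CC CNs).
Variable (E : set 'rV[R]_n.+1).
Hypothesis oE : open E.
Local Notation p := (n.+1%:R + 2 * s).

Lemma sandwich_tau y (M : 'M[R]_n.+1) Q e C (w : 'rV[R]_n.+1) : sandwich E y M Q e C ->
  enorm w < C^-1 -> C * enorm (tailr w) `^ e < `|hd w - Q (tailr w)| ->
  tauF E M y w + theta (hd w - Q (tailr w)) = 0.
Proof.
move=> sw; set h := hd w; set z := tailr w.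
have -> : tauF E M y w = tauE E (y + extl z h *m M^T) by rewrite -frame_consr consr_hd.
rewrite -(consr_hd w) => /(sw z h)[lo up]; rewrite /theta.
case: (ltrP 0 (h - Q z)) => hq.
  rewrite gtr0_norm // ltrBrDl => /up ncl.
  by rewrite tauE_out // addNr.
rewrite ler0_norm // opprB => hz; rewrite tauE_in ?subrr //.
by apply: lo; rewrite ltrBrDl -ltrBrDr.
Qed.

(** The deviation of the blown-up domain from the region below the graph of [q]. Under a sandwich it
    vanishes except in a thin wedge about that graph and far from the origin. *)
Definition bad M y (lam : R) (q : 'rV[R]_n -> R) (w : 'rV[R]_n.+1) :=
  tauF E M y (lam *: w) + theta (hd w - q (tailr w)).

Lemma bad_abs M y lam q w : `|bad M y lam q w| <= 2.
Proof.
by rewrite (le_trans (ler_normD _ _)) // theta_abs; have := tauF_abs E M y (lam *: w); lra.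
Qed.

Lemma measurable_bad (M : 'M[R]_n.+1) y lam q : M *m M^T = 1%:M -> measurable_fun setT q ->
  measurable_fun setT (bad M y lam q).
Proof.
move=> MM mq; apply: measurable_funD; first exact: measurable_tauF_scale.
apply: measurable_theta; apply: measurable_funB; first exact: measurable_hd.
exact: measurable_tail_comp.
Qed.

Lemma hdZ m c (w : 'rV[R]_m.+1) : hd (c *: w) = c * hd w.
Proof. by rewrite /hd mxE. Qed.

Lemma tailrZ m c (w : 'rV[R]_m.+1) : tailr (c *: w) = c *: tailr w.
Proof. by rewrite -{1}(consr_hd w) consrZ tailr_consr. Qed.

(** The blow-up turns the radius [1 / C] into [1 / (C lam)] and the error [C |w| ^ e] into
    [C lam ^ (e - 1) |w| ^ e]. *)
Lemma bad_eq0 y (M : 'M[R]_n.+1) Q e C (lam : R) (w : 'rV[R]_n.+1) : sandwich E y M Q e C -> 0 < C ->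
  0 < lam -> enorm w < (C * lam)^-1 ->
  C * lam `^ (e - 1) * enorm (tailr w) `^ e < `|hd w - lam^-1 * Q (lam *: tailr w)| ->
  bad M y lam (fun z => lam^-1 * Q (lam *: z)) w = 0.
Proof.
move=> sw C0 l0 wS hq.
have e1 : hd (lam *: w) - Q (tailr (lam *: w)) = lam * (hd w - lam^-1 * Q (lam *: tailr w)).
  by rewrite hdZ tailrZ mulrBr mulrA mulfV ?mul1r // gt_eqF.
rewrite /bad -(thetaZ _ l0) -e1; apply: (sandwich_tau sw).
  by rewrite enormZ gtr0_norm // -ltr_pdivlMl // -invfM mulrC.
rewrite e1 normrM tailrZ enormZ !(gtr0_norm l0) powRM ?enorm_ge0 ?(ltW l0) //.
move: hq; rewrite -(ltr_pM2l l0); apply: le_lt_trans.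
rewrite le_eqVlt; apply/orP; left; apply/eqP.
have -> : lam `^ e = lam * lam `^ (e - 1).
  by rewrite -{2}(powRr1 (ltW l0)) -powRD ?(gt_eqF l0) ?implybT // addrC subrK.
ring.
Qed.

(** With [S = 1 / (C lam)] and [p' = n + 1 + b], the wedge inside the ball of radius [S] costs
    [lam ^ (e - 1) S ^ (n + e - p')] and the outside costs [S ^ (- b)]; both are of order [lam ^ b].
    The condition [1 + b < e] is the integrability required by [slab_near]. *)
Lemma bad_integral_bound (e b C : R) : 0 < C -> 0 < b -> 1 + b < e ->
  exists2 C', 0 <= C' & forall (M : 'M[R]_n.+1) y (Q : 'rV[R]_n -> R) (lam k : R) (f : 'rV[R]_n.+1 -> R),
    M *m M^T = 1%:M -> measurable_fun setT Q -> sandwich E y M Q e C -> 0 < lam -> 0 <= k ->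
    measurable_fun setT f -> (forall w, `|f w| <= k * decay (n.+1%:R + b) w) ->
    (forall w, bad M y lam (fun z => lam^-1 * Q (lam *: z)) w = 0 -> f w = 0) ->
    `|I n.+1 f| <= k * C' * lam `^ b.
Proof.
move=> C0 b0 be; set p' := n.+1%:R + b.
have p'0 : 0 <= p' by rewrite addr_ge0 ?ltW.
have e0 : 0 < e by lra.
have ep : - n%:R < e - p' by rewrite /p' -natr1; lra.
have np : n.+1%:R < p' by rewrite ltrDl.
have [C1 C10 H1] := slab_near e0 ep.
have [C2 C20 H2] := tail_bound np.
exists (C1 * (C * C `^ (- (n%:R + (e - p')))) + C2 * C `^ b).
  by rewrite addr_ge0 // !mulr_ge0 ?powR_ge0 // ltW.
move=> M y Q lam k f MM mQ sw l0 k0 mf fle f0; set q := (fun z : 'rV[R]_n => lam^-1 * Q (lam *: z)).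
have mq : measurable_fun setT q.
  rewrite /q; apply: measurable_funM; first exact: measurable_cst.
  exact: (measurable_affine mQ (@continuous_scaler _ _ lam)).
have Cl0 : 0 < C * lam by rewrite mulr_gt0.
pose S := (C * lam)^-1; have S0 : 0 < S by rewrite invr_gt0.
have SE r : S `^ r = C `^ (- r) * lam `^ (- r).
  by rewrite /S -powR_inv1 ?(ltW Cl0) // -powRrM mulN1r powRM ?(ltW l0) // ltW.
have Dn : integ n.+1 (near S f) /\ I n.+1 (fun w => `|near S f w|) <=
    k * (C1 * (C * C `^ (- (n%:R + (e - p'))))) * lam `^ b.
  have [||||||i le] := H1 k (C * lam `^ (e - 1)) S q (fun z => k * decay p' z) (near S f) S0 _ k0 mq.
  - by rewrite mulr_ge0 ?powR_ge0 // ltW.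
  - by apply: measurable_funM => //; exact: measurable_decay.
  - exact: measurable_near.
  - by move=> z; rewrite mulr_ge0 ?decay_ge0.
  - by move=> z z0; rewrite ler_wpM2l // decay_le_pow.
  - move=> h z; rewrite /near; case: ltP => wS; last first.
      by rewrite normr0; case: ifP => // _; rewrite mulr_ge0 ?decay_ge0.
    have zS := le_lt_trans (enorm_consr_ge h z) wS; rewrite zS /=.
    case: (leP `|h - q z| _) => hq.
      by rewrite (le_trans (fle _)) // ler_wpM2l // decay_section.
    by rewrite f0 ?normr0 // (bad_eq0 sw) // hd_consr tailr_consr.
  split=> //; apply: (le_trans le); rewrite SE.
  rewrite (_ : C * _ * _ = C * C `^ (- (n%:R + (e - p'))) * (lam `^ (e - 1) * lam `^ (- (n%:R + (e - p'))))); last by ring.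
  rewrite -powRD ?(gt_eqF l0) ?implybT // (_ : e - 1 - _ = b); last by rewrite /p' -natr1; ring.
  by rewrite le_eqVlt; apply/orP; left; apply/eqP; ring.
have Df : integ n.+1 (far S f) /\ I n.+1 (fun w => `|far S f w|) <= k * (C2 * C `^ b) * lam `^ b.
  have [||i le] := H2 k S (far S f) S0 k0.
  - exact: measurable_far.
  - move=> w; rewrite /far; case: (leP S) => wS; last by rewrite normr0.
    rewrite (le_trans (fle _)) // ler_wpM2l // decay_le_pow //.
    by apply: enorm_neq0; exact: lt_le_trans wS.
  split=> //; apply: (le_trans le); rewrite SE.
  by rewrite (_ : - (n.+1%:R - p') = b) ?mulrA // /p'; ring.
by have [_] := Rint_near_far Dn Df; rewrite -mulrDl -mulrDr.
Qed.

Lemma bad_bound (e b C : R) : 0 < C -> 0 < b <= 2 * s -> 1 + b < e ->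
  exists2 C', 0 <= C' & forall (M : 'M[R]_n.+1) y (Q : 'rV[R]_n -> R) (lam d : R), M *m M^T = 1%:M ->
    measurable_fun setT Q -> sandwich E y M Q e C -> 0 < lam -> `|d| <= 1 ->
    `|I n.+1 (fun w => Ash P d w * bad M y lam (fun z => lam^-1 * Q (lam *: z)) w)| <= C' * lam `^ b.
Proof.
move=> C0 /andP[b0 bs] be; have [C' C'0 H] := bad_integral_bound C0 b0 be.
have [k kE] : {k | k = 2 * kash n s CC} by exists (2 * kash n s CC).
have k0 : 0 <= k by have := kash_ge0 kh; rewrite kE; lra.
exists (k * C') => [|M y Q lam d MM mQ sw l0 d1]; first by rewrite mulr_ge0.
apply: (H M y Q lam k _ MM mQ sw l0 k0) => [|w|w ->]; last by rewrite mulr0.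
  apply: measurable_funM; [exact: measurable_Ash kh _|apply: measurable_bad => //].
  apply: measurable_funM; first exact: measurable_cst.
  exact: (measurable_affine mQ (@continuous_scaler _ _ lam)).
rewrite normrM gtr0_norm ?(Ash_gt0 kh) // kE -mulrA mulrC ler_pM ?normr_ge0 ?(ltW (Ash_gt0 kh _ _)) ?bad_abs //.
rewrite (le_trans (Ash_le s01 kh _ d1)) // ler_wpM2l ?(kash_ge0 kh) //; apply: decay_mono.
by rewrite lerD2l.
Qed.

(** Relative to the tangent hyperplane, the displacement term is at least a multiple of [|d|] by
    [slab_lower], while the geometric term is at most a multiple of [lam ^ b] by [bad_bound]; the
    equation makes them opposite. *)
Lemma apriori (e b C : R) : 0 < C -> 0 < b <= 2 * s -> 1 + b < e ->
  exists2 C', 0 <= C' & forall (M : 'M[R]_n.+1) y (lam d : R), M *m M^T = 1%:M ->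
    sandwich E y M (fun=> 0) e C -> 0 < lam -> `|d| <= 1 ->
    I n.+1 (fun w => Ash P d w * tauF E M y (lam *: w)) = 0 -> `|d| <= C' * lam `^ b.
Proof.
move=> C0 bs be; have [C' C'0 H] := bad_bound C0 bs be.
have k0 : 0 < 2 * klow n s CC * vol1 R n.
  apply: mulr_gt0; last exact: vol1_gt0.
  by apply: mulr_gt0; [|exact: klow_gt0 kh].
exists ((2 * klow n s CC * vol1 R n)^-1 * C'); first by rewrite mulr_ge0 // invr_ge0 ltW.
move=> M y lam d MM sw l0 d1 eq0.
rewrite -[leRHS]mulrA ler_pdivlMl //; apply: le_trans (slab_lower s01 kh d1) _.
have := equation_split s01 kh oE MM d1 (q := fun=> lam^-1 * 0) _ eq0.
rewrite /= => /(_ (measurable_cst _)) /eqP; rewrite addrC addr_eq0 => /eqP.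
set A := I _ _; set B := I _ _ => AB.
have -> : I n.+1 (fun w => Ash P d w * (theta (hd w - d) - theta (hd w))) = A.
  by apply: eq_Rint => w; rewrite mulr0 subr0.
by rewrite AB normrN; apply: (H M y (fun=> 0) lam d).
Qed.

End Sandwich.
End Geometry.

(** * Second moments of radial densities *)

Section Moments.
Variable R : realType.

Notation I m f := (Rintegral (muV R m) setT f).
Notation integ m f := ((muV R m).-integrable setT (EFin \o f)).

Lemma integ0 m : integ m (fun=> 0).
Proof. by rewrite (_ : _ \o _ = cst 0%E) //; exact: integrable0. Qed.

Lemma Rint_sum m (T : Type) (r : seq T) (f : T -> 'rV[R]_m -> R) : (forall i, integ m (f i)) ->
  integ m (fun x => \sum_(i <- r) f i x) /\
  I m (fun x => \sum_(i <- r) f i x) = \sum_(i <- r) I m (f i).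
Proof.
move=> fi; elim: r => [|i r [IHi IH]].
  have e : (fun x : 'rV[R]_m => \sum_(i <- [::]) f i x) = (fun=> 0).
    by apply/funext => x; rewrite big_nil.
  by rewrite e big_nil; split; [exact: integ0|rewrite /Rintegral integral0_eq].
have e : (fun x : 'rV[R]_m => \sum_(j <- i :: r) f j x) = (fun x => f i x + \sum_(j <- r) f j x).
  by apply/funext => x; rewrite big_cons.
by rewrite e big_cons; split; [exact: integD|rewrite RintD // IH].
Qed.

Section Radial.
Variables (n : nat) (g : 'rV[R]_n -> R).
Hypotheses (mg : measurable_fun setT g) (gr : forall v w, enorm v = enorm w -> g v = g w).
Hypothesis g2 : integ n (fun w => enorm w ^+ 2 * `|g w|).

Let mom i j (w : 'rV[R]_n) := w 0 i * w 0 j * g w.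

Let mom_integ i j : integ n (mom i j).
Proof.
apply: integ_le g2.
  by apply: measurable_funM => //; apply: measurable_funM; exact: measurable_rVcoord.
move=> w; rewrite /mom !normrM ler_wpM2r // expr2 ler_pM //; exact: ler_abs_coord_enorm.
Qed.

Let mom_orth (M : 'M[R]_n) i j : M *m M^T = 1%:M -> I n (mom i j) = I n (fun w => mom i j (w *m M)).
Proof. by move=> MM; have [_ ->] := Rint_orth MM (mom_integ i j). Qed.

Let mom_off i j : i != j -> I n (mom i j) = 0.
Proof.
(* The reflection of the coordinate [i] preserves [g] and changes the sign of this moment. *)
move=> ij; pose d : 'rV[R]_n := \row_k (if k == i then -1 else 1).
have dd : diag_mx d *m (diag_mx d)^T = 1%:M.
  rewrite tr_diag_mx mulmx_diag -diag_const_mx; congr diag_mx.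
  by apply/rowP => k; rewrite !mxE; case: ifP => _; rewrite ?mulrNN mulr1.
have e : I n (fun w => mom i j (w *m diag_mx d)) = -1 * I n (mom i j).
  rewrite -RintZ //; apply: eq_Rint => w; rewrite /mom (gr (w := w)) ?enorm_mulmx //.
  by rewrite mul_mx_diag !mxE eqxx eq_sym (negPf ij); ring.
by have := mom_orth i j dd; rewrite e mulN1r; lra.
Qed.

Let mom_diag i j : I n (mom i i) = I n (mom j j).
Proof.
have tt : tperm_mx i j *m (tperm_mx i j)^T = 1%:M :> 'M[R]_n.
  by rewrite tr_tperm_mx -perm_mxM perm.tperm2 perm_mx1.
rewrite (mom_orth i i tt); apply: eq_Rint => w; rewrite /mom (gr (w := w)) ?enorm_mulmx //.
have -> : w *m tperm_mx i j = col_perm (perm.tperm i j) w by rewrite col_permE perm.tpermV.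
by rewrite !mxE perm.tpermL.
Qed.

(** Mixed moments vanish by reflections and the pure ones coincide by transpositions of coordinates,
    so only the trace of [A] is seen. The factor [n] on the left avoids dividing by the
    dimension. *)
Lemma bil_moment (A : 'M[R]_n) :
  integ n (fun w => bil A w w * g w) /\
  n%:R * I n (fun w => bil A w w * g w) = \tr A * I n (fun w => enorm w ^+ 2 * g w).
Proof.
have e1 (B : 'M[R]_n) : integ n (fun w => bil B w w * g w) /\
    I n (fun w => bil B w w * g w) = \sum_i B i i * I n (mom i i).
  have bE : (fun w : 'rV[R]_n => bil B w w * g w) = (fun w => \sum_i \sum_j B i j * mom i j w).
    apply/funext => w; rewrite /bil mulr_suml; apply: eq_bigr => i _.
    by rewrite mulr_sumr mulr_suml; apply: eq_bigr => j _; rewrite /mom; ring.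
  have S i := Rint_sum (index_enum _) (fun j => integZ (B i j) (mom_integ i j)).
  have [i1 S1] := Rint_sum (index_enum _) (fun i => (S i).1).
  rewrite bE; split => //; rewrite S1; apply: eq_bigr => i _; rewrite (S i).2 (bigD1 i) //=.
  rewrite RintZ // big1 ?addr0 // => j ji; rewrite RintZ // mom_off ?mulr0 //.
  by rewrite eq_sym.
split; first exact: (e1 A).1.
have e2 : I n (fun w => enorm w ^+ 2 * g w) = \sum_i I n (mom i i).
  rewrite (eq_Rint (g := fun w => bil 1%:M w w * g w)).
    by rewrite (e1 _).2; apply: eq_bigr => i _; rewrite mxE eqxx mul1r.
  move=> w; congr (_ * _); rewrite sqr_enorm /bil; apply: eq_bigr => i _.
  rewrite (bigD1 i) //= mxE eqxx mulr1 big1 ?addr0 // => j ji.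
  by rewrite mxE eq_sym (negPf ji) mulr0.
rewrite (e1 A).2 e2 /mxtrace mulr_suml mulr_sumr; apply: eq_bigr => i _.
rewrite [in RHS](eq_bigr (fun=> I n (mom i i))); last by move=> j _; exact: mom_diag.
by rewrite sumr_const card_ord -[_ *+ n]mulr_natl; ring.
Qed.

End Radial.
End Moments.

(** * The quadratic expansion *)

Section Quadratic.
Variables (R : realType) (n : nat) (s : R) (P : 'rV[R]_n.+1 -> R) (CC CNs : R).
Hypotheses (s01 : 0 < s < 1) (kh : kernel_hyp s P CC CNs).
Variable (E : set 'rV[R]_n.+1).
Hypotheses (oE : open E) (n0 : n != 0%N).

Notation I m f := (Rintegral (muV R m) setT f).
Notation integ m f := ((muV R m).-integrable setT (EFin \o f)).
Local Notation p := (n.+1%:R + 2 * s).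

Let s0 : 0 < s. Proof. by case/andP: s01. Qed.
Let s1 : 0 < 1 - s. Proof. by rewrite subr_gt0; case/andP: s01. Qed.
Let s2 : 1 + s < 2. Proof. by have := s1 => h; lra. Qed.
Let s3 : 1 + 2 * s < 3. Proof. by have := s1 => h; lra. Qed.
Let p0 : 0 <= p. Proof. by rewrite addr_ge0 ?mulr_ge0 // ltW. Qed.
Let Np : n.+1%:R < p. Proof. by rewrite ltrDl mulr_gt0. Qed.
Let np : n%:R < p. Proof. by rewrite (lt_trans _ Np) // ltr_nat. Qed.

(** On the hyperplane the density [|z| ^ 2 P] is not integrable for [s <= 1/2], so the expansion
    needs a truncation. The radius [1 / lam] is unit distance before the blow-up; for [s = 1/2] it
    is the radius in [bN]. *)
Definition cutoff (lam : R) (z : 'rV[R]_n) : R := if enorm z < lam^-1 then 1 else 0.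

Definition moment2 (lam : R) : R := I n (fun z => cutoff lam z * enorm z ^+ 2 * P0 P z).

Lemma measurable_cutoff lam : measurable_fun setT (cutoff lam).
Proof.
apply: measurable_fun_ifT => //; apply: measurable_fun_ltr => //; exact: measurable_enorm.
Qed.

Lemma cutoff_ge0 lam z : 0 <= cutoff lam z. Proof. by rewrite /cutoff; case: ifP. Qed.

Lemma powR_invE (lam r : R) : 0 < lam -> lam^-1 `^ r = lam `^ (- r).
Proof. by move=> l0; rewrite -powR_inv1 ?(ltW l0) // -powRrM mulN1r. Qed.

Lemma measurable_bil (A : 'M[R]_n) : measurable_fun setT (fun z => bil A z z).
Proof.
have me : (fun z : 'rV[R]_n => bil A z z) = (fun z => \sum_i \sum_j z ord0 i * z ord0 j * A i j).
  by apply/funext => z; rewrite /bil; apply: eq_bigr => i _; rewrite mulr_sumr; apply: eq_bigr => j _; rewrite mulrA.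
rewrite me; apply: measurable_sum => i; apply: measurable_sum => j.
by apply: measurable_funM => //; apply: measurable_funM; exact: measurable_rVcoord.
Qed.

Lemma cutoff_integ (lam K : R) (f : 'rV[R]_n -> R) : measurable_fun setT f ->
  (forall z, enorm z < lam^-1 -> `|f z| <= K) -> integ n (fun z => cutoff lam z * f z * P0 P z).
Proof.
move=> mf fK; apply: (@integ_le _ _ _ (fun z => `|K| * P0 P z)).
- apply: measurable_funM; last exact: measurable_P0 kh.
  by apply: measurable_funM => //; exact: measurable_cutoff.
- move=> z; rewrite normrM (gtr0_norm (P0_gt0 kh z)) ler_wpM2r ?(ltW (P0_gt0 kh z)) //.
  rewrite /cutoff; case: ifP => zl; last by rewrite mul0r normr0.
  by rewrite mul1r (le_trans (fK _ zl)) // ler_norm.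
- by apply: integZ; exact: P0_integ s01 kh.
Qed.

(** Forgetting the quadratic form leaves contact of order 2 with the hyperplane, the input of
    [apriori]. *)
Lemma sandwich_quadratic y M (A : 'M[R]_n) C : 1 <= C ->
  (forall w, `|bil A w w| <= C * enorm w ^+ 2) ->
  sandwich E y M (fun w => bil A w w) 3 C -> sandwich E y M (fun=> 0) 2 (2 * C).
Proof.
move=> C1 AC sw w h wh.
have C0 : 0 < C by lra.
have wC : enorm (consr h w) < C^-1.
  by rewrite (lt_trans wh) // ltf_pV2 ?posrE ?mulr_gt0 //; lra.
have [lo up] := sw w h wC; have := AC w; have w0 := enorm_ge0 w.
have w1 : enorm w <= 1.
  rewrite (le_trans (enorm_consr_ge h w)) // (le_trans (ltW wC)) // invf_le1 //.
have e3 : C * enorm w `^ 3 <= C * enorm w ^+ 2.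
  rewrite powR_mulrn // ler_wpM2l ?(ltW C0) // exprSr.
  by rewrite ler_piMr // exprn_ge0.
have -> : enorm w `^ 2 = enorm w ^+ 2 by rewrite powR_mulrn.
rewrite ler_norml => /andP[b1 b2].
by split => H; [apply: lo|apply: up]; lra.
Qed.

(** Where [|w'| >= 1 / lam] one also has [|w| >= 1 / lam], and the mass of the kernel there is of
    order [lam ^ (2 s)], the permitted error. *)
Lemma quadratic_far : exists2 C, 0 <= C & forall lam d (f : 'rV[R]_n.+1 -> R),
  0 < lam -> `|d| <= 1 -> measurable_fun setT f -> (forall w, `|f w| <= 2) ->
  `|I n.+1 (fun w => Ash P d w * f w) - I n.+1 (fun w => Ash P d w * f w * cutoff lam (tailr w))|
    <= C * lam `^ (2 * s).
Proof.
have [C C0 H] := tail_bound Np.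
have [k kE] : {k | k = 2 * kash n s CC} by exists (2 * kash n s CC).
have k0 : 0 <= k by have := kash_ge0 kh; rewrite kE; lra.
exists (k * C); first by rewrite mulr_ge0.
move=> lam d f l0 d1 mf f2; have mA := measurable_Ash kh d.
have mc : measurable_fun setT (fun w : 'rV[R]_n.+1 => cutoff lam (tailr w)).
  exact: measurable_tail_comp (measurable_cutoff lam).
have i1 := Ash_theta_int s01 kh d1 mf f2.
have i2 : integ n.+1 (fun w => Ash P d w * f w * cutoff lam (tailr w)).
  have := @Ash_theta_int _ _ _ _ _ _ s01 kh d (fun w => f w * cutoff lam (tailr w)) d1.
  rewrite (_ : (fun w => Ash P d w * f w * _) = (fun w => Ash P d w * (f w * cutoff lam (tailr w)))).
    apply; first exact: measurable_funM.
    by move=> w; rewrite /cutoff; case: ifP; rewrite ?mulr1 // mulr0 normr0.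
  by apply/funext => w; rewrite mulrA.
rewrite -RintB //; set g := (fun w => _).
have [|||i3 b3] := H k lam^-1 g _ k0; first by rewrite invr_gt0.
- by apply: measurable_funB; [exact: measurable_funM|apply: measurable_funM => //; exact: measurable_funM].
- move=> w; rewrite /g /cutoff; have tw : enorm (tailr w) <= enorm w.
    by rewrite -{2}(consr_hd w) enorm_consr_ge.
  case: ltP => wS; first by rewrite mulr1 subrr normr0; case: ifP => // _; rewrite mulr_ge0 ?powR_ge0.
  rewrite mulr0 subr0 (le_trans wS tw) kE normrM (gtr0_norm (Ash_gt0 kh _ _)).
  rewrite -mulrA mulrC ler_pM ?normr_ge0 ?(ltW (Ash_gt0 kh _ _)) //.
  rewrite (le_trans (Ash_le s01 kh _ d1)) // ler_wpM2l ?(kash_ge0 kh) // decay_le_pow //.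
  by apply: enorm_neq0; rewrite (lt_le_trans _ (le_trans wS tw)) // invr_gt0.
apply: le_trans (le_normr_Rintegral _ i3) _ => //; apply: (le_trans b3).
by rewrite powR_invE // (_ : - (n.+1%:R - p) = 2 * s) //; ring.
Qed.

Lemma cutoff_mass : exists2 C, 0 <= C & forall lam, 0 < lam < 1 ->
  integ n (fun z => cutoff lam z * P0 P z) /\
  `|I0 P - I n (fun z => cutoff lam z * P0 P z)| <= C * lam `^ (2 * s).
Proof.
have [C C0 H] := tail_bound np.
have [k kE] : {k | k = kdec n s CC} by exists (kdec n s CC).
have k0 : 0 <= k by rewrite kE; exact: kdec_ge0 kh.
exists (k * C); first by rewrite mulr_ge0.
move=> lam /andP[l0 l1].
have i1 : integ n (fun z => cutoff lam z * P0 P z).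
  have := @cutoff_integ lam 1 (fun=> 1) (measurable_cst _).
  rewrite (_ : (fun z => cutoff lam z * 1 * P0 P z) = (fun z => cutoff lam z * P0 P z)).
    by apply => z _; rewrite normr1.
  by apply/funext => z; rewrite mulr1.
split => //; rewrite /I0 -RintB //; last exact: P0_integ s01 kh.
set g := (fun w => _).
have [|||i3 b3] := H k lam^-1 g _ k0; first by rewrite invr_gt0.
- apply: measurable_funB; first exact: measurable_P0 kh.
  by apply: measurable_funM; [exact: measurable_cutoff|exact: measurable_P0 kh].
- move=> z; rewrite /g /cutoff.
  case: ltP => zS; first by rewrite mul1r subrr normr0.
  rewrite mul0r subr0 kE (gtr0_norm (P0_gt0 kh _)) (le_trans (P0_le s01 kh _)) //.
  rewrite ler_wpM2l ?(kdec_ge0 kh) // decay_le_pow //.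
  by apply: enorm_neq0; rewrite (lt_le_trans _ zS) // invr_gt0.
apply: le_trans (le_normr_Rintegral _ i3) _ => //; apply: (le_trans b3).
(* On the hyperplane the tail has the better order [lam ^ (1 + 2 s)]; [lam < 1] is used to weaken
   it. *)
rewrite powR_invE // ler_wpM2l ?mulr_ge0 // ger_powR ?l0 ?(ltW l1) // -[n.+1%:R]natr1; lra.
Qed.

(** The square is at most [2 lam ^ 2 Q ^ 2 + 2 d ^ 2]. The first term is integrated over
    [|z| < 1 / lam] against [|z| ^ (4 - (p + 1))] and gives [lam ^ 2 lam ^ (- (2 - 2 s))]; the
    second is of order [lam ^ (2 s)] by the hypothesis on [d], which [apriori] supplies with
    [b = s]. *)
Lemma quadratic_error C : 0 <= C -> exists2 C', 0 <= C' & forall (A : 'M[R]_n) lam d D,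
  (forall w, `|bil A w w| <= C * enorm w ^+ 2) -> 0 < lam -> `|d| <= D * lam `^ s -> D <= C ->
  integ n (fun z => `|cutoff lam z| * (lam * bil A z z - d) ^+ 2 * decay (p + 1) z) /\
  I n (fun z => `|cutoff lam z| * (lam * bil A z z - d) ^+ 2 * decay (p + 1) z) <= C' * lam `^ (2 * s).
Proof.
move=> C0.
have q0 : - n%:R < 4 - (p + 1).
  by rewrite -[n.+1%:R]natr1; move: (n%:R : R) s1 => x; lra.
have [C1 C10 H] := near_bound q0.
have np1 : n%:R < p + 1 by rewrite (lt_trans np) // ltrDl.
have id := decay_integrable np1; set D1 := I n (@decay R (p + 1) n).
have D10 : 0 <= D1 by apply: Rintegral_ge0 => z _; exact: decay_ge0.
exists (2 * C ^+ 2 * C1 + 2 * C ^+ 2 * D1); first by rewrite addr_ge0 // !mulr_ge0 // exprn_ge0.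
move=> A lam d D AC l0 dD DC.
pose g1 z := cutoff lam z * (enorm z ^+ 4 * decay (p + 1) z).
have mc := measurable_cutoff lam; have md := @measurable_decay R n (p + 1).
have mg1 : measurable_fun setT g1.
  apply: measurable_funM => //; apply: measurable_funM => //.
  by apply: measurable_funX; exact: measurable_enorm.
have g10 z : 0 <= g1 z by rewrite !mulr_ge0 ?cutoff_ge0 ?exprn_ge0 ?enorm_ge0 ?decay_ge0.
have [||i1 b1] := H 1 lam^-1 g1 _ ler01 mg1; first by rewrite invr_gt0.
  move=> z; rewrite ger0_norm // /g1 /cutoff; case: ifP => zS; last by rewrite mul0r.
  rewrite !mul1r; have [->|z0] := eqVneq z 0.
    by rewrite enorm0 expr0n mul0r powR_ge0.
  have zz := enorm_gt0 z0; rewrite powRD ?(gt_eqF zz) ?implybT //.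
  by rewrite powR_mulrn ?(ltW zz) // ler_wpM2l ?exprn_ge0 ?(ltW zz) // decay_le_pow // addr_ge0.
have e1 : I n (fun x => `|g1 x|) = I n g1 by apply: eq_Rint => z; rewrite ger0_norm.
rewrite e1 mul1r powR_invE // in b1.
have mq : measurable_fun setT (fun z => lam * bil A z z - d).
  by apply: measurable_funB => //; apply: measurable_funM => //; exact: measurable_bil.
have [] := @Rint_abs_le R _ (fun z => `|cutoff lam z| * (lam * bil A z z - d) ^+ 2 * decay (p + 1) z)
   (fun z => 2 * lam ^+ 2 * C ^+ 2 * g1 z + 2 * d ^+ 2 * decay (p + 1) z).
- apply: measurable_funM => //; apply: measurable_funM; first exact: measurableT_comp.
  exact: measurable_funX.
- move=> z; rewrite ger0_norm; last first.
    by apply: mulr_ge0; [apply: mulr_ge0; [exact: normr_ge0|exact: sqr_ge0]|exact: decay_ge0].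
  rewrite /g1 (ger0_norm (cutoff_ge0 _ _)).
  have D0 := @decay_ge0 R (p + 1) n z.
  have b2 : bil A z z ^+ 2 <= C ^+ 2 * enorm z ^+ 4.
    have -> : C ^+ 2 * enorm z ^+ 4 = (C * enorm z ^+ 2) ^+ 2 by ring.
    rewrite -real_normK ?num_real //; apply: lerXn2r; rewrite ?nnegrE //.
    by apply: mulr_ge0 => //; exact: sqr_ge0.
  rewrite /cutoff; case: ifP => _; last first.
    rewrite !mul0r mulr0 add0r; apply: mulr_ge0 => //.
    by apply: mulr_ge0 => //; exact: sqr_ge0.
  rewrite !mul1r mulrA -mulrDl ler_wpM2r //.
  have l2 : 0 <= lam ^+ 2 by rewrite exprn_ge0 // ltW.
  have := ler_wpM2l l2 b2; have := sqr_ge0 (lam * bil A z z + d).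
  have -> : (lam * bil A z z + d) ^+ 2 = 2 * (lam ^+ 2 * bil A z z ^+ 2) + 2 * d ^+ 2 - (lam * bil A z z - d) ^+ 2 by ring.
  by rewrite -!mulrA; lra.
- by apply: integD; apply: integZ.
move=> i2; have ia := integZ (2 * lam ^+ 2 * C ^+ 2) i1; have ib := integZ (2 * d ^+ 2) id.
rewrite (RintD ia ib) (RintZ _ i1) (RintZ _ id).
move=> b2; split => //; apply: le_trans (le_trans (ler_norm _) b2) _; rewrite -/D1 [leRHS]mulrDl.
apply: lerD.
  have -> : 2 * C ^+ 2 * C1 * lam `^ (2 * s) = 2 * lam ^+ 2 * C ^+ 2 * (C1 * lam `^ (- (n%:R + (4 - (p + 1))))).
    rewrite (_ : lam `^ (2 * s) = lam ^+ 2 * lam `^ (- (n%:R + (4 - (p + 1))))); first by ring.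
    rewrite -powR_mulrn ?(ltW l0) // -powRD ?(gt_eqF l0) ?implybT //.
    by congr (_ `^ _); rewrite -[n.+1%:R]natr1; ring.
  by apply: ler_wpM2l => //; apply: mulr_ge0; [apply: mulr_ge0 => //|]; exact: sqr_ge0.
have d2 : d ^+ 2 <= C ^+ 2 * lam `^ (2 * s).
  rewrite (mulrC 2) powRrM powR_mulrn ?powR_ge0 // -exprMn -real_normK ?num_real //.
  have Cl : `|d| <= C * lam `^ s by rewrite (le_trans dD) // ler_wpM2r ?powR_ge0.
  by apply: lerXn2r => //; rewrite nnegrE // mulr_ge0 ?powR_ge0.
rewrite (_ : 2 * C ^+ 2 * D1 * lam `^ (2 * s) = 2 * (C ^+ 2 * lam `^ (2 * s)) * D1); last by ring.
by rewrite ler_wpM2r // ler_wpM2l.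
Qed.

Lemma P0_radial v w : enorm v = enorm w -> P0 P v = P0 P w.
Proof. by move=> vw; apply: (kernel_radial kh); rewrite !enorm_consr0. Qed.

Lemma cutoff_radial lam v w : enorm v = enorm w -> cutoff lam v = cutoff lam w.
Proof. by rewrite /cutoff => ->. Qed.

Lemma cutoff_moment2_integ lam : 0 < lam ->
  integ n (fun z => cutoff lam z * enorm z ^+ 2 * P0 P z).
Proof.
move=> l0; apply: (cutoff_integ (K := lam^-1 ^+ 2)).
  by apply: measurable_funX; exact: measurable_enorm.
move=> z zl; rewrite ger0_norm ?sqr_ge0 //; apply: lerXn2r; rewrite ?nnegrE ?enorm_ge0 ?invr_ge0 ?ltW //.
Qed.

Lemma cutoff_bil (A : 'M[R]_n) (h lam : R) : \tr A = n%:R * h / 2 -> 0 < lam ->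
  integ n (fun z => cutoff lam z * bil A z z * P0 P z) /\
  I n (fun z => cutoff lam z * bil A z z * P0 P z) = h / 2 * moment2 lam.
Proof.
move=> trA l0; pose g (z : 'rV[R]_n) := cutoff lam z * P0 P z.
have mg : measurable_fun setT g.
  by apply: measurable_funM; [exact: measurable_cutoff|exact: measurable_P0 kh].
have g0 z : 0 <= g z by rewrite mulr_ge0 ?cutoff_ge0 // ltW // (P0_gt0 kh).
have gr v w : enorm v = enorm w -> g v = g w.
  by move=> vw; rewrite /g (cutoff_radial _ vw) (P0_radial vw).
have e1 : (fun z => cutoff lam z * enorm z ^+ 2 * P0 P z) = (fun z => enorm z ^+ 2 * g z).
  by apply/funext => z; rewrite /g; ring.
have e2 : (fun z => cutoff lam z * bil A z z * P0 P z) = (fun z => bil A z z * g z).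
  by apply/funext => z; rewrite /g; ring.
have g2 : integ n (fun z => enorm z ^+ 2 * `|g z|).
  rewrite (_ : (fun z => _) = (fun z => cutoff lam z * enorm z ^+ 2 * P0 P z)).
    exact: cutoff_moment2_integ.
  by rewrite e1; apply/funext => z; rewrite ger0_norm.
have [i m] := bil_moment mg gr g2 A.
rewrite e2 /moment2 e1; split => //.
have n0' : n%:R != 0 :> R by rewrite pnatr_eq0.
by apply: (mulfI n0'); rewrite m trA; ring.
Qed.

Lemma quadratic_core C : 1 <= C -> exists2 C', 0 <= C' &
  forall (M : 'M[R]_n.+1) y (A : 'M[R]_n) (h lam d : R),
  M *m M^T = 1%:M -> \tr A = n%:R * h / 2 -> (forall w, `|bil A w w| <= C * enorm w ^+ 2) ->
  sandwich E y M (fun w => bil A w w) 3 C -> 0 < lam < 1 -> `|d| <= 1 ->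
  I n.+1 (fun w => Ash P d w * tauF E M y (lam *: w)) = 0 ->
  `|lam * (h / 2 * moment2 lam) - d * I0 P| <= C' * lam `^ (2 * s).
Proof.
move=> C1; have C0 : 0 < C by lra.
have [|||D D0 HD] := apriori s01 kh oE (e := 2) (b := s) (C := 2 * C); [by rewrite mulr_gt0|by rewrite s0 ler_peMl // ?ler1n // ltW|exact: s2|].
have [||B B0 HB] := bad_bound s01 kh oE (e := 3) (b := 2 * s) C0; [by rewrite lexx andbT mulr_gt0|exact: s3|].
have [F F0 HF] := quadratic_far.
have [T T0 HT] := cutoff_mass.
have CD0 : 0 <= C + D by lra.
have [G G0 HG] := quadratic_error CD0.
have kl := klip_ge0 kh; set k := klip n s CC in kl.
(* Four errors of order [lam ^ (2 s)]: deviation of [E] from the paraboloid, truncation of the slab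
   integral, freezing of [P] on the hyperplane, and truncation of the mass [I0]. *)
exists (B + F + k * G + T); first by have := mulr_ge0 kl G0; lra.
move=> M y A h lam d MM trA AC sw l01 d1 eq0.
have /andP[l0 l1] := l01.
pose q (z : 'rV[R]_n) := lam * bil A z z.
have mq : measurable_fun setT q by apply: measurable_funM => //; exact: measurable_bil.
have qE : (fun z => lam^-1 * bil A (lam *: z) (lam *: z)) = q.
  by apply/funext => z; rewrite bilZl bilZr /q mulKf ?gt_eqF.
have dD : `|d| <= D * lam `^ s.
  exact: (HD M y lam d MM (sandwich_quadratic C1 AC sw) l0 d1 eq0).
have := HB M y (fun w => bil A w w) lam d MM (measurable_bil A) sw l0 d1.
rewrite qE => bB.
have split0 := equation_split s01 kh oE MM d1 mq eq0.
pose f (w : 'rV[R]_n.+1) := theta (hd w - d) - theta (hd w - q (tailr w)).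
have mf : measurable_fun setT f.
  apply: measurable_funB; apply: measurable_theta; apply: measurable_funB => //; try exact: measurable_hd.
  exact: measurable_tail_comp.
have f2 w : `|f w| <= 2 by rewrite (le_trans (ler_normB _ _)) // !theta_abs.
have bF := HF lam d f l0 d1 mf f2.
have [i2 J2] := cutoff_bil trA l0.
have [i3 bT] := HT lam l01.
have iX : integ n (fun z => cutoff lam z * (q z - d) * P0 P z) /\
    I n (fun z => cutoff lam z * (q z - d) * P0 P z) =
    lam * (h / 2 * moment2 lam) - d * I n (fun z => cutoff lam z * P0 P z).
  have e : (fun z => cutoff lam z * (q z - d) * P0 P z) =
      (fun z => lam * (cutoff lam z * bil A z z * P0 P z) - d * (cutoff lam z * P0 P z)).
    by apply/funext => z; rewrite /q; ring.
  have ia := integZ lam i2; have ib := integZ d i3.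
  by rewrite e; split; [exact: integB|rewrite (RintB ia ib) (RintZ _ i2) (RintZ _ i3) J2].
have AC' w : `|bil A w w| <= (C + D) * enorm w ^+ 2.
  by rewrite (le_trans (AC w)) // ler_wpM2r ?sqr_ge0 //; lra.
have DC : D <= C + D by lra.
have [iE bE] := HG A lam d D AC' l0 dD DC.
have [_] := slab_expansion s01 kh mq (measurable_cutoff lam) iX.1 iE.
rewrite iX.2 -/k => bX.
have : 2 * k * I n (fun z => `|cutoff lam z| * (q z - d) ^+ 2 * decay (p + 1) z) <= 2 * k * (G * lam `^ (2 * s)).
  by rewrite ler_wpM2l // mulr_ge0.
move: bB bF bX split0 bT.
set b := I _ _; set x := I _ _; set x' := I _ _; set m := I _ _; set e := I _ _.
move=> bB bF bX split0 bT bK.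
have dT : `|d * (I0 P - m)| <= T * lam `^ (2 * s).
  by rewrite normrM -[leRHS]mul1r ler_pM.
have -> : lam * (h / 2 * moment2 lam) - d * I0 P =
  2^-1 * (- b - (x - x') - (x' - 2 * (lam * (h / 2 * moment2 lam) - d * m))) - d * (I0 P - m).
  have -> : b = - x by apply/eqP; rewrite -addr_eq0; apply/eqP.
  by field.
set L := lam `^ (2 * s) in bB bF bX bT bK dT *.
have bX' := le_trans bX bK.
move: bB bF bX' dT; rewrite !ler_norml; set u := x' - _; set u' := d * (_ - _).
have -> : 2 * k * (G * L) = 2 * (k * G * L) by ring.
have -> : (B + F + k * G + T) * L = B * L + F * L + k * G * L + T * L by ring.
have b0 : 0 <= B * L by rewrite mulr_ge0 ?powR_ge0.
have c0 : 0 <= F * L by rewrite mulr_ge0 ?powR_ge0.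
by move=> /andP[? ?] /andP[? ?] /andP[? ?] /andP[? ?]; apply/andP; split; lra.
Qed.

End Quadratic.

(** * The scale [sigma_half] *)

Section SigmaHalf.
Variable R : realType.

Local Notation G := (fun x : R => x ^+ 2 * `|ln x|).
Local Notation e0 := (expR (- 2^-1) : R).

Let G_near (x eps : R) : 0 < x -> 0 < eps ->
  exists2 d, 0 < d & forall y, `|x - y| < d -> `|G x - G y| < eps.
Proof.
move=> x0 e0; have cG : {for x, continuous G}.
  apply: continuousM; first exact: exprn_continuous.
  by apply: continuous_comp; [exact: continuous_ln|exact: norm_continuous].
have /cvgrPdist_lt /(_ _ e0) /nbhs_ballP[d d0 H] := cG.
by exists d => // y xy; exact: H.
Qed.

(** By continuity of [G] at the supremum: [G > t] there would persist to its left, where the set has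
    points, and [G < t] would persist to its right and produce larger members of the set. *)
Lemma sigma_halfP (t : R) : 0 < t < expR (- 1) / 2 ->
  [/\ 0 < sigma_half t, sigma_half t < 1, ln (sigma_half t) != 0 &
      sigma_half t ^+ 2 * `|ln (sigma_half t)| = t].
Proof.
move=> /andP[t0 t1]; set S := [set sg : R | 0 < sg <= e0 /\ G sg <= t].
have -> : sigma_half t = sup S by [].
have e1 : e0 < 1 by rewrite -expR0 ltr_expR oppr_lt0 invr_gt0.
have ee : e0 ^+ 2 = expR (- 1) by rewrite expr2 -expRD; congr expR; field.
have te : t <= e0.
  have := expR_gt0 (- 2^-1 : R); move: t1 e1; rewrite -ee; nra.
(* The bound of [ln (1 / t)] by [1 / t] gives [t ^ 2 |ln t| <= t]. *)
have St : S t.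
  split; first by rewrite t0.
  rewrite ler0_norm ?ln_le0 //; last by rewrite (le_trans te) // ltW.
  have := ln_sublinear (x := t^-1); rewrite invr_gt0 lnV ?posrE // => /(_ t0) h.
  by rewrite expr2 -mulrA ger_pMr // -ler_pdivlMl // mulr1 ltW.
have bS : has_ubound S by exists e0 => x [/andP[]].
have hS : has_sup S by split => //; exists t.
have up x : S x -> x <= sup S by exact: ub_le_sup.
have s0 : 0 < sup S by exact: lt_le_trans (up _ St).
have se : sup S <= e0 by apply: ge_sup; [exists t|move=> x [/andP[]]].
have s1 : sup S < 1 by exact: le_lt_trans se e1.
split => //; first by rewrite lt_eqF // ln_lt0 // s0.
have [gt|lt|//] := ltrgtP (G (sup S)) t; last first.
  have [|d d0 H] := G_near s0 (eps := G (sup S) - t); first by rewrite subr_gt0.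
  have [x Sx dx] := sup_adherent d0 hS.
  have := H x; rewrite ger0_norm ?subr_ge0 ?up //.
  have h : sup S - x < d by lra.
  move=> /(_ h) /ltr_normlW; case: Sx => _; lra.
have [|d d0 H] := G_near s0 (eps := t - G (sup S)); first by rewrite subr_gt0.
(* At the endpoint [G] equals [expR (- 1) / 2], which exceeds [t]; so there is room to the right of
   the supremum. *)
have ne : sup S < e0.
  rewrite lt_neqAle se andbT; apply/negP => /eqP E.
  move: gt; rewrite E expRK ltr0_norm ?oppr_lt0 ?invr_gt0 // opprK ee; lra.
pose x := Num.min e0 (sup S + d / 2).
have sx : sup S < x by rewrite lt_min ne ltrDl divr_gt0.
have xd : x <= sup S + d / 2 by rewrite ge_min lexx orbT.
have xe : x <= e0 by rewrite ge_min lexx.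
have := H x; rewrite distrC ger0_norm; last by rewrite subr_ge0 ltW.
have h : x - sup S < d by lra.
move=> /(_ h); rewrite distrC => /ltr_normlW Gx.
have : S x by split; [rewrite (lt_trans s0 sx)|lra].
by move=> /up; lra.
Qed.

End SigmaHalf.

(** * Boundaries of class C^3 *)

Section C3.
Variables (R : realType) (n : nat) (s : R) (P : 'rV[R]_n.+1 -> R) (CC CNs : R).
Hypotheses (n1 : (1 <= n)%N) (s01 : 0 < s < 1) (kh : kernel_hyp s P CC CNs).
Variables (E : set 'rV[R]_n.+1) (nu : 'rV[R]_n.+1 -> 'rV[R]_n.+1) (H : 'rV[R]_n.+1 -> R).
Hypotheses (oE : open E) (EC3 : C3_boundary E nu H).
Variable K : set 'rV[R]_n.+1.
Hypotheses (cK : compact K) (KE : K `<=` bdry E).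

Notation I m f := (Rintegral (muV R m) setT f).
Notation integ m f := ((muV R m).-integrable setT (EFin \o f)).
Local Notation p := (n.+1%:R + 2 * s).

(** Testing the form on the basis vectors bounds the diagonal. This makes [H] bounded on the compact
    set, as is needed when the truncated moment is replaced by the full one. *)
Lemma trace_bound (A : 'M[R]_n) (h C : R) : \tr A = n%:R * h / 2 ->
  (forall w, `|bil A w w| <= C * enorm w ^+ 2) -> `|h| <= 2 * C.
Proof.
move=> trA AC; have n0 : 0 < n%:R :> R by rewrite ltr0n.
have bA i : `|A i i| <= C.
  have := AC (evec R i); rewrite enorm_evec expr1n mulr1 /bil.
  rewrite (bigD1 i) //= [X in _ + X]big1; last by move=> j ji; rewrite mxE eqxx (negPf ji) mul0r.
  rewrite addr0 (bigD1 i) //= [X in _ + X]big1; last by move=> j ji; rewrite mxE eqxx (negPf ji) mul0r.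
  by rewrite mxE !eqxx addr0 !mul1r.
have : `|\tr A| <= n%:R * C.
  rewrite (le_trans (ler_norm_sum _ _ _)) // (le_trans (ler_sum _ (fun i _ => bA i))) //.
  by rewrite sumr_const card_ord mulr_natl.
rewrite trA -mulrA !normrM normfV (ger0_norm (ltW n0)) ler_pM2l // (@ger0_norm _ 2) //.
by lra.
Qed.

(* [H] is a multiple of the trace of the quadratic form of a chart, so that the expansion of the
   level-set equation is an equation for the displacement [v * t / lam] and for [H]. *)
Lemma curvature_equation : exists2 C, 0 <= C & forall t y v lam, K y ->
  0 < lam < 1 -> sigma_s s t = lam `^ (2 * s) -> admissible s P E nu t y v ->
  `|H y| <= C /\
  `|lam * (H y / 2 * moment2 P lam) - v * t / lam * I0 P| <= C * lam `^ (2 * s).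
Proof.
have [C [C1 HC]] := c3_sandwich n1 oE EC3 cK KE.
have n0 : n != 0%N by rewrite -lt0n.
have [C' C'0 HC'] := quadratic_core s01 kh oE n0 C1.
exists (2 * C + C'); first by lra.
move=> t y v lam Ky l01 st ad; have /andP[l0 l1] := l01.
have [M [A [MM nuy trA AC sw]]] := HC y Ky.
have [d1 eq0] := admissible_equation s01 kh oE l0 st MM nuy ad.
split; first by rewrite (le_trans (trace_bound trA AC)) // lerDl.
rewrite (le_trans (HC' M y A (H y) lam _ MM trA AC sw l01 d1 eq0)) //.
by rewrite ler_wpM2r ?powR_ge0 // lerDr; lra.
Qed.

Lemma moment2_intRN lam : 0 < lam ->
  intRN (fun z : 'rV[R]_n => (if enorm z < lam^-1 then 1 else 0) * enorm z ^+ 2 * P (extl z 0)) =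
  moment2 P lam.
Proof.
move=> l0; have s0 : 0 < s by case/andP: s01.
have np : n%:R < p by rewrite -natr1 -addrA ltrDl addr_gt0 // mulr_gt0.
rewrite (_ : (fun z => _) = (fun z => cutoff lam z * enorm z ^+ 2 * P0 P z)); last first.
  by apply/funext => z; rewrite (P0_extl kh).
apply: intRN_Rintegral; apply: (hintegrable_decay np (K := lam^-1 ^+ 2 * kdec n s CC)).
  apply: measurable_funM; last exact: measurable_P0 kh.
  by apply: measurable_funM; [exact: measurable_cutoff|apply: measurable_funX; exact: measurable_enorm].
move=> z; rewrite normrM (gtr0_norm (P0_gt0 kh _)) -mulrA; apply: ler_pM => //.
- exact: ltW (P0_gt0 kh _).
- rewrite /cutoff; case: ifP => zl; last by rewrite mul0r normr0 sqr_ge0.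
  rewrite mul1r ger0_norm ?sqr_ge0 //; apply: lerXn2r; rewrite ?nnegrE ?enorm_ge0 ?invr_ge0 ?(ltW l0) //.
  exact: ltW.
- exact: P0_le s01 kh _.
Qed.

(** Here [t = lam ^ 2 |ln lam|], so the displacement is [d = v lam |ln lam|]; dividing the equation
    by [lam |ln lam| I0] turns the error [C lam] into a multiple of [1 / |ln lam|]. *)
Lemma C3_half : s = 2^-1 -> exists C t0, 0 < t0 /\ forall t y v, 0 < t < t0 -> K y ->
  admissible s P E nu t y v -> `|v - bN P t * H y| <= C / `|ln (sigma_half t)|.
Proof.
move=> sh; have [C C0 HC] := curvature_equation; have i0 := I0_gt0 s01 kh.
exists (C / I0 P), (expR (- 1) / 2); split; first by rewrite divr_gt0 // expR_gt0.
move=> t y v t01 Ky ad; have [] := sigma_halfP t01.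
set lam := sigma_half t => l0 l1 ln0 lE.
have st : sigma_s s t = lam `^ (2 * s).
  by rewrite /sigma_s sh ltxx eqxx mulfV // powRr1 // ltW.
have l01 : 0 < lam < 1 by rewrite l0.
have [_] := HC t y v lam Ky l01 st ad.
rewrite sh mulfV // powRr1 ?(ltW l0) // -{1}lE.
rewrite /bN -/lam (moment2_intRN l0) (intRN_P0 s01 kh).
move: (moment2 P lam) (I0 P) i0 (H y) => J i i0 h.
have L0 : 0 < `|ln lam| by rewrite normr_gt0.
move: (`|ln lam|) L0 => L L0 le.
rewrite -(ler_pM2l (mulr_gt0 l0 (mulr_gt0 L0 i0))).
rewrite -{1}(gtr0_norm (mulr_gt0 l0 (mulr_gt0 L0 i0))) -normrM distrC in le *.
have -> : lam * (L * i) * (C / i / L) = C * lam by field; rewrite !gt_eqF.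
apply: le_trans le; rewrite le_eqVlt; apply/orP; left; apply/eqP; congr `|_|.
by field; rewrite !gt_eqF.
Qed.

Hypothesis s12 : 2^-1 < s.

(** For [s > 1/2] the density [|z| ^ 2 P] decays with exponent [p - 2 > n], and its tail beyond
    [1 / lam] is of order [lam ^ (2 s - 1)]. *)
Lemma moment2_limit : exists2 C, 0 <= C & forall lam, 0 < lam ->
  `|intRN (fun z : 'rV[R]_n => enorm z ^+ 2 * P (extl z 0)) - moment2 P lam| <= C * lam `^ (2 * s - 1).
Proof.
have np : n%:R < p - 2 by rewrite -natr1; move: (n%:R : R) s12 => x; lra.
have p20 : 0 <= p - 2 by rewrite (le_trans _ (ltW np)).
have [C C0 HC] := tail_bound np.
have [k kE] : {k | k = kdec n s CC} by exists (kdec n s CC).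
have k0 : 0 <= k by rewrite kE; exact: kdec_ge0 kh.
pose g (z : 'rV[R]_n) := enorm z ^+ 2 * P0 P z.
have mg : measurable_fun setT g.
  by apply: measurable_funM; [apply: measurable_funX; exact: measurable_enorm|exact: measurable_P0 kh].
have gle z : `|g z| <= k * decay (p - 2) z.
  rewrite normrM (ger0_norm (sqr_ge0 _)) (gtr0_norm (P0_gt0 kh _)).
  have z1 : 0 < 1 + enorm z by rewrite ltr_pwDl ?enorm_ge0.
  apply: (@le_trans _ _ (enorm z ^+ 2 * (k * decay p z))).
    by rewrite ler_wpM2l ?sqr_ge0 // kE (P0_le s01 kh).
  rewrite mulrCA ler_wpM2l // /decay opprB [2 - p]addrC powRD; last first.
    by rewrite (gt_eqF z1) implybT.
  rewrite powR_mulrn ?(ltW z1) // mulrC ler_wpM2l ?powR_ge0 //.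
  by apply: lerXn2r; rewrite ?nnegrE ?(ltW z1) ?enorm_ge0 // lerDr.
exists (k * C); first by rewrite mulr_ge0.
move=> lam l0.
rewrite (_ : (fun z => _) = g); last by apply/funext => z; rewrite /g (P0_extl kh).
have hg := hintegrable_decay np mg gle.
have ig := hintegrable_integrable hg; rewrite (intRN_Rintegral hg).
have ic := cutoff_moment2_integ s01 kh l0; rewrite /moment2 -RintB //.
set f := (fun z => _).
have [|||i3 b3] := HC k lam^-1 f _ k0; first by rewrite invr_gt0.
- by apply: measurable_funB => //; exact: integ_measurable ic.
- move=> z; rewrite /f /cutoff; case: ltP => zS; first by rewrite mul1r subrr normr0.
  rewrite !mul0r subr0 (le_trans (gle z)) // ler_wpM2l // decay_le_pow //.
  by apply: enorm_neq0; rewrite (lt_le_trans _ zS) // invr_gt0.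
apply: le_trans (le_normr_Rintegral _ i3) _ => //; apply: (le_trans b3).
rewrite powR_invE // ler_wpM2l ?mulr_ge0 //.
by rewrite (_ : - (n%:R - (p - 2)) = 2 * s - 1) // -natr1; ring.
Qed.

Lemma C3_above : exists C t0, 0 < t0 /\ forall t y v, 0 < t < t0 -> K y ->
  admissible s P E nu t y v -> `|v - cNs P * H y| <= C * t `^ ((2 * s - 1) / 2).
Proof.
have [C C0 HC] := curvature_equation; have i0 := I0_gt0 s01 kh.
have [T T0 HT] := moment2_limit.
(* With [lam = sqrt t] one has [d = lam v]. The equation divided by [lam] contributes [C], and
   replacing the truncated moment contributes [T |H| / 2] with [|H| <= C]. *)
exists ((C + T * C / 2) / I0 P), 1; split => // t y v /andP[t0 t1] Ky ad.
pose lam := t `^ 2^-1; have l0 : 0 < lam by rewrite powR_gt0.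
have l1 : lam < 1.
  have e : 1 `^ 2^-1 = 1 :> R by rewrite powR1.
  by rewrite /lam -[ltRHS]e gt0_ltr_powR ?invr_gt0 ?nnegrE // ltW.
have st : sigma_s s t = lam `^ (2 * s).
  rewrite /sigma_s ltNge (ltW s12) /= gt_eqF // -powRrM.
  by congr (_ `^ _); field.
have l01 : 0 < lam < 1 by rewrite l0.
have tl : t = lam * lam by rewrite -expr2 -powR_mulrn ?(ltW l0) // -powRrM mulVf // powRr1 // ltW.
have -> : t `^ ((2 * s - 1) / 2) = lam `^ (2 * s - 1) by rewrite -powRrM mulrC.
have [hC] := HC t y v lam Ky l01 st ad; have := HT lam l0.
have -> : lam `^ (2 * s) = lam * lam `^ (2 * s - 1).
  by rewrite -{2}(powRr1 (ltW l0)) -powRD ?(gt_eqF l0) ?implybT // addrC subrK.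
have -> : v * t / lam = lam * v by rewrite {1}tl; field; rewrite gt_eqF.
rewrite /cNs (intRN_P0 s01 kh); have := powR_ge0 lam (2 * s - 1).
move: (lam `^ (2 * s - 1)) (intRN _) (moment2 P lam) (I0 P) i0 (H y) hC => L J J' i i0 h hC L0 bJ b.
have {}b : `|h / 2 * J' - v * i| <= C * L.
  rewrite -(ler_pM2l l0) -{1}(gtr0_norm l0) -normrM (_ : lam * (C * L) = C * (lam * L)); last by ring.
  by apply: le_trans b; rewrite le_eqVlt; apply/orP; left; apply/eqP; congr `|_|; ring.
have b2 : `|h / 2 * (J - J')| <= T * C / 2 * L.
  have -> : T * C / 2 * L = C / 2 * (T * L) by ring.
  by rewrite normrM ler_pM // normrM ler_pM // gtr0_norm // invr_gt0.
have -> : v - J / (2 * i) * h = - ((h / 2 * J' - v * i) + h / 2 * (J - J')) / i.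
  by field; rewrite gt_eqF.
rewrite normrM normrN normfV (gtr0_norm i0) [leRHS]mulrAC ler_pM2r ?invr_gt0 // mulrDl.
by rewrite (le_trans (ler_normD _ _)) // lerD.
Qed.

End C3.

(** * Fractional mean curvature in a boundary frame *)

Section Nonlocal.
Variables (R : realType) (n : nat) (s : R) (E : set 'rV[R]_n.+1).
Hypotheses (s01 : 0 < s < 1) (oE : open E).

Notation I m f := (Rintegral (muV R m) setT f).
Notation integ m f := ((muV R m).-integrable setT (EFin \o f)).
Local Notation p := (n.+1%:R + 2 * s).

Definition tauB M y (w : 'rV[R]_n.+1) : R := tauF E M y w + theta (hd w).

Lemma tauB_abs M y w : `|tauB M y w| <= 2.
Proof.
by rewrite (le_trans (ler_normD _ _)) // theta_abs; have := tauF_abs E M y w; lra.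
Qed.

Lemma measurable_tauB (M : 'M[R]_n.+1) y : M *m M^T = 1%:M -> measurable_fun setT (tauB M y).
Proof.
move=> MM; apply: measurable_funD; first exact: measurable_tauF.
apply: measurable_theta; exact: measurable_hd.
Qed.

(** Stated for any [f] below the weight [|z| ^ (- p)] that vanishes with [tauB], because it serves
    the integrand of [H_s], the scaled kernel and their difference. The first bound is small for
    small [r], the second for large [r]. *)
Lemma singular_bound (e C : R) : 0 < C -> 1 + 2 * s < e -> exists2 C', 0 <= C' &
  forall (M : 'M[R]_n.+1) y (K : R) (f : 'rV[R]_n.+1 -> R), M *m M^T = 1%:M ->
  sandwich E y M (fun=> 0) e C -> 0 <= K -> measurable_fun setT f ->
  (forall z, z != 0 -> `|f z| <= K * enorm z `^ (- p)) -> (forall z, tauB M y z = 0 -> f z = 0) ->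
  (forall r, 0 < r <= C^-1 -> integ n.+1 (near r f) /\
     I n.+1 (fun w => `|near r f w|) <= K * C' * r `^ (e - (1 + 2 * s))) /\
  (forall r, 0 < r -> integ n.+1 (far r f) /\
     I n.+1 (fun w => `|far r f w|) <= K * C' * r `^ (- (2 * s))).
Proof.
move=> C0 se; have s0 : 0 < s by case/andP: s01.
have e0 : 0 < e by lra.
have p0 : 0 <= p by rewrite addr_ge0 // mulr_ge0 // ltW.
have ep : - n%:R < e - p by rewrite -natr1; move: (n%:R : R) => x; lra.
have np : n.+1%:R < p by rewrite ltrDl mulr_gt0.
have [C1 C10 H1] := slab_near e0 ep.
have [C2 C20 H2] := tail_bound np.
exists (C1 * C + C2) => [|M y K f MM sw K0 mf fK f0].
  by rewrite addr_ge0 // mulr_ge0 // ltW.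
have CC : 0 <= C1 * C by rewrite mulr_ge0 // ltW.
split=> [r /andP[r0 rC]|r r0].
  (* The weight has the default value [0] at the origin and cannot bound [f 0], so that value is
     entered by hand. *)
  pose psi (z : 'rV[R]_n) := if enorm z <= 0 then `|f 0| else K * enorm z `^ (- p).
  have mpsi : measurable_fun setT psi.
    apply: measurable_fun_ifT => //.
      by apply: measurable_fun_ler => //; exact: measurable_enorm.
    by apply: measurable_funM => //; exact: measurable_powR_enorm.
  have [||||i le] := H1 K C r (fun=> 0) psi (near r f) r0 (ltW C0) K0 (measurable_cst _) mpsi.
  - exact: measurable_near.
  - by move=> z; rewrite /psi; case: ifP => // _; rewrite mulr_ge0 ?powR_ge0.
  - by move=> z /enorm_gt0 z0; rewrite /psi; case: (leP (enorm z) 0) => // /(lt_le_trans z0); rewrite ltxx.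
  - move=> h z; rewrite /near subr0; case: ltP => wS; last first.
      rewrite normr0; case: ifP => // _; rewrite /psi; case: ifP => // _.
      by rewrite mulr_ge0 ?powR_ge0.
    have zw := enorm_consr_ge h z; rewrite (le_lt_trans zw wS) /=.
    case: (leP `|h| _) => hz; last first.
      rewrite f0 ?normr0 // /tauB -[hd _]subr0.
      apply: (sandwich_tau sw (w := consr h z)); first exact: lt_le_trans wS rC.
      by rewrite hd_consr tailr_consr subr0.
    rewrite /psi; case: (leP (enorm z) 0) => z0.
      have z00 : enorm z = 0 by apply/eqP; rewrite eq_le z0 enorm_ge0.
      move: hz; rewrite z00 powR0 ?gt_eqF // mulr0 normr_le0 => /eqP ->.
      by rewrite (enorm_eq0 z00) (_ : consr 0 0 = 0) //; apply/rowP => i; rewrite !mxE; case: unliftP => *; rewrite ?mxE.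
    rewrite (le_trans (fK _ _)) //; first by apply: enorm_neq0; exact: lt_le_trans zw.
    by rewrite ler_wpM2l // le0_ger_powR // oppr_le0.
  split => //; apply: (le_trans le).
  have -> : n%:R + (e - p) = e - (1 + 2 * s) by rewrite -natr1; ring.
  rewrite -[leRHS]mulrA -[leLHS]mulrA ler_wpM2l // mulrA ler_wpM2r ?powR_ge0 //.
  by rewrite lerDl.
have [||i le] := H2 K r (far r f) r0 K0.
- exact: measurable_far.
- move=> z; rewrite /far; case: (leP r) => wr; last by rewrite normr0.
  by apply: fK; apply: enorm_neq0; exact: lt_le_trans wr.
split => //; apply: (le_trans le).
have -> : n.+1%:R - p = - (2 * s) by ring.
by rewrite ler_wpM2r ?powR_ge0 // ler_wpM2l // lerDr.
Qed.

Lemma singular_integ (e C : R) (M : 'M[R]_n.+1) y (K : R) (f : 'rV[R]_n.+1 -> R) : 0 < C ->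
  1 + 2 * s < e -> M *m M^T = 1%:M -> sandwich E y M (fun=> 0) e C -> 0 <= K ->
  measurable_fun setT f -> (forall z, z != 0 -> `|f z| <= K * enorm z `^ (- p)) ->
  (forall z, tauB M y z = 0 -> f z = 0) -> integ n.+1 f.
Proof.
move=> C0 se MM sw K0 mf fK f0; have [C' _ H] := singular_bound C0 se.
have [Hn Hf] := H M y K f MM sw K0 mf fK f0.
have Ci : 0 < C^-1 by rewrite invr_gt0.
have r1 : 0 < C^-1 <= C^-1 by rewrite Ci lexx.
by have [] := Rint_near_far (Hn _ r1) (Hf _ Ci).
Qed.

Definition Bfrac M y (w : 'rV[R]_n.+1) : R := tauB M y w * enorm w `^ (- p).

Lemma measurable_Bfrac (M : 'M[R]_n.+1) y : M *m M^T = 1%:M -> measurable_fun setT (Bfrac M y).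
Proof.
by move=> MM; apply: measurable_funM; [exact: measurable_tauB|exact: measurable_powR_enorm].
Qed.

Lemma Bfrac_le M y z : `|Bfrac M y z| <= 2 * enorm z `^ (- p).
Proof. by rewrite normrM (ger0_norm (powR_ge0 _ _)) ler_wpM2r ?powR_ge0 // tauB_abs. Qed.

Definition truncHs (x : 'rV[R]_n.+1) (r : R) (z : 'rV[R]_n.+1) : R :=
  if enorm (z - x) < r then 0 else tauE E z / enorm (x - z) `^ p.

Lemma truncHs_hintegrable x r : 0 < r -> hintegrable (truncHs x r).
Proof.
move=> r0; have s0 : 0 < s by case/andP: s01.
have p0 : 0 <= p by rewrite addr_ge0 // mulr_ge0 // ltW.
have np : n.+1%:R < p by rewrite ltrDl mulr_gt0.
have md : measurable_fun setT (fun z : 'rV[R]_n.+1 => enorm (x - z)).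
  apply: (measurable_affine (@measurable_enorm R n.+1)).
  apply: (@enorm_continuous_map _ _ _ _ 1) => a b.
  by rewrite opprB addrC addrA subrK mul1r enorm_distC.
have x0 := enorm_ge0 x.
pose A := 1 + (1 + enorm x) / r.
have A0 : 0 < A by rewrite ltr_pwDl // divr_ge0 ?(ltW r0) //; lra.
apply: (hintegrable_decay np (K := A `^ p)) => [|z].
  apply: measurable_fun_ifT => //.
    apply: measurable_fun_ltr => //; rewrite (_ : (fun z => _) = (fun z => enorm (x - z))) //.
    by apply/funext => z; rewrite enorm_distC.
  rewrite (_ : (fun z => _) = (fun z => tauE E z * enorm (x - z) `^ (- p))).
    apply: measurable_funM; first exact: measurable_tauE.
    exact: (measurableT_comp (measurable_powR (- p)) md).
  by apply/funext => z; rewrite powRN.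
rewrite /truncHs enorm_distC; case: ltP => xz; first by rewrite normr0 mulr_ge0 ?powR_ge0.
rewrite -powRN normrM (ger0_norm (powR_ge0 _ _)) -[leRHS]mul1r ler_pM ?powR_ge0 ?tauE_abs //.
have d0 : 0 < enorm (x - z) := lt_le_trans r0 xz.
have z1 : 0 < 1 + enorm z by rewrite ltr_pwDl ?enorm_ge0.
have : 1 + enorm z <= A * enorm (x - z).
  have := enorm_triangle x (z - x); rewrite addrC subrK (enorm_distC z).
  have : 1 + enorm x <= (1 + enorm x) / r * enorm (x - z).
    by rewrite -mulrA ler_peMr ?addr_ge0 // ler_pdivlMl // mulr1.
  by rewrite /A mulrDl mul1r; lra.
rewrite /decay !powRN => h.
rewrite -[leLHS]mul1r ler_pdivrMr ?powR_gt0 // mulrAC ler_pdivlMr ?powR_gt0 // mul1r -powRM ?(ltW A0) ?(ltW d0) //.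
by rewrite ge0_ler_powR ?nnegrE ?mulr_ge0 ?(ltW A0) ?(ltW d0) ?(ltW z1).
Qed.

(** Outside a ball [theta (hd w) |w| ^ (- p)] is integrable and odd, so adding it leaves each
    truncated integral unchanged. With it the integrand becomes absolutely integrable at the origin,
    and the principal value is an ordinary integral. *)
Lemma HsE (e C : R) (M : 'M[R]_n.+1) y : 0 < C -> 1 + 2 * s < e -> M *m M^T = 1%:M ->
  sandwich E y M (fun=> 0) e C -> Hs s E y = I n.+1 (Bfrac M y).
Proof.
move=> C0 se MM sw; have s0 : 0 < s by case/andP: s01.
have [C' C'0 H] := singular_bound C0 se.
have B0 z : tauB M y z = 0 -> Bfrac M y z = 0 by rewrite /Bfrac => ->; rewrite mul0r.
have mB := measurable_Bfrac y MM.
have [Hn Hf] := H M y 2 _ MM sw (ler0n _ 2) mB (fun z _ => Bfrac_le M y z) B0.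
have bound r : 0 < r <= C^-1 ->
    `|intRN (truncHs y r) - I n.+1 (Bfrac M y)| <= 2 * C' * r `^ (e - (1 + 2 * s)).
  move=> rC; have /andP[r0 _] := rC.
  have [in_ bn] := Hn r rC; have [if_ _] := Hf r r0.
  have hi := hintegrable_integrable (truncHs_hintegrable y r0).
  rewrite (intRN_Rintegral (truncHs_hintegrable y r0)).
  have [i1 ->] := Rint_frame y MM ltr01 hi.
  pose g (w : 'rV[R]_n.+1) := far r (fun w => enorm w `^ (- p)) w.
  have ig : integ n.+1 g.
    have np : n.+1%:R < p by rewrite ltrDl mulr_gt0.
    have [C2 _ H2] := tail_bound np.
    have [||//] := H2 1 r g r0 ler01.
    - by apply: measurable_far; exact: measurable_powR_enorm.
    - move=> w; rewrite /g /far; case: (leP r) => wr; last by rewrite normr0.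
      by rewrite mul1r ger0_norm ?powR_ge0.
  have ge w : g (- w) = g w by rewrite /g /far enormN.
  have [it zt] := Rint_theta_even ig ge.
  have e1 : I n.+1 (fun w => 1 ^+ n.+1 * truncHs y r (y + frame M (1 *: w))) =
      I n.+1 (far r (Bfrac M y)).
    transitivity (I n.+1 (fun w => far r (Bfrac M y) w - g w * theta (hd w))).
      apply: eq_Rint => w; rewrite expr1n mul1r scale1r /truncHs /far /g /far.
      rewrite opprD addrA subrr sub0r addrAC subrr add0r enormN !enorm_frame //.
      case: (leP r) => wr; last by rewrite mul0r subr0.
      by rewrite /Bfrac /tauB powRN /tauF; ring.
    by rewrite (RintB if_ it) zt subr0.
  rewrite e1.
  have -> : I n.+1 (Bfrac M y) = I n.+1 (near r (Bfrac M y)) + I n.+1 (far r (Bfrac M y)).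
    by rewrite -RintD //; apply: eq_Rint => w; exact: near_far.
  rewrite distrC addrK; apply: le_trans bn.
  exact: le_normr_Rintegral.
rewrite /Hs -/(truncHs y); apply/cvg_lim => //.
apply/cvgrPdist_le => eps eps0.
have a0 : 0 < e - (1 + 2 * s) by lra.
(* The solution of [(2 C' + 1) r1 ^ (e - (1 + 2 s)) = eps]. *)
pose r1 := (eps / (2 * C' + 1)) `^ (e - (1 + 2 * s))^-1.
have k0 : 0 < 2 * C' + 1 by lra.
have r10 : 0 < r1 by rewrite powR_gt0 // divr_gt0.
near=> r; rewrite distrC.
have r0 : 0 < r by near: r; exact: nbhs_right_gt.
have rC : r <= C^-1 by near: r; apply: nbhs_right_le; rewrite invr_gt0.
have rr : r <= r1 by near: r; exact: nbhs_right_le.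
apply: le_trans (bound r _) _; first by rewrite r0.
apply: (@le_trans _ _ ((2 * C' + 1) * r1 `^ (e - (1 + 2 * s)))).
  apply: ler_pM; rewrite ?mulr_ge0 ?powR_ge0 //; first by rewrite lerDl.
  by rewrite ge0_ler_powR ?nnegrE ?(ltW a0) ?(ltW r0) ?(ltW r10).
rewrite -powRrM mulVf ?gt_eqF // powRr1 ?divr_ge0 ?(ltW eps0) ?(ltW k0) //.
by rewrite mulrC divfK // gt_eqF.
Unshelve. all: by end_near.
Qed.

End Nonlocal.

(** * Boundaries of class C^{1,beta} *)

Section NonlocalLimit.
Variables (R : realType) (n : nat) (s : R) (P : 'rV[R]_n.+1 -> R) (CC CNs : R).
Hypotheses (s01 : 0 < s < 1) (kh : kernel_hyp s P CC CNs).
Variable E : set 'rV[R]_n.+1.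
Hypothesis oE : open E.

Notation I m f := (Rintegral (muV R m) setT f).
Notation integ m f := ((muV R m).-integrable setT (EFin \o f)).
Local Notation p := (n.+1%:R + 2 * s).

Lemma shell_compact (m : nat) (r S : R) :
  compact [set z : 'rV[R]_m.+1 | r <= enorm z <= S].
Proof.
apply: bounded_closed_compact.
  exists S; split; first exact: num_real.
  move=> x Sx z /= /andP[_ zS]; rewrite (_ : `|z| = mx_norm z) //.
  have [->|/mx_norm_neq0 [ij ->]] := eqVneq (mx_norm z) 0.
    by rewrite (le_trans _ (ltW Sx)) // (le_trans _ zS) // enorm_ge0.
  by rewrite ord1 (le_trans (ler_abs_coord_enorm _ _)) // (le_trans zS) // ltW.
have -> : [set z : 'rV[R]_m.+1 | r <= enorm z <= S] =
    (@enorm R m.+1) @^-1` [set x | r <= x] `&` (@enorm R m.+1) @^-1` [set x | x <= S].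
  by apply/seteqP; split => z /=; [case/andP|move=> [-> ->]].
apply: closedI; apply: preimage_closed => [z _|]; try exact: continuous_enorm.
  exact: closed_ge.
exact: closed_le.
Qed.

(* The kernel at time [lam `^ (2 * s)], divided by that time. *)
Definition scaledK (lam : R) (z : 'rV[R]_n.+1) : R := lam `^ (- p) * P (lam^-1 *: z).

Lemma measurable_scaledK lam : measurable_fun setT (scaledK lam).
Proof.
apply: measurable_funM => //; apply: (measurable_affine (kernel_measurable kh)).
exact: continuous_scaler.
Qed.

Lemma scaledK_le lam z : 0 < lam -> z != 0 -> `|scaledK lam z| <= kdec n s CC * enorm z `^ (- p).
Proof.
move=> l0 z0; have s0 : 0 < s by case/andP: s01.
have p0 : 0 <= p by rewrite addr_ge0 // mulr_ge0 // ltW.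
rewrite /scaledK normrM (ger0_norm (powR_ge0 _ _)) (gtr0_norm (kernel_gt0 kh _)).
have lz0 : lam^-1 *: z != 0 by rewrite scaler_eq0 negb_or invr_eq0 gt_eqF.
apply: (@le_trans _ _ (lam `^ (- p) * (kdec n s CC * enorm (lam^-1 *: z) `^ (- p)))).
  rewrite ler_wpM2l ?powR_ge0 // (le_trans (kernel_le s01 kh _)) // ler_wpM2l ?(kdec_ge0 kh) //.
  exact: decay_le_pow.
rewrite mulrCA ler_wpM2l ?(kdec_ge0 kh) // -powRM ?(ltW l0) ?enorm_ge0 //.
by rewrite enormZ ger0_norm ?invr_ge0 ?(ltW l0) // mulVKf ?gt_eqF.
Qed.

Lemma scaledK_limit (r S eps : R) : 0 < r -> 0 < eps -> exists2 l0, 0 < l0 &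
  forall lam z, 0 < lam < l0 -> r <= enorm z <= S ->
  `|scaledK lam z - CNs * enorm z `^ (- p)| <= eps.
Proof.
move=> r0 eps0; have s0 : 0 < s by case/andP: s01.
have [_ _ _ _ H] := kh.
have [|d d0 Hd] := H _ (@shell_compact n r S) _ eps eps0.
  by move=> z /= /andP[rz _] z0; move: rz; rewrite z0 enorm0 leNgt r0.
exists (d `^ (2 * s)^-1); first by rewrite powR_gt0.
move=> lam z /andP[l0 ld] zS; have := Hd (lam `^ (2 * s)) z.
have s20 : 0 < 2 * s by rewrite mulr_gt0.
have ld' : lam `^ (2 * s) < (d `^ (2 * s)^-1) `^ (2 * s).
  by rewrite gt0_ltr_powR ?nnegrE ?powR_ge0 ?(ltW l0).
move: ld'; rewrite -powRrM mulVf ?gt_eqF // powRr1 ?(ltW d0) // => ->.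
rewrite powR_gt0 //= => /(_ isT zS); rewrite Kern_scale // mulrA.
have -> : (lam `^ (2 * s))^-1 * lam ^- n.+1 = lam `^ (- p).
  rewrite -powR_mulrn ?(ltW l0) // -invfM -powRD ?(gt_eqF l0) ?implybT //.
  by rewrite powRN addrC.
by rewrite /scaledK [enorm z `^ (- _)]powRN.
Qed.

Lemma Rint_scaledK lam (M : 'M[R]_n.+1) y : 0 < lam ->
  integ n.+1 (fun z => scaledK lam z * tauB E M y z) ->
  lam `^ (- (2 * s)) * I n.+1 (fun w => P w * bad E M y lam (fun=> 0) w) =
  I n.+1 (fun z => scaledK lam z * tauB E M y z).
Proof.
move=> l0 hi; have [i2 e] := Rint_scale l0 hi.
have e2 : (fun w => P w * bad E M y lam (fun=> 0) w) =
    (fun w => lam `^ p * (scaledK lam (lam *: w) * tauB E M y (lam *: w))).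
  apply/funext => w; rewrite /scaledK scalerA mulVf ?gt_eqF // scale1r.
  rewrite /bad /tauB hdZ thetaZ // subr0 !mulrA -powRD ?(gt_eqF l0) ?implybT //.
  by rewrite subrr powRr0 mul1r.
rewrite e2 (RintZ _ i2) e mulrA mulrA -powRD ?(gt_eqF l0) ?implybT //.
rewrite addrCA addNr addr0 powR_mulrn ?(ltW l0) // mulfV ?mul1r //.
by rewrite expf_neq0 // gt_eqF.
Qed.

(** The difference of the two integrands is at most [L |z| ^ (- p)] for every [lam]. Inside a small
    ball and outside a large one this alone makes the integral small; on the shell between them the
    convergence of the kernel is uniform. Each region is allowed [eps / 3], and the radii depend on
    the sandwich constant but not on [y]. *)
Lemma nonlocal_limit (e C : R) : 0 < C -> 1 + 2 * s < e -> forall eps, 0 < eps ->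
  exists2 l0, 0 < l0 & forall (M : 'M[R]_n.+1) y lam, M *m M^T = 1%:M ->
  sandwich E y M (fun=> 0) e C -> 0 < lam < l0 ->
  `|lam `^ (- (2 * s)) * I n.+1 (fun w => P w * bad E M y lam (fun=> 0) w) - CNs * Hs s E y|
    <= eps.
Proof.
move=> C0 se eps eps0; have s0 : 0 < s by case/andP: s01.
have s20 : 0 < 2 * s by rewrite mulr_gt0.
have a0 : 0 < e - (1 + 2 * s) by lra.
have CN0 : 0 < CNs by case: kh => -[].
have [k kE] : {k | k = kdec n s CC} by exists (kdec n s CC).
have k0 : 0 <= k by rewrite kE; exact: kdec_ge0 kh.
have [C1 C10 H1] := singular_bound E s01 C0 se.
have [|C2 C20 H2] := @near_bound R n.+1 0; first by rewrite oppr_lt0.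
pose L := 2 * (k + CNs).
have L0 : 0 < L by rewrite /L; lra.
have [B BE] : {B | B = L * C1 + 1} by exists (L * C1 + 1).
have LC : 0 <= L * C1 by rewrite mulr_ge0 // ltW.
have B0 : 0 < B by lra.
have eb : 0 < eps / 3 / B by rewrite !divr_gt0.
pose r := Num.min C^-1 ((eps / 3 / B) `^ (e - (1 + 2 * s))^-1).
have r0 : 0 < r by rewrite lt_min invr_gt0 C0 powR_gt0.
have rC : 0 < r <= C^-1 by rewrite r0 ge_min lexx.
have rb : L * C1 * r `^ (e - (1 + 2 * s)) <= eps / 3.
  apply: (@le_trans _ _ (B * (eps / 3 / B))); last by rewrite mulrC divfK ?gt_eqF.
  apply: ler_pM; rewrite ?powR_ge0 ?BE ?lerDl //.
  rewrite -BE (@le_trans _ _ (((eps / 3 / B) `^ (e - (1 + 2 * s))^-1) `^ (e - (1 + 2 * s)))) //.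
    by rewrite ge0_ler_powR ?nnegrE ?powR_ge0 ?(ltW a0) ?(ltW r0) // ge_min lexx orbT.
  by rewrite -powRrM mulVf ?gt_eqF // powRr1 // ltW.
(* The solution of [B S ^ (- 2 s) = eps / 3]; [r] was chosen likewise for the inner ball, within the
   range of the sandwich. *)
pose S := (eps / 3 / B) `^ (- (2 * s)^-1).
have S0 : 0 < S by rewrite powR_gt0.
have Sb : L * C1 * S `^ (- (2 * s)) <= eps / 3.
  apply: (@le_trans _ _ (B * (eps / 3 / B))); last by rewrite mulrC divfK ?gt_eqF.
  apply: ler_pM; rewrite ?powR_ge0 ?BE ?lerDl //.
  by rewrite -BE -powRrM mulrNN mulVf ?gt_eqF // powRr1 // ltW.
pose D := C2 * S `^ (n.+1%:R + 0) + 1.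
have D0 : 0 < D by rewrite ltr_wpDl // mulr_ge0 ?powR_ge0.
have d0 : 0 < eps / 3 / D / 2 by rewrite !divr_gt0.
have [l0 l00 Hl] := scaledK_limit S r0 d0.
exists l0 => // M y lam MM sw ll; have /andP[lam0 _] := ll.
pose f z := scaledK lam z * tauB E M y z.
pose g z := CNs * Bfrac s E M y z.
have mf : measurable_fun setT f.
  by apply: measurable_funM; [exact: measurable_scaledK|exact: measurable_tauB].
have mg : measurable_fun setT g.
  by apply: measurable_funM => //; exact: measurable_Bfrac.
have f0 z : tauB E M y z = 0 -> f z = 0 by rewrite /f => ->; rewrite mulr0.
have g0 z : tauB E M y z = 0 -> g z = 0 by rewrite /g /Bfrac => ->; rewrite mul0r mulr0.
have fle z : z != 0 -> `|f z| <= 2 * k * enorm z `^ (- p).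
  move=> z0; rewrite normrM mulrC -mulrA ler_pM ?(tauB_abs E) // kE.
  exact: scaledK_le.
have gle z : z != 0 -> `|g z| <= 2 * CNs * enorm z `^ (- p).
  by move=> z0; rewrite normrM (gtr0_norm CN0) [leRHS]mulrAC [leRHS]mulrC ler_wpM2l ?(ltW CN0) // Bfrac_le.
have i1 : integ n.+1 f.
  have K0 : 0 <= 2 * k by rewrite mulr_ge0.
  exact: (singular_integ s01 C0 se MM sw K0 mf fle f0).
have i2 : integ n.+1 (Bfrac s E M y).
  apply: (singular_integ s01 C0 se MM sw _ (measurable_Bfrac s oE y MM)).
  - exact: (ler0n _ 2).
  - by move=> z _; exact: Bfrac_le.
  - by move=> z; rewrite /Bfrac => ->; rewrite mul0r.
rewrite (Rint_scaledK lam0 i1) (HsE s01 oE C0 se MM sw) -(RintZ _ i2).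
have i3 : integ n.+1 g by exact: integZ.
rewrite -(RintB i1 i3); pose h z := f z - g z.
have mh : measurable_fun setT h by exact: measurable_funB.
have h0 z : tauB E M y z = 0 -> h z = 0 by move=> t0; rewrite /h f0 // g0 // subrr.
have hle z : z != 0 -> `|h z| <= L * enorm z `^ (- p).
  move=> z0; rewrite (le_trans (ler_normB _ _)) // /L mulrDr mulrDl lerD ?fle //.
  exact: gle.
have [Hn _] := H1 M y L h MM sw (ltW L0) mh hle h0.
have [j1 b1] := Hn r rC.
(* With exponent [0] the weight is constantly [1], so [near_bound] is a volume bound for the ball of
   radius [S], and [D] exceeds that bound. *)
have [|||j3 b3] := H2 (eps / 3 / D) S (near S (far r h)) S0.
- by rewrite !divr_ge0 // ltW.
- by apply: measurable_near; exact: measurable_far.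
- move=> z; rewrite /near; case: ltP => zS; last by rewrite normr0.
  rewrite powRr0 mulr1 /far; case: (leP r) => rz; last by rewrite normr0 ltW // !divr_gt0.
  rewrite /h /f /g /Bfrac [tauB _ _ _ _ * _]mulrC mulrA -mulrBl normrM.
  apply: (@le_trans _ _ (eps / 3 / D / 2 * 2)); last by rewrite divfK.
  by apply: ler_pM => //; [apply: Hl => //; rewrite rz ltW|exact: (tauB_abs E)].
have b3' : I n.+1 (fun z => `|near S (far r h) z|) <= eps / 3.
  apply: (le_trans b3); rewrite -mulrA; apply: (@le_trans _ _ (eps / 3 / D * D)).
    by rewrite ler_wpM2l ?lerDl // !divr_ge0 // ltW.
  by rewrite divfK // gt_eqF.
have hle' z : z != 0 -> `|far r h z| <= L * enorm z `^ (- p).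
  move=> z0; rewrite /far; case: ifP => _; first exact: hle.
  by rewrite normr0 mulr_ge0 ?powR_ge0 // ltW.
have h0' z : tauB E M y z = 0 -> far r h z = 0.
  by move=> t0; rewrite /far h0 // if_same.
have [_ Hf] := H1 M y L (far r h) MM sw (ltW L0) (measurable_far r mh) hle' h0'.
have [j2 b2] := Hf S S0.
have bf := Rint_near_far (conj j3 b3') (conj j2 (le_trans b2 Sb)).
have hE : h = fun z => near r h z + far r h z by apply/funext => z; exact: near_far.
have -> : I n.+1 h = I n.+1 (near r h) + I n.+1 (far r h) by rewrite {1}hE RintD //; exact: bf.1.
rewrite (le_trans (ler_normD _ _)) // [leRHS](_ : eps = eps / 3 + (eps / 3 + eps / 3)); last by field.
rewrite lerD ?bf.2 // (le_trans _ rb) // (le_trans _ b1) //.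
exact: le_normr_Rintegral.
Qed.

End NonlocalLimit.

(** * Solving for the displacement when [s < 1/2] *)

Section C1beta.
Variables (R : realType) (n : nat) (s : R) (P : 'rV[R]_n.+1 -> R) (CC CNs : R).
Hypotheses (s01 : 0 < s < 1) (kh : kernel_hyp s P CC CNs).
Variables (E : set 'rV[R]_n.+1) (nu : 'rV[R]_n.+1 -> 'rV[R]_n.+1) (be : R).
Hypotheses (oE : open E) (sbe : 2 * s < be) (EC1 : C1beta_boundary E be nu).
Variable K : set 'rV[R]_n.+1.
Hypotheses (cK : compact K) (KE : K `<=` bdry E).

Notation I m f := (Rintegral (muV R m) setT f).
Notation integ m f := ((muV R m).-integrable setT (EFin \o f)).
Local Notation p := (n.+1%:R + 2 * s).

(** Recentring [Ash P d] at the boundary point costs [|d| lam ^ (2 s)] by the gradient bound, and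
    freezing [P] costs [d ^ 2]. By [apriori] with [b = 2 s] both are of order [lam ^ (4 s)], one
    factor [lam ^ (2 s)] better than the terms that remain. *)
Lemma displacement_equation (e C : R) : 0 < C -> 1 + 2 * s < e -> exists2 C', 0 <= C' &
  forall (M : 'M[R]_n.+1) y lam d, M *m M^T = 1%:M -> sandwich E y M (fun=> 0) e C ->
  0 < lam -> `|d| <= 1 -> I n.+1 (fun w => Ash P d w * tauF E M y (lam *: w)) = 0 ->
  `|I n.+1 (fun w => P w * bad E M y lam (fun=> 0) w) - 2 * d * I0 P|
    <= C' * (lam `^ (2 * s) * lam `^ (2 * s)).
Proof.
move=> C0 se; have s0 : 0 < s by case/andP: s01.
have s20 : 0 < 2 * s by rewrite mulr_gt0.
have p0 : 0 <= p by rewrite addr_ge0 // ltW.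
have bs : 0 < 2 * s <= 2 * s by rewrite s20 lexx.
have [D D0 HD] := apriori s01 kh oE C0 bs se.
have [B B0 HB] := bad_integral_bound E C0 s20 se.
have np1 : n%:R < p + 1 by rewrite -natr1; move: (n%:R : R) => x; lra.
have id := decay_integrable np1.
have [D1 D1E] : {D1 | D1 = I n (@decay R (p + 1) n)} by exists (I n (@decay R (p + 1) n)).
have D10 : 0 <= D1 by rewrite D1E; apply: Rintegral_ge0 => z _; exact: decay_ge0.
have [kl klE] : {k | k = klip n s CC} by exists (klip n s CC).
have kl0 : 0 <= kl by rewrite klE; exact: klip_ge0 kh.
pose k := 2 * (kl * 2 `^ (p + 1)).
have k0 : 0 <= k by rewrite !mulr_ge0 ?powR_ge0.
exists (k * D * B + 2 * kl * D1 * D ^+ 2).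
  by rewrite addr_ge0 ?mulr_ge0 ?sqr_ge0.
move=> M y lam d MM sw l0 d1 eq0.
have dD := HD M y lam d MM sw l0 d1 eq0.
have mq : measurable_fun setT ((fun=> 0) : 'rV[R]_n -> R) by exact: measurable_cst.
have := equation_split s01 kh oE MM d1 mq eq0.
have P_Ash w : P w = Ash P 0 w.
  rewrite /Ash (_ : consr 0 0 = 0) ?sub0r ?(kernel_opp kh) //.
  by apply/rowP => i; rewrite !mxE; case: unliftP => *; rewrite ?mxE.
have mb := measurable_bad oE y lam MM mq.
have ib a : `|a| <= 1 -> integ n.+1 (fun w => Ash P a w * bad E M y lam (fun=> 0) w).
  by move=> a1; apply: (Ash_theta_int s01 kh a1 mb); exact: bad_abs.
have a1 : `|0 : R| <= 1 by rewrite normr0.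
have [i0 i1] := (ib 0 a1, ib d d1).
have fe : (fun w => Ash P d w * bad E M y lam (fun=> 0) w - Ash P 0 w * bad E M y lam (fun=> 0) w)
   = (fun w => (Ash P d w - P w) * bad E M y lam (fun=> 0) w).
  by apply/funext => w; rewrite P_Ash mulrBl.
have q0 : (fun=> 0) = (fun z : 'rV[R]_n => lam^-1 * 0) by apply/funext => z; rewrite mulr0.
have bX : `|I n.+1 (fun w => Ash P d w * bad E M y lam (fun=> 0) w) -
    I n.+1 (fun w => P w * bad E M y lam (fun=> 0) w)| <= k * `|d| * B * lam `^ (2 * s).
  rewrite (_ : (fun w => P w * _) = (fun w => Ash P 0 w * bad E M y lam (fun=> 0) w)); last first.
    by apply/funext => w; rewrite P_Ash.
  rewrite -(RintB i1 i0) fe.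
  apply: (HB M y (fun=> 0) lam (k * `|d|) _ MM mq sw l0).
  - by rewrite mulr_ge0.
  - by rewrite -fe; exact: integ_measurable (integB i1 i0).
  - move=> w; rewrite normrM mulrC.
    rewrite (_ : k * `|d| * decay p w = 2 * (kl * (2 `^ (p + 1) * decay p w) * `|d|)); last first.
      by rewrite /k; ring.
    rewrite ler_pM ?bad_abs //.
    have := kernel_lip1 s01 kh (- w) (w := consr d 0); rewrite enorm_consrh0 => /(_ d1).
    by rewrite (kernel_opp kh) /decay enormN -klE [- w + _]addrC.
  - by move=> w; rewrite -q0 => ->; rewrite mulr0.
have iom : integ n (fun z => 1 * (0 - d) * P0 P z).
  by have := integZ (1 * (0 - d)) (P0_integ s01 kh).
have ide : integ n (fun z : 'rV[R]_n => `|1 : R| * (0 - d) ^+ 2 * decay (p + 1) z).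
  by have := integZ (`|1 : R| * (0 - d) ^+ 2) id.
have [_] := slab_expansion s01 kh (d := d) mq (measurable_cst (1 : R)) iom ide.
rewrite /= (RintZ _ (P0_integ s01 kh)) (RintZ _ id) -D1E -klE normr1 !mul1r sub0r sqrrN.
rewrite (@eq_Rint _ _ _ (fun w => Ash P d w * (theta (hd w - d) - theta (hd w - 0)))) => [|w]; last by rewrite /= mulr1.
rewrite -/(I0 P).
move: bX; rewrite /bad.
set X := I _ _; set X' := I _ _; set Y := I _ _ => bX bY XY.
have -> : X' - 2 * d * I0 P = - (X - X') - (Y - 2 * (- d * I0 P)).
  have -> : X = - Y by apply/eqP; rewrite -addr_eq0; apply/eqP.
  by ring.
set L := lam `^ (2 * s) in dD bX *.
have L0 : 0 <= L by exact: powR_ge0.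
rewrite (le_trans (ler_normB _ _)) // normrN.
rewrite (_ : (_ + _) * (L * L) = k * (D * L) * B * L + 2 * kl * ((D * L) ^+ 2 * D1)); last by ring.
rewrite lerD //.
  apply: (le_trans bX); rewrite ler_wpM2r // ler_wpM2r // ler_wpM2l //.
apply: (le_trans bY); rewrite ler_wpM2l ?mulr_ge0 // ler_wpM2r //.
by rewrite -(real_normK (num_real d)) lerXn2r ?nnegrE ?mulr_ge0.
Qed.

Lemma C1beta_below : s < 2^-1 -> forall eps, 0 < eps -> exists2 t0, 0 < t0 &
  forall t y v, 0 < t < t0 -> K y -> admissible s P E nu t y v ->
  `|v - aNs s P CNs * Hs s E y| <= eps.
Proof.
move=> s12 eps eps0; have s0 : 0 < s by case/andP: s01.
have s20 : 0 < 2 * s by rewrite mulr_gt0.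
have be0 : 0 < be by exact: lt_trans sbe.
have se : 1 + 2 * s < 1 + be by rewrite ltrD2l.
have [C [C1 HC]] := c1beta_sandwich oE be0 EC1 cK KE.
have C0 : 0 < C by exact: lt_le_trans C1.
have [D D0 HD] := displacement_equation C0 se.
have i0 := I0_gt0 s01 kh.
have ei : 0 < eps * I0 P by rewrite mulr_gt0.
have [l0 l00 Hl] := nonlocal_limit s01 kh oE C0 se ei.
(* The bound to be imposed on [lam ^ (2 s)]. Since [d = v lam ^ (2 s)], the equation is divided by
   that power; its error and that of [nonlocal_limit] are then at most [eps I0] each, and the final
   division by [2 I0] leaves [eps]. *)
pose q := eps * I0 P / (D + 1).
have D1 : 0 < D + 1 by rewrite ltr_wpDl.
have q0 : 0 < q by rewrite divr_gt0.
pose l1 := Num.min l0 (q `^ (2 * s)^-1).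
have l10 : 0 < l1 by rewrite lt_min l00 powR_gt0.
have u0 : 0 < 1 + 2 * s by rewrite addr_gt0.
exists (l1 `^ (1 + 2 * s)); first by rewrite powR_gt0.
move=> t y v /andP[t0 tl] Ky ad.
pose lam := t `^ (1 + 2 * s)^-1.
have lam0 : 0 < lam by rewrite powR_gt0.
have tE : t = lam * lam `^ (2 * s).
  rewrite -{1}[lam](powRr1 (ltW lam0)) -powRD ?(gt_eqF lam0) ?implybT //.
  by rewrite -powRrM mulVf ?gt_eqF // powRr1 // ltW.
have laml : lam < l1.
  have := gt0_ltr_powR (r := (1 + 2 * s)^-1) _ _ _ tl.
  rewrite invr_gt0 !nnegrE (ltW t0) powR_ge0 => /(_ u0 isT isT).
  by rewrite -powRrM mulfV ?gt_eqF // (powRr1 (ltW l10)).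
have st : sigma_s s t = lam `^ (2 * s).
  by rewrite /sigma_s s12 -powRrM mulrC.
have [M [MM nuy sw]] := HC y Ky.
have [d1 eq0] := admissible_equation s01 kh oE lam0 st MM nuy ad.
have ll : 0 < lam < l0 by rewrite lam0 (lt_le_trans laml) // ge_min lexx.
have := Hl M y lam MM sw ll; have := HD M y lam _ MM sw lam0 d1 eq0.
have Lq : lam `^ (2 * s) <= q.
  have := ge0_ler_powR (ltW s20) (x := lam) (y := q `^ (2 * s)^-1).
  rewrite !nnegrE !powR_ge0 => /(_ isT isT).
  rewrite -powRrM mulVf ?gt_eqF // (powRr1 (ltW q0)); apply.
  by rewrite (le_trans (ltW laml)) // ge_min lexx orbT.
have -> : v * t / lam = v * lam `^ (2 * s).
  by rewrite {1}tE; field; rewrite gt_eqF.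
rewrite powRN /aNs (intRN_P0 s01 kh).
have : 0 < lam `^ (2 * s) by rewrite powR_gt0.
move: (lam `^ (2 * s)) Lq (I n.+1 _) => L Lq X L0 b1 b2.
have b1' : `|L^-1 * X - 2 * v * I0 P| <= D * L.
  rewrite -(ler_pM2l L0) -{1}(gtr0_norm L0) -normrM [leRHS]mulrCA.
  apply: le_trans b1; rewrite le_eqVlt; apply/orP; left; apply/eqP; congr `|_|.
  by field; rewrite gt_eqF.
have bD : D * L <= eps * I0 P.
  apply: (@le_trans _ _ ((D + 1) * q)); last by rewrite mulrC divfK ?gt_eqF.
  by rewrite ler_pM ?(ltW L0) // lerDl.
have -> : v - CNs / (2 * I0 P) * Hs s E y =
    ((L^-1 * X - CNs * Hs s E y) - (L^-1 * X - 2 * v * I0 P)) / (2 * I0 P).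
  by field; rewrite !gt_eqF.
have i2 : 0 < 2 * I0 P by rewrite mulr_gt0.
rewrite normrM normfV (gtr0_norm i2) ler_pdivrMr //.
rewrite (le_trans (ler_normB _ _)) //; have := le_trans b1' bD; lra.
Qed.

End C1beta.

Unset Implicit Arguments.
Set Strict Implicit.
Set Printing Implicit Defensive.

(* N = n.+1 is the dimension; P is P_s, CC = \mathcal C_{N,s}, CNs = C_{N,s}. *)
Theorem theorem1p1 (R : realType) (n : nat) (s : R) (P : 'rV[R]_n.+1 -> R)
  (CC CNs : R) (E : set 'rV[R]_n.+1)
  (nu : 'rV[R]_n.+1 -> 'rV[R]_n.+1) (H : 'rV[R]_n.+1 -> R) :
  (1 <= n)%N -> 0 < s < 1 ->
  kernel_hyp s P CC CNs ->
  open E ->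
  (s < 2^-1 -> exists2 beta, 2 * s < beta & C1beta_boundary E beta nu) ->
  (2^-1 <= s -> C3_boundary E nu H) ->
  forall K : set 'rV[R]_n.+1, compact K -> K `<=` bdry E ->
  [/\ (s < 2^-1 -> forall eps, 0 < eps -> exists2 t0, 0 < t0 &
         forall t y v, 0 < t < t0 -> K y -> admissible s P E nu t y v ->
           `|v - aNs s P CNs * Hs s E y| <= eps),
      (s = 2^-1 -> exists C t0, 0 < t0 /\
         forall t y v, 0 < t < t0 -> K y -> admissible s P E nu t y v ->
           `|v - bN P t * H y| <= C / `|ln (sigma_half t)|)
    & (2^-1 < s -> exists C t0, 0 < t0 /\
         forall t y v, 0 < t < t0 -> K y -> admissible s P E nu t y v ->
           `|v - cNs P * H y| <= C * t `^ ((2 * s - 1) / 2))].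
Proof.
move=> n1 s01 kh oE EC1 EC3 K cK KE; split=> [s12|s12|s12].
- by have [be sbe EC] := EC1 s12; exact: (C1beta_below s01 kh oE sbe EC cK KE).
- have EC := EC3 (eq_ind_r (fun x => 2^-1 <= x) (lexx _) s12).
  exact: (C3_half n1 s01 kh oE EC cK KE).
- exact: (C3_above n1 s01 kh oE (EC3 (ltW s12)) cK KE).
Qed.
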